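(* Let $\Pi_\infty$ be a partially exchangeable random partition of $\mathbb{N}=\{1,2,\ldots\}$, and for each $n=0,1,2,\ldots$ let $(P^{(n)}_j)_{j\ge1}$ be the frequencies of the clusters of $\Pi_\infty$ in their order of appearance when $\Pi_\infty$ is restricted to $\{n+1,n+2,\ldots\}$. Then: (1) The sequence $\bigl((P^{(n)}_j)_{j\ge1},\ n=0,1,\ldots\bigr)$ is a Markov chain with stationary transition probabilities on the space of sub-probability distributions on $\mathbb{N}$. For $n\ge1$ the forwards transition mechanism from $(P^{(n-1)}_j)$ to $(P^{(n)}_j)$ is a top to random move: given $(P^{(n-1)}_j)=(P_j)$, the value of $(P^{(n)}_j)$ is $(P_2,P_3,\ldots)$ if $P_1=0$, and is $$(P_2,\ldots,P_X,P_1,P_{X+1},P_{X+2},\ldots)\quad\text{if }P_1>0,$$ for some random position $X\in\mathbb{N}$ with the proper conditional distribution $$\mathbb{P}[X>j\mid (P_j)]=\prod_{i=1}^{j}\Bigl(1-\frac{P_1}{1-P_2-P_3-\cdots-P_i}\Bigr),\qquad j=1,2,\ldots,$$ where the denominator for $i=1$ is $1$ (and for $X=1$ the new sequence is $(P_1,P_2,\ldots)$). (2) $\Pi_\infty$ is exchangeable if and only if the Markov chain $\bigl((P^{(n)}_j)_{j\ge1}\bigr)_{n\ge0}$ is stationary, meaning that $(P^{(n)}_j)_{j\ge1}$ has the same distribution as $(P^{(0)}_j)_{j\ge1}$ for $n=1$ and hence for all $n\ge1$. (3) If $\Pi_\infty$ is exchangeable, the reversed transition mechanism from $(P^{(n)}_j)$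 to $(P^{(n-1)}_j)$, for $n\ge 1$, is a random to top move: given $(P^{(n)}_j)$, with probability $1-\sum_jP^{(n)}_j$ the frequency $0$ is prepended to the sequence $(P^{(n)}_j)$; otherwise, with probability $P^{(n)}_j$ for each $j$, the frequency $P^{(n)}_j$ is removed from its place and put in place $1$.
   Context: Write $[n]=\{1,\ldots,n\}$. A random partition $\Pi_\infty$ of $\mathbb{N}$ is identified with the sequence $(\Pi_n)$ of its restrictions to $[n]$. The blocks of a partition are called clusters. Clusters are in order of appearance if they are listed in increasing order of their least elements (for the restriction to $\{n+1,n+2,\ldots\}$, least elements in that set, listing only clusters that meet it). $\Pi_\infty$ is exchangeable if for each $n$ the distribution of $\Pi_n$ is invariant under the natural action of permutations of $[n]$ on partitions of $[n]$. $\Pi_\infty$ is partially exchangeable if there is a function $p$ of finite sequences of positive integers such that for each $n$ and each partition $\{C_1,\ldots,C_k\}$ of $[n]$ with clusters $C_1,\ldots,C_k$ in order of appearance, $\mathbb{P}(\Pi_n=\{C_1,\ldots,C_k\})=p(\#C_1,\ldots,\#C_k)$. Every cluster $\mathcal{C}$ of a partially exchangeable random partition of $\mathbb{N}$ has an almost sure limiting relative frequency $\lim_n\#(\mathcal{C}\cap[n])/n$, called its frequency, which is almost surely $0$ iff the cluster is a singleton. If there are only finitely many clusters, the sequence of frequencies is continued by zeros. A sub-probability distribution on $\mathbb{N}$ is a sequence $(P_j)_{j\ge1}$ with $P_j\ge0$ and $\sum_jP_j\le1$. A distribution of $X$ is proper if $X<\infty$ almost surely. *)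

(* Defs.v *)
From mathcomp Require Import all_boot all_order all_algebra all_fingroup.
From mathcomp Require Import all_classical all_reals all_analysis.
Set Implicit Arguments.
Unset Strict Implicit.
Unset Printing Implicit Defensive.
Import Order.TTheory GRing.Theory Num.Theory.
Import numFieldNormedType.Exports.
Local Open Scope classical_set_scope.
Local Open Scope ring_scope.

(* Indices are shifted by one: i : nat stands for the element i + 1 of
   {1, 2, ...}, so that [n] is 'I_n, and {n+1, n+2, ...} is {i | n <= i}.
   Likewise x : nat -> R stands for (P_j)_{j >= 1} with P_j = x j.-1.
   The positions X and j in [move_top] and [top_gt_prob], however, are 1-based.
   A partition of the positive integers is given by its equivalence relation. *)

Section RandomPartition.
Context d (T : measurableType d) (R : realType) (P : probability T R).
Implicit Types (Pi : T -> rel nat).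

Definition random_partition Pi : Prop :=
  (forall w, equivalence_rel (Pi w)) /\
  (forall i j, measurable [set w | Pi w i j]).

Definition restr (E : rel nat) (n : nat) : {set {set 'I_n}} :=
  equivalence_partition (fun i j : 'I_n => E i j) [set: 'I_n].

Definition perm_act n (s : {perm 'I_n}) (Q : {set {set 'I_n}}) :
    {set {set 'I_n}} :=
  [set [set s i | i in B]%SET | B : {set 'I_n} in Q]%SET.

Definition exchangeable Pi : Prop :=
  forall (n : nat) (s : {perm 'I_n}) (Q : {set {set 'I_n}}),
    P [set w | perm_act s (restr (Pi w) n) = Q] =
    P [set w | restr (Pi w) n = Q].

(* The value n at the empty set is never used: clusters are nonempty. *)
Definition least n (B : {set 'I_n}) : nat := \big[minn/n]_(i in B) (i : nat).

Definition in_appearance_order n (C : seq {set 'I_n}) : bool :=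
  sorted (fun A B => (least A < least B)%N) C.

Definition partially_exchangeable Pi : Prop :=
  exists p : seq nat -> R,
    forall (n : nat) (C : seq {set 'I_n}),
      finset.partition [set:: C]%SET [set: 'I_n]%SET -> in_appearance_order C ->
      P [set w | restr (Pi w) n = [set:: C]%SET] =
      (p [seq #|B| | B : {set 'I_n} <- C])%:E.

End RandomPartition.

(* R^nat with the product sigma-algebra *)
Definition coord_cylinders (R : realType) : set (set (R ^nat)) :=
  [set C | exists j (B : set R), measurable B /\ C = [set x | B (x j)]].

Definition seq_space (R : realType) := g_sigma_algebraType (@coord_cylinders R).

Section Frequencies.
Variable R : realType.

(* #(C \cap [m]) / m, where C is the cluster of i *)
Definition rel_freq (E : rel nat) (i m : nat) : R :=
  #|[set j : 'I_m | E i j]%SET|%:R / m%:R.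

(* [limn] is total: it has a junk value when the limit does not exist, which
   for a partially exchangeable random partition is a null event. *)
Definition cluster_freq (E : rel nat) (i : nat) : R := limn (rel_freq E i).

(* i is the least element of its cluster restricted to {k | n <= k} *)
Definition is_least_from (E : rel nat) (n i : nat) : bool :=
  (n <= i)%N && all (fun k => ~~ E k i) (index_iota n i).

(* i is the least element of the j-th cluster (j counted from 0), in order of
   appearance, of the restriction of E to {k | n <= k} *)
Definition is_nth_least (E : rel nat) (n j i : nat) : bool :=
  is_least_from E n i && (count (is_least_from E n) (iota 0 i) == j).

(* (P^(n)_j)_j: the sequence is continued by zeros when fewer than j + 1
   clusters meet {k | n <= k}. *)
Definition freqs (E : rel nat) (n : nat) : R ^nat := fun j =>
  if pselect (exists i, is_nth_least E n j i) is left ex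
  then cluster_freq E (ex_minn ex) else 0.

Definition subprob : set (seq_space R) :=
  [set x | (forall j, 0 <= x j) /\
           (\sum_(0 <= j <oo) (x j)%:E <= 1%:E)%E].

End Frequencies.

Section Moves.
Variable R : realType.

Definition drop_top (x : R ^nat) : R ^nat := fun k => x k.+1.

(* (P_2, ..., P_X, P_1, P_{X+1}, ...) *)
Definition move_top (X : nat) (x : R ^nat) : R ^nat := fun k =>
  if (k.+1 < X)%N then x k.+1 else if k.+1 == X then x 0%N else x k.

(* \prod_{i=1}^j (1 - P_1 / (1 - P_2 - ... - P_i)) *)
Definition top_gt_prob (x : R ^nat) (j : nat) : R :=
  \prod_(1 <= i < j.+1) (1 - x 0%N / (1 - \sum_(2 <= m < i.+1) x m.-1)).

Definition prepend0 (x : R ^nat) : R ^nat := fun k =>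
  if k is k'.+1 then x k' else 0.

(* The entry of index j (counted from 0) is removed and put in front. *)
Definition move_to_top (j : nat) (x : R ^nat) : R ^nat := fun k =>
  if k == 0%N then x j else if (k <= j)%N then x k.-1 else x k.

End Moves.

Section TransitionLaws.
Local Open Scope ereal_scope.
Variable R : realType.

(* nu is the law of the result of a top to random move applied to x; in the
   case P_1 > 0, q is the law of X. Taking j = 0 says that X >= 1. *)
Definition top_to_random_law (x : seq_space R)
    (nu : set (seq_space R) -> \bar R) : Prop :=
  ((x 0%N = 0)%R -> forall B, measurable B ->
     nu B = \d_(drop_top x : seq_space R) B) /\
  ((0 < x 0%N)%R -> exists q : probability nat R,
     (forall j : nat, q [set X : nat | (j < X)%N] = (top_gt_prob x j)%:E) /\
     (forall B : set (seq_space R), measurable B ->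
        nu B = q [set X : nat | B (move_top X x)])).

Definition random_to_top_law (x : seq_space R)
    (nu : set (seq_space R) -> \bar R) : Prop :=
  forall B, measurable B ->
    nu B = (1 - \sum_(0 <= j <oo) (x j)%:E) *
             \d_(prepend0 x : seq_space R) B +
           \sum_(0 <= j <oo)
             (x j)%:E * \d_(move_to_top j x : seq_space R) B.

End TransitionLaws.

Section MarkovChain.
Local Open Scope ereal_scope.
Context d (T : measurableType d) d' (S : measurableType d') (R : realType).
Variable P : probability T R.

(* Conditionally given Y, the variable Z has law K Y. *)
Definition cond_law (K : R.-pker S ~> S) (Y Z : T -> S) : Prop :=
  forall A B : set S, measurable A -> measurable B ->
    P (Y @^-1` A `&` Z @^-1` B) = \int[P]_(w in Y @^-1` A) K (Y w) B.

(* M is a Markov chain with state space D, a measurable part of S, and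
   stationary transition probabilities K. *)
Definition markov_chain (D : set S) (K : R.-pker S ~> S) (M : nat -> T -> S) :
    Prop :=
  [/\ measurable D,
      (forall x, D x -> K x D = 1),
      (forall n, measurable_fun [set: T] (M n)),
      (forall n, {ae P, forall w, D (M n w)}) &
      forall (n : nat) (A : nat -> set S) (B : set S),
        (forall i, measurable (A i)) -> measurable B ->
        P ([set w | forall i, (i <= n)%N -> A i (M i w)] `&` M n.+1 @^-1` B) =
        \int[P]_(w in [set w | forall i, (i <= n)%N -> A i (M i w)])
          K (M n w) B].

Definition same_law (Y Z : T -> S) : Prop :=
  forall A : set S, measurable A -> P (Y @^-1` A) = P (Z @^-1` A).

End MarkovChain.

(* Main.v *)
From HB Require Import structures.
Require Import Defs.
From mathcomp Require Import all_boot all_order all_algebra all_fingroup.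
From mathcomp Require Import all_classical all_reals all_analysis.
From mathcomp Require Import measurable_realfun.
From mathcomp Require Import zify ring lra.
Set Implicit Arguments.
Unset Strict Implicit.
Unset Printing Implicit Defensive.
Import Order.TTheory GRing.Theory Num.Theory.
Import numFieldNormedType.Exports.
Local Open Scope classical_set_scope.
Local Open Scope ring_scope.

(** The frequencies are governed by prediction rules: given the n-th sequence
    of frequencies P_1, P_2, ... and the way in which n + 1, ..., m are
    clustered into k clusters, the next element joins the i-th cluster with
    probability P_i, and opens a new one with probability
    1 - P_1 - ... - P_k ([has_density_joins], [has_density_new]).

    They follow from swaps of neighbours. A swap of a and a + 1 changes the
    sequence of cluster sizes in order of appearance only if both elements are
    least in their clusters, so partial exchangeability makes all other swaps
    harmless ([pe_swap]). In particular, once an element i0 has been seen, all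
    later elements are equally likely to join its cluster. This remains true
    on events that such swaps preserve, the tail invariant events, among them
    every event on the sequences of frequencies from times 0 to n. Averaging
    over the later elements, the law of large numbers [avg_cvg_ae] replaces
    the probability of joining by the frequency of the cluster ([prob_join]).

    (1) Deleting the element n + 1 from {n + 1, n + 2, ...} acts on the
    sequence of frequencies in a deterministic way. If its cluster has no
    other element, the first entry is dropped, and this is the case of
    frequency 0 almost surely; otherwise the first entry moves to the place X,
    the number of clusters seen before the cluster comes back ([freqs_noret],
    [freqs_ret]). By the prediction rules the number of clusters seen while
    waiting is a chain that stays put, stops, or increases by 1 with explicit
    probabilities, and summing geometric series gives the product formula for
    the law of X ([wait_prob_series], [prob_top_position]). Since the rules
    hold on every tail invariant event, the whole past may be added to the
    condition, which is the Markov property ([markov_step]).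

    (2) Multiplying the prediction rules, the conditional probability of a
    finite pattern given the frequencies is the same function at all times
    ([pattern_density]). So if the first two sequences of frequencies have the
    same law, the law of the partition is invariant under shifts. To see that
    it is then exchangeable, it suffices to treat the swap of a and a + 1, and
    by invariance the swap can be made far away, at b and b + 1. The only
    obstacle is that both are least in their clusters. But an element has only
    one least element in its cluster, so the probabilities that b is least in
    a cluster containing b + 1 are summable in b, and the probability that b
    is least and has company within a bounded distance tends to 0; and a swap
    of two elements without company in a window does not change the pattern
    seen there ([stationary_swap_bound]). Conversely, an exchangeable law is
    invariant under shifts, since on finite sets of elements a shift agrees
    with a finite permutation.

    (3) For an exchangeable law the first element can be placed after m others
    by a rotation. By the prediction rule it then joins their j-th cluster
    with probability P_j; m tends to infinity ([prob_joins_top]). Adding the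
    first element undoes the top to random move: it brings the cluster joined
    to the front, or puts the frequency 0 there ([freqs_joins_top],
    [freqs_not_joins]). *)

(** * Counting, and the order of appearance *)

Local Notation cnt y i := (count y (iota 0 i)).
(** One representative per cluster, its least element from n on: counting
    representatives gives the rank of a cluster in order of appearance. *)
Local Notation L := is_least_from.

Lemma cntS (y : pred nat) n : cnt y n.+1 = (cnt y n + y n)%N.
Proof. by rewrite -addn1 iotaD count_cat /= add0n addn0. Qed.

Lemma cnt_le (y : pred nat) n : (cnt y n <= n)%N.
Proof. by rewrite (leq_trans (count_size _ _)) ?size_iota. Qed.

Lemma cnt_addn (y : pred nat) m n :
  cnt y (m + n) = (cnt y m + cnt (fun k => y (m + k)) n)%N.
Proof. by rewrite iotaD count_cat add0n -{2}[m]addn0 iotaDl count_map. Qed.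

Lemma cnt_homo (y : pred nat) m n : (m <= n)%N -> (cnt y m <= cnt y n)%N.
Proof. by move=> /subnKC <-; rewrite cnt_addn leq_addr. Qed.

Lemma eq_cnt (y z : pred nat) n : (forall k, (k < n)%N -> y k = z k) ->
  cnt y n = cnt z n.
Proof.
by move=> yz; apply: eq_in_count => k; rewrite mem_iota add0n => /= /yz.
Qed.

Lemma cnt0 (y : pred nat) n : (forall k, (k < n)%N -> ~~ y k) -> cnt y n = 0%N.
Proof.
move=> y0; apply/eqP; rewrite -leqn0 leqNgt -has_count; apply/hasPn => k.
by rewrite mem_iota add0n => /= /y0.
Qed.

Lemma is_least_fromP (E : rel nat) n i :
  reflect ((n <= i)%N /\ forall k, (n <= k < i)%N -> ~~ E k i) (L E n i).
Proof.
apply: (iffP andP) => -[ni /= H]; split => //.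
  by move=> k nki; move/allP: H; apply; rewrite mem_index_iota.
by apply/allP => k; rewrite mem_index_iota; exact: H.
Qed.

Lemma nth_least_lt (E : rel nat) n j i m : is_nth_least E n j i ->
  (i < m)%N -> (j < cnt (L E n) m)%N.
Proof.
move=> /andP[Li /eqP <-] im.
by apply: leq_trans (cnt_homo _ im); rewrite cntS Li addn1.
Qed.

Lemma nth_least_ge (E : rel nat) n j i m : is_nth_least E n j i ->
  (m <= i)%N -> (cnt (L E n) m <= j)%N.
Proof. by move=> /andP[_ /eqP <-] mi; exact: cnt_homo. Qed.

Lemma nth_least_uniq (E : rel nat) n j i i' :
  is_nth_least E n j i -> is_nth_least E n j i' -> i = i'.
Proof.
move=> H H'; case: (ltngtP i i') => // lt.
  by have := nth_least_lt H lt; move: H' => /andP[_ /eqP->]; rewrite ltnn.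
by have := nth_least_lt H' lt; move: H => /andP[_ /eqP->]; rewrite ltnn.
Qed.

Lemma nth_least_ex (E : rel nat) n j m : (j < cnt (L E n) m)%N ->
  exists2 i, (i < m)%N & is_nth_least E n j i.
Proof.
elim: m => // m IH; rewrite cntS.
have [jm|mj] := ltnP j (cnt (L E n) m).
  by have [i im H] := IH jm; exists i => //; exact: ltnW.
case Lm : (L E n m); last by rewrite addn0 ltnNge mj.
rewrite addn1 ltnS => jm; exists m => //.
by rewrite /is_nth_least Lm /= eqn_leq mj jm.
Qed.

Lemma nth_least_nat_ge (E : rel nat) n j i : is_nth_least E n j i -> (n <= i)%N.
Proof. by move=> /andP[/is_least_fromP[]]. Qed.

Section freqs.
Variable R : realType.
Implicit Types E : rel nat.

Lemma freqsE E n j i : is_nth_least E n j i ->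
  freqs R E n j = cluster_freq R E i.
Proof.
move=> Hi; rewrite /freqs; case: pselect => [ex|[]]; last by exists i.
by case: ex_minnP => i' Hi' _; rewrite (nth_least_uniq Hi Hi').
Qed.

Lemma freqs0 E n j : (forall i, ~~ is_nth_least E n j i) -> freqs R E n j = 0.
Proof.
move=> H; rewrite /freqs; case: pselect => // -[i Hi].
by have := H i; rewrite Hi.
Qed.

Lemma freqs_eq E E' n n' j j' :
  (forall i, is_nth_least E n j i -> exists2 i', is_nth_least E' n' j' i' &
     cluster_freq R E i = cluster_freq R E' i') ->
  (forall i', is_nth_least E' n' j' i' -> exists i, is_nth_least E n j i) ->
  freqs R E n j = freqs R E' n' j'.
Proof.
move=> H H'.
have [[i Hi]|Hn] := pselect (exists i, is_nth_least E n j i).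
  by have [i' Hi' e] := H i Hi; rewrite (freqsE Hi) (freqsE Hi').
rewrite !freqs0// => i; apply/negP => Hi; apply: Hn; last by exists i.
exact: H' Hi.
Qed.

Lemma least_rep E n m : equivalence_rel E -> (n <= m)%N ->
  exists2 i, L E n i & (n <= i <= m)%N && E i m.
Proof.
move=> eqE nm.
have ex : exists i, (n <= i)%N && E i m by exists m; rewrite nm (eqE m m m).1.
case: (ex_minnP ex) => i /andP[ni Eim] min; exists i; last first.
  by rewrite ni Eim !andbT; apply: min; rewrite nm (eqE m m m).1.
apply/is_least_fromP; split=> // k /andP[nk ki]; apply/negP => Eki.
have := min k; rewrite nk (eqE k i m).2// Eim => /(_ isT).
by rewrite leqNgt ki.
Qed.

Lemma equiv_sym E i j : equivalence_rel E -> E i j = E j i.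
Proof.
move=> eqE; apply/idP/idP => h.
  by rewrite -(eqE i j i).2// (eqE i i i).1.
by rewrite -(eqE j i j).2// (eqE j j j).1.
Qed.

Lemma cluster_freq_class E i j : equivalence_rel E -> E i j ->
  cluster_freq R E i = cluster_freq R E j.
Proof.
move=> eqE Eij; rewrite /cluster_freq; congr (limn _); apply/funext => m.
rewrite /rel_freq; congr (_ / _); congr (_%:R); apply: eq_card => k.
by rewrite !inE (eqE i j k).2.
Qed.

Definition avg (y : pred nat) (N : nat) : R := (cnt y N)%:R / N%:R.

Lemma rel_freqE E i : rel_freq R E i = avg (E i).
Proof.
apply/funext => m; rewrite /rel_freq /avg; congr (_ / _); congr (_%:R).
rewrite -sum1_card -sum1_count.
have -> : iota 0 m = index_iota 0 m by rewrite /index_iota subn0.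
rewrite big_mkord.
by apply: eq_bigl => k; rewrite inE.
Qed.

(** The image filter of a sequence depends only on its tail, so the limits
    agree even when they are junk values: cluster frequencies can be compared
    before they are known to exist. *)
Lemma limn_near_eq (u v : R^nat) M : (forall m, (M <= m)%N -> u m = v m) ->
  limn u = limn v.
Proof.
move=> uv; congr (lim _); apply/funext => A; apply/propext; split.
  by move=> [N _ H]; exists (maxn M N) => // m /=; rewrite geq_max => /andP[Mm Nm];
    rewrite -uv//; exact: H.
by move=> [N _ H]; exists (maxn M N) => // m /=; rewrite geq_max => /andP[Mm Nm];
    rewrite uv//; exact: H.
Qed.

(** Dropping n terms changes the average of N terms by at most n / N. *)
Lemma avg_shift_cvg (y : pred nat) n (l : R) :
  avg (fun k => y (n + k)%N) @ \oo --> l <-> avg y @ \oo --> l.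
Proof.
have small : (fun N => n%:R / N%:R : R) @ \oo --> (0 : R).
  rewrite -(mulr0 n%:R); apply: cvgM; first exact: cvg_cst.
  by rewrite -(cvg_shiftS (fun N : nat => N%:R^-1 : R)); exact: cvg_harmonic.
have dist N : `|avg y N - avg (fun k => y (n + k)%N) N| <= n%:R / N%:R.
  rewrite /avg -mulrBl normrM (ger0_norm (_ : 0 <= N%:R^-1)) ?invr_ge0//.
  rewrite ler_wpM2r ?invr_ge0//.
  have := cnt_addn y n N; have := cnt_addn y N n; rewrite addnC => -> e.
  have := cnt_le y n; have := cnt_le (fun k => y (N + k)%N) n.
  move: e; move: (cnt y N) (cnt (fun k => y (N + k)%N) n) (cnt y n).
  move: (cnt (fun k => y (n + k)%N) N) => c' c b a e hb ha.
  have e' : (c%:R + b%:R = a%:R + c'%:R :> R) by rewrite -!natrD e.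
  have : b%:R <= n%:R :> R by rewrite ler_nat.
  have : a%:R <= n%:R :> R by rewrite ler_nat.
  have : 0 <= a%:R :> R by rewrite ler0n.
  have : 0 <= b%:R :> R by rewrite ler0n.
  by move=> *; rewrite ler_norml; apply/andP; split; lra.
have d0 : (fun N => avg y N - avg (fun k => y (n + k)%N) N) @ \oo --> (0 : R).
  apply/norm_cvg0P.
  apply: (@squeeze_cvgr _ _ _ _ (fun=> 0) (fun N : nat => n%:R / N%:R)) => //.
    by apply: nearW => N /=; rewrite normr_ge0 dist.
  exact: cvg_cst.
split=> h.
  rewrite -[l]add0r; suff -> : avg y = (fun N => avg y N -
    avg (fun k => y (n + k)%N) N) + avg (fun k => y (n + k)%N) by exact: cvgD.
  by apply/funext => N; rewrite fctE /= subrK.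
rewrite -[l]subr0; suff -> : avg (fun k => y (n + k)%N) = avg y - (fun N =>
  avg y N - avg (fun k => y (n + k)%N) N) by exact: cvgB.
by apply/funext => N; rewrite fctE /= subKr.
Qed.

End freqs.

(** * Swapping two neighbours *)

Definition relabel (s : nat -> nat) (E : nat -> nat -> bool) :
    nat -> nat -> bool :=
  fun i j => E (s i) (s j).

Definition swapn (a i : nat) : nat :=
  if i == a then a.+1 else if i == a.+1 then a else i.

Lemma relabel_equiv s E : equivalence_rel E -> equivalence_rel (relabel s E).
Proof. by move=> eqE i j k; exact: eqE. Qed.

Lemma swapnL a : swapn a a = a.+1. Proof. by rewrite /swapn eqxx. Qed.

Lemma swapnR a : swapn a a.+1 = a.
Proof. by rewrite /swapn eqxx eqn_leq ltnn. Qed.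

Lemma swapn_neq a i : i != a -> i != a.+1 -> swapn a i = i.
Proof. by rewrite /swapn => /negPf-> /negPf->. Qed.

Lemma swapn_lt a i : (i < a)%N -> swapn a i = i.
Proof. by move=> ia; rewrite swapn_neq//; lia. Qed.

Lemma swapn_gt a i : (a.+1 < i)%N -> swapn a i = i.
Proof. by move=> ia; rewrite swapn_neq//; lia. Qed.

Lemma swapnK a : involutive (swapn a).
Proof.
move=> i; have [->|ia] := eqVneq i a; first by rewrite swapnL swapnR.
have [->|ia1] := eqVneq i a.+1; first by rewrite swapnR swapnL.
by rewrite !swapn_neq.
Qed.

Lemma relabel_swapK a : involutive (relabel (swapn a)).
Proof. by move=> E; apply/funext => i; apply/funext => j; rewrite /relabel !swapnK. Qed.

Lemma cnt_swap (y : pred nat) a m : (a.+2 <= m)%N ->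
  cnt (fun k => y (swapn a k)) m = cnt y m.
Proof.
move=> /subnKC <-; rewrite !cnt_addn !cntS swapnL swapnR.
congr (_ + _)%N.
  rewrite -!addnA; congr (_ + _)%N; last by rewrite addnC.
  by apply: eq_cnt => k /swapn_lt ->.
by apply: eq_cnt => k _; rewrite swapn_gt//; lia.
Qed.

Lemma relabel_swap_same E a : equivalence_rel E -> E a a.+1 ->
  relabel (swapn a) E = E.
Proof.
move=> eqE Ea; have sw i j : E (swapn a i) j = E i j.
  rewrite /swapn; case: eqP => [->|_]; first by rewrite -(eqE a a.+1 j).2.
  by case: eqP => [->|//]; rewrite (eqE a a.+1 j).2.
apply/funext => i; apply/funext => j; rewrite /relabel sw (equiv_sym _ _ eqE).
by rewrite sw (equiv_sym _ _ eqE).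
Qed.

Lemma swapn_range a n i k : (n <= a)%N -> (a.+1 < i)%N ->
  (n <= swapn a k < i)%N = (n <= k < i)%N.
Proof.
by rewrite /swapn; case: eqP => [->|_]; [|case: eqP => [->|_]]; lia.
Qed.

(** Distinct clusters just exchange the roles of a and a + 1, since no third
    element lies between them. *)
Lemma least_swap E n a i : equivalence_rel E -> (n <= a)%N -> ~~ E a a.+1 ->
  L (relabel (swapn a) E) n i = L E n (swapn a i).
Proof.
move=> eqE na nE.
have [ia|ia] := ltnP i a.
  rewrite swapn_lt//; apply/is_least_fromP/is_least_fromP => -[ni H]; split=> // k /[dup] /andP[_ ki] /H;
  by rewrite /relabel !swapn_lt// (ltn_trans ki).
have [->|ia'] := eqVneq i a.
  rewrite swapnL; apply/is_least_fromP/is_least_fromP => -[ni H]; split; [lia| |lia|].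
    move=> k /andP[nk]; rewrite ltnS leq_eqVlt => /predU1P[->//|ka].
    by have := H k; rewrite nk ka /relabel swapnL swapn_lt//; exact.
  move=> k /andP[nk ka]; rewrite /relabel swapnL swapn_lt//; apply: H.
  by rewrite nk ltnS ltnW.
have [->|ia1] := eqVneq i a.+1.
  rewrite swapnR; apply/is_least_fromP/is_least_fromP => -[ni H]; split; [lia| |lia|].
    move=> k /andP[nk ka]; have := H k; rewrite /relabel swapnR swapn_lt//.
    by rewrite nk ltnS ltnW//; exact.
  move=> k /andP[nk]; rewrite ltnS leq_eqVlt => /predU1P[->|ka].
    by rewrite /relabel swapnL swapnR (equiv_sym _ _ eqE).
  by rewrite /relabel swapnR swapn_lt//; apply: H; rewrite nk.
have ia2 : (a.+1 < i)%N by lia.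
rewrite swapn_gt//; apply/is_least_fromP/is_least_fromP => -[ni H]; split=> // k nki.
  have := H (swapn a k); rewrite swapn_range// /relabel swapnK swapn_gt//.
  exact.
by rewrite /relabel [swapn a i]swapn_gt//; apply: H; rewrite swapn_range.
Qed.

Section swap_frequencies.
Variable R : realType.

Lemma cluster_freq_swap E a i :
  cluster_freq R (relabel (swapn a) E) i = cluster_freq R E (swapn a i).
Proof.
rewrite /cluster_freq !rel_freqE; apply: (@limn_near_eq _ _ _ a.+2) => m am.
by rewrite /avg /relabel (cnt_swap (E (swapn a i))).
Qed.

(** Since a is not least in its cluster, at most one of a and a + 1 represents
    a cluster, so the order of appearance is kept. *)
Lemma nth_least_swap E n a i0 j i : equivalence_rel E ->
  (n <= i0 < a)%N -> E i0 a -> ~~ E a a.+1 ->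
  is_nth_least (relabel (swapn a) E) n j i = is_nth_least E n j (swapn a i).
Proof.
move=> eqE /andP[ni0 i0a] Ei0 nE; have na : (n <= a)%N by lia.
have La : L E n a = false.
  by apply/negP => /is_least_fromP[_ /(_ i0)]; rewrite ni0 i0a Ei0 => /(_ isT).
rewrite /is_nth_least least_swap//.
have [Ls/=|//] := boolP (L E n (swapn a i)); congr (_ == _).
rewrite (@eq_count _ _ (fun k => L E n (swapn a k))); last first.
  by move=> k; rewrite least_swap.
have base k : (k <= a)%N -> cnt (fun k => L E n (swapn a k)) k = cnt (L E n) k.
  by move=> ka; apply: eq_cnt => k' k'k; rewrite swapn_lt// (leq_trans k'k).
have [ia|ia] := ltnP i a; first by rewrite swapn_lt// base// ltnW.
have [ea|ia'] := eqVneq i a; first by rewrite ea swapnL base// cntS La addn0.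
have [ea|ia1] := eqVneq i a.+1; first by rewrite ea swapnR La in Ls.
by rewrite swapn_gt; [rewrite cnt_swap//|]; lia.
Qed.

Lemma freqs_swap E n a i0 : equivalence_rel E -> (n <= i0 < a)%N -> E i0 a ->
  freqs R (relabel (swapn a) E) n = freqs R E n.
Proof.
move=> eqE ni0 Ei0; have [Ea|nE] := boolP (E a a.+1).
  by rewrite relabel_swap_same.
apply/funext => j; apply: freqs_eq => i.
  rewrite (nth_least_swap _ _ eqE ni0 Ei0 nE) => Hi; exists (swapn a i) => //.
  exact: cluster_freq_swap.
move=> Hi; exists (swapn a i).
by rewrite (nth_least_swap _ _ eqE ni0 Ei0 nE) swapnK.
Qed.

End swap_frequencies.

Definition cluster_sizes (E : rel nat) (m : nat) : seq nat :=
  [seq cnt (E i) m | i <- iota 0 m & L E 0 i].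

(** The order of appearance changes only when two representatives trade
    places. *)
Lemma cluster_sizes_swap E a m : equivalence_rel E -> (a.+2 <= m)%N ->
  ~~ (L E 0 a && L E 0 a.+1) ->
  cluster_sizes (relabel (swapn a) E) m = cluster_sizes E m.
Proof.
move=> eqE am nL; have [Ea|nE] := boolP (E a a.+1).
  by rewrite relabel_swap_same.
rewrite /cluster_sizes.
have cE i : cnt (relabel (swapn a) E i) m = cnt (E (swapn a i)) m.
  exact: (cnt_swap (E (swapn a i))).
rewrite (eq_map cE) (eq_filter (fun i => least_swap i eqE (leq0n a) nE)).
rewrite -(subnKC am) iotaD !filter_cat !map_cat add0n; congr (_ ++ _); last first.
  rewrite (@eq_in_filter _ _ (L E 0)); last first.
    by move=> k; rewrite mem_iota => /andP[ak _]; rewrite swapn_gt.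
  apply/eq_in_map => k; rewrite mem_filter mem_iota => /and3P[_ ak _].
  by rewrite swapn_gt.
rewrite -addn2 iotaD !filter_cat !map_cat add0n; congr (_ ++ _).
  rewrite (@eq_in_filter _ _ (L E 0)); last first.
    by move=> k; rewrite mem_iota => /andP[_ ak]; rewrite swapn_lt.
  apply/eq_in_map => k; rewrite mem_filter mem_iota => /and3P[_ _ ak].
  by rewrite swapn_lt.
rewrite /= swapnL swapnR; move: nL.
by case: (L E 0 a); case: (L E 0 a.+1) => //=; rewrite ?swapnL ?swapnR.
Qed.

(** * From one restriction to the next *)

Section first_return.
Variables (R : realType) (E : rel nat) (n : nat).
Hypothesis eqE : equivalence_rel E.

Definition returns (k : nat) := (n < k)%N && E n k.

Lemma least_self : L E n n.
Proof. by apply/is_least_fromP; split=> // k; lia. Qed.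

Lemma cnt_least_n m : (m <= n)%N -> cnt (L E n) m = 0%N.
Proof.
move=> mn; apply: cnt0 => k km; apply/negP => /is_least_fromP[nk _]; lia.
Qed.

Lemma nth_least0 : is_nth_least E n 0 n.
Proof. by rewrite /is_nth_least least_self cnt_least_n. Qed.

Lemma freqs_head : freqs R E n 0%N = cluster_freq R E n.
Proof. exact: freqsE nth_least0. Qed.

Section no_return.
Hypothesis nret : forall k, ~~ returns k.

Lemma least_noret i : (n < i)%N -> L E n.+1 i = L E n i.
Proof.
move=> ni; apply/is_least_fromP/is_least_fromP => -[_ H]; [split=> [|k nki]; first exact: ltnW|split=> // k nki].
  have [->|kn] := eqVneq k n; last by apply: H; lia.
  by have := nret i; rewrite /returns ni.
by apply: H; lia.
Qed.

Lemma cnt_least_noret i : (n < i)%N -> cnt (L E n) i = (cnt (L E n.+1) i).+1.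
Proof.
elim: i => // i IH; rewrite ltnS leq_eqVlt => /predU1P[<-|ni].
  rewrite !cntS cnt_least_n// least_self add0n.
  have -> : L E n.+1 n = false by apply/negP => /is_least_fromP[]; rewrite ltnn.
  rewrite addn0; congr (_.+1); apply/esym/cnt0 => k km.
  by apply/negP => /is_least_fromP[nk _]; lia.
by rewrite !cntS IH// least_noret// addSn.
Qed.

(** The first cluster is the singleton {n}; without it the others move up. *)
Lemma freqs_noret : freqs R E n.+1 = drop_top (freqs R E n).
Proof.
apply/funext => j; rewrite /drop_top.
have H i : is_nth_least E n.+1 j i = is_nth_least E n j.+1 i.
  have [ni|ni] := ltnP n i.
    by rewrite /is_nth_least least_noret// cnt_least_noret// eqSS.
  rewrite /is_nth_least.
  have -> : L E n.+1 i = false by apply/negP => /is_least_fromP[]; lia.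
  by rewrite cnt_least_n//= andbF.
by apply: freqs_eq => i; rewrite ?H => Hi; exists i => //; rewrite H.
Qed.

End no_return.

Section at_return.
Variable rho : nat.
Hypothesis ret : returns rho.
Hypothesis no_earlier : forall k, (n < k < rho)%N -> ~~ E n k.

(** When n is taken away, the next element rho of its cluster becomes the
    representative. *)
Lemma least_ret i : (n < i)%N -> L E n.+1 i = L E n i || (i == rho).
Proof.
move: ret => /andP[nr Er] ni; apply/is_least_fromP/orP => [[_ H]|[/is_least_fromP[_ H]|/eqP ->]].
- have [|ir] := eqVneq i rho; first by right.
  left; apply/is_least_fromP; split=> [|k nki]; first exact: ltnW.
  have [->|kn] := eqVneq k n; last by apply: H; lia.
  apply/negP => Eni; case: (ltngtP i rho) => ir'.
  + by have := @no_earlier i; rewrite ni ir' Eni => /(_ isT).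
  + by have := H rho; rewrite nr ir' -(eqE n rho i).2// Eni => /(_ isT).
  + by move: ir; rewrite ir' eqxx.
- by split=> // k nki; apply: H; lia.
- split=> // k nki; rewrite (equiv_sym _ _ eqE) -(eqE n rho k).2//.
  exact: no_earlier.
Qed.

Lemma least_rho : L E n rho = false.
Proof.
move: ret => /andP[nr Er].
by apply/negP => /is_least_fromP[_ /(_ n)]; rewrite leqnn nr Er => /(_ isT).
Qed.

Lemma cnt_least_ret i : (n < i)%N ->
  (cnt (L E n) i + (rho < i))%N = (cnt (L E n.+1) i).+1.
Proof.
move: (ret) => /andP[nr Er].
elim: i => // i IH; rewrite ltnS leq_eqVlt => /predU1P[<-|ni].
  rewrite !cntS cnt_least_n// least_self add0n.
  have -> : L E n.+1 n = false by apply/negP => /is_least_fromP[]; rewrite ltnn.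
  have -> : (rho < n.+1)%N = false by lia.
  rewrite !addn0; congr (_.+1); apply/esym/cnt0 => k km.
  by apply/negP => /is_least_fromP[nk _]; lia.
rewrite !cntS -addSn -(IH ni) least_ret//; have [->|ir] := eqVneq i rho.
  by rewrite least_rho ltnSn ltnn/= !addn0.
by rewrite orbF; lia.
Qed.

(** The clusters that appear between n and rho move up one place, that of n
    reappears just behind them, and those that appear after rho keep their
    places. *)
Lemma freqs_ret : freqs R E n.+1 = move_top (cnt (L E n) rho) (freqs R E n).
Proof.
move: (ret) => /andP[nr Er].
have small i : (i <= n)%N -> L E n.+1 i = false.
  by move=> ni; apply/negP => /is_least_fromP[]; lia.
have Hr : cnt (L E n) rho = (cnt (L E n.+1) rho).+1.
  by rewrite -cnt_least_ret// ltnn addn0.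
apply/funext => j; rewrite /move_top; case: (ltngtP j.+1 (cnt (L E n) rho)) => jX.
- suff H i : is_nth_least E n.+1 j i = is_nth_least E n j.+1 i.
    by apply: freqs_eq => i; rewrite ?H => Hi; exists i => //; rewrite H.
  have [ni|ni] := ltnP n i; last first.
    by rewrite /is_nth_least small// cnt_least_n// andbF.
  have [ir|ir] := ltnP i rho.
    rewrite /is_nth_least least_ret// -[X in _ && X]eqSS -cnt_least_ret//.
    by rewrite ltnNge ltnW// addn0 (ltn_eqF ir) orbF.
  apply/idP/idP => Hi.
    by have := nth_least_ge Hi ir; lia.
  by have := nth_least_ge Hi ir; lia.
- suff H i : is_nth_least E n.+1 j i = is_nth_least E n j i.
    by apply: freqs_eq => i; rewrite ?H => Hi; exists i => //; rewrite H.
  have [ni|ni] := ltnP n i; last first.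
    rewrite /is_nth_least small// cnt_least_n//; apply/esym/negbTE/negP.
    move=> /andP[_ /eqP jj]; move: jX Hr; rewrite -jj.
    by have := cnt_homo (L E n) nr; rewrite cntS least_self; lia.
  have [ir|ir] := leqP i rho; last first.
    rewrite /is_nth_least least_ret// -[X in _ && X]eqSS -cnt_least_ret//.
    by rewrite ir (gtn_eqF ir) orbF addn1 eqSS.
  apply/idP/idP => Hi.
    move: Hi => /andP[_ /eqP jj]; move: jX; rewrite Hr -jj.
    by have := cnt_homo (L E n.+1) ir; lia.
  have ir' : (i < rho)%N.
    rewrite ltn_neqAle ir andbT; apply/eqP => ir'.
    by move: Hi; rewrite ir' /is_nth_least least_rho.
  by have := nth_least_lt Hi ir'; lia.
- have Hrho : is_nth_least E n.+1 j rho.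
    by rewrite /is_nth_least least_ret// eqxx orbT -[X in _ && X]eqSS -Hr jX/=.
  by rewrite (freqsE _ Hrho) freqs_head (cluster_freq_class R eqE Er).
Qed.

End at_return.
End first_return.

Lemma move_topK (R : realType) j (x : R^nat) :
  move_to_top j (move_top j.+1 x) = x.
Proof.
apply/funext => k; rewrite /move_to_top /move_top; case: k => [|k] /=.
  by rewrite ltnn eqxx.
have [kj|jk] := ltnP k j; first by rewrite ltnS kj.
by rewrite !ifF//; lia.
Qed.

Lemma drop_topK (R : realType) (x : R^nat) : x 0%N = 0 ->
  prepend0 (drop_top x) = x.
Proof. by move=> x0; apply/funext => -[|k]. Qed.

(** * Shifts and rotations *)

Section shift.
Variables (R : realType) (E : rel nat) (n : nat).

Lemma least_shift k i : L (relabel (addn n) E) k i = L E (n + k) (n + i).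
Proof.
apply/is_least_fromP/is_least_fromP => -[ki H]; split; rewrite ?leq_add2l// in ki *.
  by move=> l nkl; have := H (l - n)%N; rewrite /relabel subnKC; [apply|]; lia.
by move=> l kl; rewrite /relabel; apply: H; rewrite leq_add2l ltn_add2l.
Qed.

Lemma nth_least_shift k j i :
  is_nth_least (relabel (addn n) E) k j i = is_nth_least E (n + k) j (n + i).
Proof.
rewrite /is_nth_least least_shift; congr (_ && (_ == _)).
rewrite cnt_addn (@cnt_least_n E (n + k) n) ?leq_addr// add0n.
by apply: eq_cnt => l _; rewrite least_shift.
Qed.

Definition has_freqs (F : rel nat) : Prop :=
  forall i, cvgn (rel_freq R F i).

Lemma cluster_freq_shift i : has_freqs E ->
  cluster_freq R (relabel (addn n) E) i = cluster_freq R E (n + i).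
Proof.
move=> /(_ (n + i)%N); rewrite /cluster_freq !rel_freqE => h.
by apply/cvg_lim => //; apply/avg_shift_cvg.
Qed.

Lemma freqs_shift k : has_freqs E ->
  freqs R (relabel (addn n) E) k = freqs R E (n + k).
Proof.
move=> h; apply/funext => j; apply: freqs_eq => i.
  by rewrite nth_least_shift => Hi; exists (n + i)%N => //; exact: cluster_freq_shift.
move=> Hi; exists (i - n)%N; rewrite nth_least_shift subnKC//.
by have := nth_least_nat_ge Hi; lia.
Qed.

End shift.

(** After relabelling by this permutation the old element 0 stands at place m,
    and the old elements 1, ..., m stand at places 0, ..., m - 1. *)
Definition rot_nat (m i : nat) : nat :=
  if (i < m)%N then i.+1 else if i == m then 0%N else i.

Section rotation.
Variable R : realType.

Lemma rot_nat_lt m i : (i < m)%N -> rot_nat m i = i.+1.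
Proof. by rewrite /rot_nat => ->. Qed.

Lemma rot_natm m : rot_nat m m = 0%N.
Proof. by rewrite /rot_nat ltnn eqxx. Qed.

Lemma rot_nat_gt m i : (m < i)%N -> rot_nat m i = i.
Proof. by move=> mi; rewrite /rot_nat ltnNge ltnW//= gtn_eqF. Qed.

Lemma cnt_rot (y : pred nat) m k : (m < k)%N ->
  cnt (fun i => y (rot_nat m i)) k = cnt y k.
Proof.
move=> /subnKC <-; rewrite !cnt_addn; congr (_ + _)%N; last first.
  by apply: eq_cnt => i _; rewrite rot_nat_gt// leq_addr.
rewrite cntS rot_natm -[in RHS]add1n cnt_addn /= addn0 addnC; congr (_ + _)%N.
by apply: eq_cnt => i im; rewrite rot_nat_lt.
Qed.

Lemma cluster_freq_rot E m i :
  cluster_freq R (relabel (rot_nat m) E) i = cluster_freq R E (rot_nat m i).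
Proof.
rewrite /cluster_freq !rel_freqE; apply: (@limn_near_eq _ _ _ m.+1) => k mk.
by rewrite /avg /relabel (cnt_rot (E (rot_nat m i))).
Qed.

Variables (E : rel nat) (m i0 : nat).
Hypotheses (eqE : equivalence_rel E) (i0m : (i0 < m)%N) (Ei0 : E 0%N i0.+1).

(** Placed after the member i0 + 1 of its cluster, the element 0 represents no
    cluster. *)
Lemma least_rot i : L (relabel (rot_nat m) E) 0 i = L E 1 (rot_nat m i).
Proof.
case: (ltngtP i m) => im.
- rewrite rot_nat_lt//; apply/is_least_fromP/is_least_fromP => -[_ H]; split=> // k.
    move=> /andP[k0 ki]; have := H k.-1; rewrite /relabel !rot_nat_lt//; [|lia].
    by rewrite prednK//; apply; lia.
  by move=> ki; rewrite /relabel !rot_nat_lt//; [apply: H; lia|lia].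
- rewrite rot_nat_gt//; apply/is_least_fromP/is_least_fromP => -[_ H]; split=> //; first by lia.
    move=> k /andP[k0 ki]; have [mk|km] := ltnP m k.
      by have := H k; rewrite /relabel !rot_nat_gt//; apply; rewrite ki.
    have := H k.-1; rewrite /relabel rot_nat_lt ?prednK// rot_nat_gt//.
    by apply; lia.
  move=> k /andP[_ ki]; rewrite /relabel [rot_nat m i]rot_nat_gt//.
  case: (ltngtP k m) => km.
  + by rewrite rot_nat_lt//; apply: H; lia.
  + by rewrite rot_nat_gt//; apply: H; lia.
  + by rewrite km rot_natm (eqE 0%N i0.+1 i).2//; apply: H; lia.
- rewrite im rot_natm; have -> : L E 1 0 = false by apply/negP => /is_least_fromP[].
  apply/negP => /is_least_fromP[_ /(_ i0)]; rewrite leq0n i0m /relabel rot_natm.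
  by rewrite rot_nat_lt// (equiv_sym _ _ eqE) Ei0 => /(_ isT).
Qed.

Lemma nth_least_rot j i :
  is_nth_least (relabel (rot_nat m) E) 0 j i = is_nth_least E 1 j (rot_nat m i).
Proof.
rewrite /is_nth_least least_rot.
have [Ls/=|//] := boolP (L E 1 (rot_nat m i)); congr (_ == _).
rewrite (@eq_count _ _ (fun k => L E 1 (rot_nat m k))); last first.
  by move=> k; rewrite least_rot.
case: (ltngtP i m) => im.
- rewrite rot_nat_lt// -[i.+1]add1n cnt_addn [cnt _ 1]cntS /= add0n.
  by apply: eq_cnt => k ki; rewrite rot_nat_lt// (ltn_trans ki).
- by rewrite [in RHS]rot_nat_gt// cnt_rot.
- by move: Ls; rewrite im rot_natm => /is_least_fromP[].
Qed.

Lemma freqs_rot : freqs R (relabel (rot_nat m) E) 0 = freqs R E 1.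
Proof.
apply/funext => j; apply: freqs_eq => i.
  rewrite nth_least_rot => Hi; exists (rot_nat m i) => //.
  exact: cluster_freq_rot.
move=> Hi; have i1 := nth_least_nat_ge Hi.
have [im|mi] := leqP i m.
  by exists i.-1; rewrite nth_least_rot rot_nat_lt prednK.
by exists i; rewrite nth_least_rot rot_nat_gt.
Qed.

End rotation.

(** * The space of relations *)

(** A random partition is a random element of the space of all relations,
    whose measurable sets are the events that can be asked about it. *)
Definition rel_cylinders : set (set (nat -> nat -> bool)) :=
  [set C | exists i j, C = [set E : nat -> nat -> bool | E i j]].

Definition rel_space := g_sigma_algebraType rel_cylinders.

Definition agree (m : nat) (E : rel nat) : set rel_space :=
  [set F | forall i j, (i < m)%N -> (j < m)%N -> F i j = E i j].

Definition local_upto (m : nat) (A : set rel_space) : Prop :=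
  forall E F : rel_space, agree m E F -> A E -> A F.

Definition pattern_ext (m : nat) (e : {ffun 'I_m * 'I_m -> bool}) : rel nat :=
  fun i j => if insub i is Some i' then
    if insub j is Some j' then e (i', j') else false else false.

Lemma agree_sym m E F : agree m E F -> agree m F E.
Proof. by move=> h i j im jm; rewrite h. Qed.

Lemma agree_trans m E F G : agree m E F -> agree m F G -> agree m E G.
Proof. by move=> EF FG i j im jm; rewrite FG// EF. Qed.

Lemma agree_le m m' E F : (m <= m')%N -> agree m' E F -> agree m E F.
Proof.
by move=> mm' h i j im jm; rewrite h// (leq_trans _ mm').
Qed.

Lemma agree_pattern m (F : rel_space) :
  agree m (pattern_ext [ffun p : 'I_m * 'I_m => F p.1 p.2]) F.
Proof. by move=> i j im jm; rewrite /pattern_ext !insubT ffunE. Qed.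

(** There are only finitely many patterns on the first m elements, whence
    measurability. *)
Lemma local_upto_bigcup m A : local_upto m A ->
  A = \bigcup_(e in [set e | A (@pattern_ext m e)]) agree m (pattern_ext e).
Proof.
move=> locA; apply/seteqP; split=> [F AF|F [e /= Ae Fe]]; last exact: locA Ae.
exists [ffun p : 'I_m * 'I_m => F p.1 p.2]; last exact: agree_pattern.
by apply: locA AF; apply: agree_sym; exact: agree_pattern.
Qed.

Lemma measurable_agree m E : measurable (agree m E).
Proof.
have meq i j : measurable [set F : rel_space | F i j = E i j].
  have mij : measurable [set F : rel_space | F i j].
    by apply: sub_sigma_algebra; exists i, j.
  have [Eij|Eij] := boolP (E i j); first exact: mij.
  rewrite (_ : mkset _ = ~` [set F : rel_space | F i j]).
    exact: measurableC.
  by apply/seteqP; split=> F /=; [move=> ->|move/negP/negbTE].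
rewrite (_ : agree m E = \bigcap_(i in `I_m) \bigcap_(j in `I_m)
    [set F : rel_space | F i j = E i j]).
  apply: bigcap_measurableType => i _; apply: bigcap_measurableType => j _.
  exact: meq.
apply/seteqP; split=> F h; first by move=> i im j jm; exact: h.
by move=> i j im jm; exact: h.
Qed.

Lemma local_upto_measurable m A : local_upto m A -> measurable A.
Proof.
move=> /local_upto_bigcup ->; apply: fin_bigcup_measurable => [|e _].
  exact: finite_finset.
exact: measurable_agree.
Qed.

Lemma measurable_rel i j : measurable [set E : rel_space | E i j].
Proof. by apply: sub_sigma_algebra; exists i, j. Qed.

Section into_rel_space.
Context d (T : measurableType d).

Lemma measurable_rel_fun (f : T -> rel_space) :
  (forall i j, measurable [set w | f w i j]) -> measurable_fun [set: T] f.
Proof.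
move=> mf; apply: (@measurability _ _ T rel_space setT f rel_cylinders) => //.
by move=> _ [_ [i [j ->]] <-]; rewrite setTI; exact: mf.
Qed.

End into_rel_space.

Lemma measurable_relabel s : measurable_fun [set: rel_space]
  (relabel s : rel_space -> rel_space).
Proof. by apply: measurable_rel_fun => i j; exact: measurable_rel. Qed.

Lemma measurable_preimage_relabel s (S : set rel_space) : measurable S ->
  measurable [set E : rel_space | S (relabel s E)].
Proof. by move=> mS; rewrite -[X in measurable X]setTI; exact: measurable_relabel. Qed.

Section law.
Context d (T : measurableType d) (R : realType) (P : probability T R).
Local Open Scope ereal_scope.

(** With the empty set, the events [agree m E] form a pi-system: two of them
    are disjoint or intersect in a third. Large m suffice, because a short
    pattern is a finite union of long ones; and a pattern that is not an
    equivalence relation is never realized. The event D allows conditioning.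
    *)
Lemma law_ext (D : set T) (f g : T -> rel_space) (N : nat) :
  measurable D -> measurable_fun [set: T] f -> measurable_fun [set: T] g ->
  (forall w, equivalence_rel (f w)) -> (forall w, equivalence_rel (g w)) ->
  (forall m E, (N <= m)%N -> equivalence_rel E ->
     P (D `&` f @^-1` agree m E) = P (D `&` g @^-1` agree m E)) ->
  forall S, measurable S -> P (D `&` f @^-1` S) = P (D `&` g @^-1` S).
Proof.
move=> mD mf mg eqf eqg fg.
have mpre (h : T -> rel_space) (S : set rel_space) : measurable_fun [set: T] h ->
    measurable S -> measurable (D `&` h @^-1` S).
  move=> mh mS; apply: measurableI => //.
  by rewrite -[X in measurable X]setTI; exact: mh.
have fg' m E : (N <= m)%N -> P (D `&` f @^-1` agree m E) = P (D `&` g @^-1` agree m E).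
  move=> Nm.
  have [[w Ew]|nf] := pselect (exists w, agree m E (f w)).
    have e : agree m E = agree m (f w).
      apply/seteqP; split=> F h.
        exact: agree_trans (agree_sym Ew) h.
      exact: agree_trans Ew h.
    by rewrite e; exact: fg.
  have [[w Ew]|ng] := pselect (exists w, agree m E (g w)).
    have e : agree m E = agree m (g w).
      apply/seteqP; split=> F h.
        exact: agree_trans (agree_sym Ew) h.
      exact: agree_trans Ew h.
    by rewrite e; exact: fg.
  congr (P _); apply/seteqP; split=> w [_ h]; exfalso.
    by apply: nf; exists w.
  by apply: ng; exists w.
have addl (h : T -> rel_space) : measurable_fun [set: T] h ->
    semi_sigma_additive (fun S : set rel_space => P (D `&` h @^-1` S)).
  move=> mh F mF tF mUF; rewrite preimage_bigcup setI_bigcupr.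
  apply: measure_semi_sigma_additive.
  - by move=> n; exact: mpre.
  - apply/trivIsetP => /= i j _ _ ij; rewrite setIACA setIid -preimage_setI.
    by move/trivIsetP : tF => /(_ _ _ _ _ ij) ->//; rewrite preimage_set0 setI0.
  - by rewrite -setI_bigcupr -preimage_bigcup; exact: mpre.
have zero (h : T -> rel_space) : P (D `&` h @^-1` set0) = 0.
  by rewrite preimage_set0 setI0 measure0.
pose m1 : {measure set rel_space -> \bar R} := HB.pack
  (fun S : set rel_space => P (D `&` f @^-1` S))
  (isMeasure.Build _ rel_space R (fun S : set rel_space => P (D `&` f @^-1` S))
    (zero f) (fun S => measure_ge0 P _) (addl f mf)).
pose m2 : {measure set rel_space -> \bar R} := HB.pack
  (fun S : set rel_space => P (D `&` g @^-1` S))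
  (isMeasure.Build _ rel_space R (fun S : set rel_space => P (D `&` g @^-1` S))
    (zero g) (fun S => measure_ge0 P _) (addl g mg)).
pose G : set (set rel_space) := [set S | [\/ S = set0, S = setT |
  exists m E, (N <= m)%N /\ S = agree m E]].
move=> S mS.
have mG : G `<=` @measurable _ rel_space.
  by move=> _ [->|->|[m [E [_ ->]]]] //; exact: measurable_agree.
have sub : measurable `<=` <<s G >>.
  apply: smallest_sub; first exact: smallest_sigma_algebra.
  move=> _ [i [j ->]].
  pose M := maxn N (maxn i.+1 j.+1).
  have locij : local_upto M [set E : rel_space | E i j].
    by move=> E F EF /=; rewrite EF// /M !leq_max leqnn !orbT.
  rewrite (local_upto_bigcup locij).
  apply: (@fin_bigcup_measurable _ (g_sigma_algebraType G)) => [|e _].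
    exact: finite_finset.
  by apply: sub_sigma_algebra; apply: Or33; exists M, (pattern_ext e);
    rewrite /M leq_maxl.
apply: (@g_sigma_algebra_measure_unique _ _ _ G mG (fun=> setT) _ _ m1 m2);
  last exact: sub.
- by move=> _; apply: Or32.
- by rewrite bigcup_const//; exists 0%N.
- move=> A B GA GB; case: GA => [->|->|[m [E [Nm ->]]]].
  + by rewrite set0I; apply: Or31.
  + by rewrite setTI.
  case: GB => [->|->|[m' [E' [Nm' ->]]]].
  + by rewrite setI0; apply: Or31.
  + by rewrite setIT; apply: Or33; exists m, E.
  have [[F [EF EF']]|no] := pselect (exists F, agree m E F /\ agree m' E' F).
    apply: Or33; exists (maxn m m'), F; split; first by rewrite leq_max Nm.
    apply/seteqP; split=> K /=.
      move=> [EK EK'] i j im jm; have [mm'|mm'] := leqP m m'.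
        have im' : (i < m')%N by move: im; rewrite (maxn_idPr mm').
        have jm' : (j < m')%N by move: jm; rewrite (maxn_idPr mm').
        by rewrite EK' ?EF'.
      have im' : (i < m)%N by move: im; rewrite (maxn_idPl (ltnW mm')).
      have jm' : (j < m)%N by move: jm; rewrite (maxn_idPl (ltnW mm')).
      by rewrite EK ?EF.
    move=> FK; split.
      apply: agree_trans EF _; apply: agree_le FK; exact: leq_maxl.
    apply: agree_trans EF' _; apply: agree_le FK; exact: leq_maxr.
  apply: Or31; apply/seteqP; split=> K //= [EK EK'].
  by apply: no; exists K.
- move=> A [->|->|[m [E [Nm ->]]]] /=.
  + by rewrite !zero.
  + by rewrite !preimage_setT.
  + exact: fg'.
- move=> _; rewrite /= preimage_setT setIT.
  exact: (le_lt_trans (probability_le1 P mD) (ltry _)).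
Qed.

End law.

(** * Partially exchangeable laws *)

Lemma least_local m E F n i : agree m E F -> (i < m)%N -> L E n i = L F n i.
Proof.
move=> EF im; apply/is_least_fromP/is_least_fromP => -[ni H]; split=> // k nki; have := H k nki.
  by rewrite EF//; lia.
by rewrite EF//; lia.
Qed.

Lemma cnt_least_local m E F n i : agree m E F -> (i <= m)%N ->
  cnt (L E n) i = cnt (L F n) i.
Proof.
by move=> EF im; apply: eq_cnt => k ki; rewrite (least_local _ EF)// (leq_trans ki).
Qed.

Lemma nth_least_local m E F n j i : agree m E F -> (i < m)%N ->
  is_nth_least E n j i = is_nth_least F n j i.
Proof.
by move=> EF im; rewrite /is_nth_least (least_local _ EF)// (cnt_least_local _ EF) 1?ltnW.
Qed.

Section restriction.
Local Open Scope nat_scope.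
Variables (E : rel nat) (m : nat).
Hypothesis eqE : equivalence_rel E.

Definition clusters : seq {set 'I_m} :=
  [seq [set j : 'I_m | E i j]%SET | i <- iota 0 m & L E 0 i].

Lemma mem_restr (B : {set 'I_m}) :
  reflect (exists x : 'I_m, B = [set j : 'I_m | E x j]%SET) (B \in restr E m).
Proof.
apply: (iffP imsetP) => [[x _ ->]|[x ->]]; exists x => //;
by apply/setP => y; rewrite !inE.
Qed.

Lemma restr_clusters : restr E m = [set:: clusters]%SET.
Proof.
apply/setP => B; rewrite inE; apply/mem_restr/mapP => [[x ->]|[i]].
  have [i Li /andP[ix Eix]] := least_rep eqE (leq0n x).
  exists i; first by rewrite mem_filter Li mem_iota (leq_ltn_trans ix) /=.
  by apply/setP => y; rewrite !inE (eqE i x y).2.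
rewrite mem_filter mem_iota => /andP[_ /= im] ->.
by exists (Ordinal im).
Qed.

Lemma partition_clusters :
  finset.partition [set:: clusters]%SET [set: 'I_m]%SET.
Proof. by rewrite -restr_clusters; exact: equivalence_partitionP. Qed.

Lemma least_cluster i : (i < m) -> L E 0 i ->
  least [set j : 'I_m | E i j]%SET = i.
Proof.
move=> im /is_least_fromP[_ Li]; apply/eqP; rewrite eqn_leq; apply/andP; split.
  rewrite /least; have : Ordinal im \in index_enum 'I_m by rewrite mem_index_enum.
  elim: (index_enum _) => // k s IH; rewrite inE big_cons.
  case/predU1P => [<-|/IH le]; first by rewrite inE (eqE i i i).1 geq_minl.
  by case: ifP => // _; rewrite (leq_trans (geq_minr _ _)).
rewrite /least; elim/big_ind: _ => [|x y|j]; first exact: ltnW.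
  by rewrite leq_min => -> ->.
rewrite inE => Eij; rewrite leqNgt; apply/negP => ji.
by have := Li j; rewrite ji (equiv_sym _ _ eqE) Eij => /(_ isT).
Qed.

Lemma sorted_clusters : in_appearance_order clusters.
Proof.
rewrite /in_appearance_order /clusters sorted_map.
have : sorted ltn [seq i <- iota 0 m | L E 0 i].
  by apply: sorted_filter; [exact: ltn_trans|exact: iota_ltn_sorted].
apply: (@sub_in_sorted _ (fun i => (i < m) && L E 0 i)); last first.
  by apply/allP => i; rewrite mem_filter mem_iota andbC.
move=> i j /andP[im Li] /andP[jm Lj] ij /=.
by rewrite /relpre /= !least_cluster.
Qed.

Lemma card_clusters : [seq #|B| | B : {set 'I_m} <- clusters] = cluster_sizes E m.
Proof.
rewrite /clusters /cluster_sizes -map_comp; apply: eq_map => i /=.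
rewrite -sum1_card -sum1_count.
have -> : iota 0 m = index_iota 0 m by rewrite /index_iota subn0.
by rewrite big_mkord; apply: eq_bigl => k; rewrite inE.
Qed.

End restriction.

Lemma restr_eqP m E F : equivalence_rel E -> equivalence_rel F ->
  restr E m = restr F m <-> agree m E F.
Proof.
move=> eqE eqF; split=> [EF i j im jm|EF]; last first.
  apply/setP => B; apply/mem_restr/mem_restr => -[x ->]; exists x;
  by apply/setP => y; rewrite !inE EF.
have /mem_restr[x xF] : [set k : 'I_m | E (Ordinal im) k]%SET \in restr F m.
  by rewrite -EF; apply/mem_restr; exists (Ordinal im).
have h k : (k < m)%N -> E i k = F x k.
  by move=> km; move/setP: xF => /(_ (Ordinal km)); rewrite !inE.
by rewrite h// (eqF x i j).2// -h// (eqE i i i).1.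
Qed.

Section partial_exchangeability.
Context d (T : measurableType d) (R : realType) (P : probability T R).
Variable Pi : T -> rel_space.
Hypotheses (hPi : random_partition Pi) (hpe : partially_exchangeable P Pi).
Local Open Scope ereal_scope.

Lemma measurable_Pi : measurable_fun [set: T] Pi.
Proof. by apply: measurable_rel_fun => i j; exact: hPi.2. Qed.

Lemma measurable_Pi_preimage (S : set rel_space) : measurable S ->
  measurable (Pi @^-1` S).
Proof. by move=> mS; rewrite -[X in measurable X]setTI; exact: measurable_Pi. Qed.

(** To realize a pattern is to have the same restriction, so partial
    exchangeability yields a function of the cluster sizes in order of
    appearance. *)
Lemma pe_agree : exists p : seq nat -> R, forall m E, equivalence_rel E ->
  P (Pi @^-1` agree m E) = (p (cluster_sizes E m))%:E.
Proof.
have [p hp] := hpe; exists p => m E eqE.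
rewrite -card_clusters -(hp _ _ (partition_clusters m eqE) (sorted_clusters m eqE)).
congr (P _); apply/seteqP; split=> w /=; rewrite -restr_clusters// => h.
  by apply/esym/restr_eqP => //; exact: hPi.1.
by apply/restr_eqP => //; exact: hPi.1.
Qed.

Definition not_both_least (a : nat) : set rel_space :=
  [set E : rel_space | ~~ (L E 0 a && L E 0 a.+1)].

Lemma measurable_not_both_least a : measurable (not_both_least a).
Proof.
apply: (@local_upto_measurable a.+2) => E F EF; rewrite /not_both_least /=.
by rewrite !(least_local _ EF).
Qed.

Lemma not_both_least_swap a E : equivalence_rel E ->
  not_both_least a (relabel (swapn a) E) <-> not_both_least a E.
Proof.
move=> eqE; have [Ea|nE] := boolP (E a a.+1); first by rewrite relabel_swap_same.
by rewrite /not_both_least /= !least_swap// swapnL swapnR andbC.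
Qed.

Lemma agree_swap a m E F : (a.+2 <= m)%N ->
  agree m E (relabel (swapn a) F) <-> agree m (relabel (swapn a) E) F.
Proof.
have lt i : (a.+2 <= m)%N -> (i < m)%N -> (swapn a i < m)%N.
  by rewrite /swapn; case: eqP => [->|_]; [|case: eqP => [->|_]]; lia.
move=> am; split=> h i j im jm.
  by rewrite /relabel -h ?lt// /relabel !swapnK.
by have := h _ _ (lt _ am im) (lt _ am jm); rewrite /relabel !swapnK.
Qed.

(** On this event the swap keeps the cluster sizes in order of appearance,
    hence the probability of each finite pattern. *)
Lemma pe_swap a (S : set rel_space) : measurable S ->
  P (Pi @^-1` (not_both_least a `&` [set E : rel_space | S (relabel (swapn a) E)])) =
  P (Pi @^-1` (not_both_least a `&` S)).
Proof.
move=> mS; rewrite !preimage_setI.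
apply: (@law_ext _ _ _ P _ (fun w => relabel (swapn a) (Pi w)) _ a.+2) => //.
- by apply: measurable_Pi_preimage; exact: measurable_not_both_least.
- apply: (measurableT_comp (measurable_relabel (swapn a))).
  exact: measurable_Pi.
- exact: measurable_Pi.
- by move=> w; apply: relabel_equiv; exact: hPi.1.
- exact: hPi.1.
move=> m E am eqE; have [p hp] := pe_agree.
have nbE F : agree m E F -> not_both_least a F <-> not_both_least a E.
  by move=> EF; rewrite /not_both_least /= !(least_local _ EF)//; lia.
have [nb|nb] := pselect (not_both_least a E).
  rewrite [in LHS](_ : _ `&` _ = Pi @^-1` agree m (relabel (swapn a) E)).
    rewrite [in RHS](_ : _ `&` _ = Pi @^-1` agree m E).
      rewrite !hp//; last exact: relabel_equiv.
      by rewrite cluster_sizes_swap.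
    by apply/seteqP; split=> w /= => [[_]//|h]; split=> //; apply/(nbE _ h).
  apply/seteqP; split=> w /=; first by move=> [_ h]; exact/agree_swap.
  move=> h; split; last exact/agree_swap.
  have := (nbE _ ((agree_swap E (Pi w) am).2 h)).2 nb.
  by move/not_both_least_swap; apply; exact: hPi.1.
congr (P _); apply/seteqP; split=> w /= [nbw h]; exfalso; apply: nb.
  by apply/(nbE _ h)/not_both_least_swap => //; exact: hPi.1.
exact/(nbE _ h).
Qed.

(** A member of the cluster of an earlier element i0 represents no cluster, so
    the swap is among those of [pe_swap]. *)
Lemma pe_swap_join a i0 (S : set rel_space) : (i0 < a)%N -> measurable S ->
  P (Pi @^-1` ([set E : rel_space | E i0 a.+1] `&` [set E : rel_space | S (relabel (swapn a) E)])) =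
  P (Pi @^-1` ([set E : rel_space | E i0 a] `&` S)).
Proof.
move=> i0a mS.
have nb (E : rel_space) k : E i0 k -> (i0 < k)%N -> L E 0 k = false.
  by move=> Ek ik; apply/negP => /is_least_fromP[_ /(_ i0)]; rewrite Ek ik => /(_ isT).
have mS' : measurable ([set E : rel_space | E i0 a] `&` S).
  by apply: measurableI => //; exact: measurable_rel.
transitivity (P (Pi @^-1` (not_both_least a `&` ([set E : rel_space | E i0 a] `&` S)))).
  rewrite -(pe_swap _ mS'); congr (P (_ @^-1` _)).
  apply/seteqP; split=> E; rewrite /not_both_least /relabel /= swapnL swapn_lt//.
    by move=> [Ek SE]; rewrite [L E 0 a.+1](nb _ _ Ek) ?andbF// ltnW.
  by case=> _ [].
congr (P (_ @^-1` _)); apply/seteqP; split=> E /=; first by case.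
by move=> [Ek SE]; split=> //; rewrite /not_both_least /= (nb _ _ Ek).
Qed.
End partial_exchangeability.

(** * A law of large numbers *)

Section series_bounds.
Variable R : realType.
Local Open Scope ereal_scope.

Lemma nneseries_le_bound (u : nat -> \bar R) (M : \bar R) :
  (forall k, 0 <= u k) -> (forall n, \sum_(0 <= k < n) u k <= M) ->
  \sum_(0 <= k <oo) u k <= M.
Proof.
move=> u0 uM; apply: lime_le; first by apply: is_cvg_nneseries => *; exact: u0.
by apply: nearW => n; exact: uM.
Qed.

Lemma nneseries_fin_cvg (u : R^nat) : (forall k, (0 <= u k)%R) ->
  \sum_(0 <= k <oo) (u k)%:E < +oo -> cvgn (series u).
Proof.
move=> u0 fin; apply: nondecreasing_is_cvgn.
  apply/nondecreasing_seqP => n; rewrite /series /= big_nat_recr//=.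
  by rewrite lerDl.
have s0 : 0 <= \sum_(0 <= k <oo) (u k)%:E.
  by apply: nneseries_ge0 => k _ _; rewrite lee_fin.
exists (fine (\sum_(0 <= k <oo) (u k)%:E)) => _ [n _ <-].
rewrite -lee_fin fineK ?ge0_fin_numE// /series /= -sumEFin.
by apply: nneseries_lim_ge => k _ _; rewrite lee_fin.
Qed.

End series_bounds.

Section averages.
Variable R : realType.
Local Notation avg := (avg R).

Lemma cnt_sum (y : pred nat) n : (cnt y n)%:R = \sum_(0 <= l < n) (y l)%:R :> R.
Proof.
elim: n => [|n IH]; first by rewrite big_geq.
by rewrite cntS natrD IH big_nat_recr.
Qed.

Lemma avg_ge0 (y : pred nat) n : 0 <= avg y n.
Proof. by rewrite /avg divr_ge0. Qed.

Lemma avg_le1 (y : pred nat) n : avg y n <= 1.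
Proof.
rewrite /avg; case: n => [|n]; first by rewrite invr0 mulr0.
by rewrite ler_pdivrMr ?mul1r ?ler_nat ?cnt_le// ltr0n.
Qed.

Lemma avg_dist (y : pred nat) n m : (0 < n)%N -> (n <= m)%N ->
  `|avg y m - avg y n| <= (m - n)%:R / n%:R.
Proof.
move=> n0 /subnKC; move: (m - n)%N => r <-; rewrite /avg cnt_addn.
have := cnt_le y n; have := cnt_le (fun k => y (n + k)%N) r.
move: (cnt y n) (count _ _) => a b br an.
have n0' : 0 < n%:R :> R by rewrite ltr0n.
have nr0 : 0 < n%:R + r%:R :> R by rewrite -natrD ltr0n addn_gt0 n0.
have a0 : 0 <= a%:R :> R by [].
have b0 : 0 <= b%:R :> R by [].
have r0 : 0 <= r%:R :> R by [].
have an' : a%:R <= n%:R :> R by rewrite ler_nat.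
have br' : b%:R <= r%:R :> R by rewrite ler_nat.
have -> : (a + b)%:R / (n + r)%:R - a%:R / n%:R =
  (b%:R * n%:R - a%:R * r%:R) / (n%:R + r%:R) / n%:R :> R.
  rewrite !natrD; field; by rewrite !gt_eqF.
rewrite normrM [X in _ * X]ger0_norm ?invr_ge0// ler_wpM2r ?invr_ge0//.
rewrite normrM [X in _ * X]ger0_norm ?invr_ge0 ?(ltW nr0)// ler_pdivrMr//.
rewrite ler_norml; apply/andP; split; nra.
Qed.

(** Consecutive fourth powers have ratio tending to 1, and an average changes
    little between them. *)
Lemma avg_cvg_pow4 (y : pred nat) :
  cvgn (fun k => avg y (k.+1 ^ 4)) -> cvgn (avg y).
Proof.
move=> /cvg_ex[l hl]; apply/cvg_ex; exists l; apply/cvgrPdist_le => /= e e0.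
have e2 : 0 < e / 2 by rewrite divr_gt0.
move/cvgrPdist_le : hl => /(_ _ e2)[K1 _ hK1].
(* (x + 1)^4 - x^4 <= 15 x^3 for x >= 1, and 15 = 4 + 6 + 4 + 1 *)
have [K2 hK2] : exists K2 : nat, 15 / (e / 2) <= K2%:R.
  exists (Num.bound (15 / (e / 2))).
  by apply/ltW/archi_boundP; rewrite divr_ge0// ltW.
pose K := maxn K1 K2; exists (K.+1 ^ 4)%N => // m /= Km.
have ex : exists k, (k.+1 ^ 4 <= m)%N by exists K.
have bd k : (k.+1 ^ 4 <= m)%N -> (k <= m)%N.
  by move=> km; rewrite (leq_trans _ km)// (leq_trans (leqnSn k))// expnS leq_pmulr// expn_gt0.
case: (ex_maxnP ex bd) => k km kmax.
have Kk : (K <= k)%N by exact: kmax.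
have mk : (m < k.+2 ^ 4)%N by rewrite ltnNge; apply/negP => /kmax; rewrite ltnn.
have -> : l - avg y m = (l - avg y (k.+1 ^ 4)) - (avg y m - avg y (k.+1 ^ 4)).
  by ring.
rewrite (le_trans (ler_normB _ _))// (splitr e) lerD//.
  by apply: hK1 => /=; rewrite (leq_trans _ Kk)// leq_maxl.
rewrite (le_trans (avg_dist _ _ km)) ?expn_gt0//.
have k0 : 0 < k.+1%:R :> R by rewrite ltr0n.
rewrite ler_pdivrMr ?ltr0n ?expn_gt0//.
have Kk' : 15 / (e / 2) <= k.+1%:R.
  by rewrite (le_trans hK2)// ler_nat ltnW// ltnS (leq_trans _ Kk)// leq_maxr.
apply: (@le_trans _ _ (15 * k.+1%:R ^+ 3)).
  rewrite (@le_trans _ _ (k.+2 ^ 4 - k.+1 ^ 4)%:R)//.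
    by rewrite ler_nat leq_sub2r// ltnW.
  rewrite natrB; last by rewrite leq_exp2r.
  rewrite !natrX -[k.+2]addn1 natrD.
  have k1 : 1 <= k.+1%:R :> R by rewrite ler1n.
  move: (k.+1%:R : R) k1 => x x1; nra.
have -> : (k.+1 ^ 4)%:R = k.+1%:R * k.+1%:R ^+ 3 :> R by rewrite natrX exprS.
have key (c x : R) : 0 < c -> 0 <= x -> 15 / c <= x ->
    15 * x ^+ 3 <= c * (x * x ^+ 3).
  move=> c0 x0; rewrite ler_pdivrMr// => h.
  by rewrite mulrA ler_wpM2r ?exprn_ge0// mulrC.
exact: key (ltW k0) Kk'.
Qed.

Context d (T : measurableType d) (P : probability T R).

Section lln.
Variables (y : nat -> T -> bool) (a b : R).
Hypotheses (my : forall l, measurable [set w | y l w])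
  (y1 : forall l, P [set w | y l w] = a%:E)
  (y2 : forall l k, l != k -> P [set w | y l w && y k w] = b%:E).

(** For weights of sum 0 the products of distinct weights add up to minus the
    sum of the squares, so the terms with b combine with those with a. *)
Lemma integral_square_sum (c : nat -> R) m : \sum_(0 <= l < m) c l = 0 ->
  (\int[P]_w ((\sum_(0 <= l < m) c l * (y l w)%:R) ^+ 2)%:E =
   ((a - b) * \sum_(0 <= l < m) c l ^+ 2)%:E)%E.
Proof.
move=> c0; have mI l k : measurable [set w | y l w && y k w].
  rewrite (_ : mkset _ = [set w | y l w] `&` [set w | y k w]).
    exact: measurableI.
  by apply/seteqP; split=> w /= /andP.
pose f (p : nat * nat) (w : T) : \bar R :=
  ((c p.1 * c p.2)%:E * (\1_[set w | y p.1 w && y p.2 w] w)%:E)%E.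
have intI (p : nat * nat) :
    P.-integrable setT (EFin \o \1_[set w | y p.1 w && y p.2 w]).
  by apply: integrable_indic => //; rewrite (le_lt_trans (probability_le1 P _))// ltry.
have fint p : P.-integrable setT (f p) by apply: integrableZl => //; exact: intI.
transitivity (\int[P]_w
  (\sum_(p <- [seq (l, k) | l <- index_iota 0 m, k <- index_iota 0 m]) f p w))%E.
  apply: eq_integral => w _; rewrite expr2 big_distrlr /= big_allpairs /=.
  rewrite -sumEFin; apply: eq_bigr => l _; rewrite -sumEFin; apply: eq_bigr => k _.
  rewrite /f /= -EFinM; congr (_%:E); rewrite mulrACA indicE; congr (_ * _).
  have -> : (w \in [set w | y l w && y k w]) = y l w && y k w.
    by apply/idP/idP; rewrite inE.
  by case: (y l w); case: (y k w); rewrite ?mulr0 ?mul0r ?mulr1.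
rewrite integral_sum// big_allpairs /=.
have q l k : (\int[P]_w f (l, k) w = (c l * c k * (if l == k then a else b))%:E)%E.
  rewrite integralZl//; last exact: (intI (l, k)).
  rewrite integral_indic// setIT [RHS]EFinM; congr (_ * _)%E.
  case: eqVneq => [<-|lk]; last exact: y2.
  rewrite -(y1 l); congr (P _); apply/seteqP; split=> w /=; rewrite ?andbb//.
under eq_bigr do under eq_bigr do rewrite q.
under eq_bigr do rewrite sumEFin.
rewrite sumEFin; congr (_%:E).
transitivity (\sum_(0 <= l < m) ((a - b) * c l ^+ 2 + b * c l * \sum_(0 <= k < m) c k)).
  apply: eq_big_nat => l lm.
  rewrite mulr_sumr (bigD1_seq l) ?mem_index_iota ?iota_uniq//= eqxx.
  rewrite [in RHS](bigD1_seq l) ?mem_index_iota ?iota_uniq//=.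
  rewrite addrA; congr (_ + _); first by ring.
  by apply: eq_bigr => k kl; rewrite eq_sym (negPf kl); ring.
by rewrite c0 mulr_sumr; apply: eq_bigr => l _; rewrite mulr0 addr0.
Qed.

(** The difference of two averages is a sum with weights of sum 0, and its
    second moment is (a - b) (1 / n - 1 / m). *)
Lemma integral_avg_square n m : (0 < n)%N -> (n <= m)%N ->
  (\int[P]_w ((avg (y^~ w) n - avg (y^~ w) m) ^+ 2)%:E <= (n%:R^-1)%:E)%E.
Proof.
move=> n0 nm; have m0 : (0 < m)%N by exact: leq_trans nm.
have nR : n%:R != 0 :> R by rewrite pnatr_eq0 -lt0n.
have mR : m%:R != 0 :> R by rewrite pnatr_eq0 -lt0n.
pose c l : R := (if (l < n)%N then n%:R^-1 else 0) - m%:R^-1.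
have sumif (x : nat -> R) : \sum_(0 <= l < m) (if (l < n)%N then x l else 0) =
    \sum_(0 <= l < n) x l.
  by rewrite (big_nat_widen _ _ _ _ _ nm) -big_mkcond.
have c0 : \sum_(0 <= l < m) c l = 0.
  rewrite sumrB sumif !sumr_const_nat !subn0 -[X in X - _]mulr_natl.
  by rewrite -[X in _ - X]mulr_natl !mulfV// subrr.
have -> : (\int[P]_w ((avg (y^~ w) n - avg (y^~ w) m) ^+ 2)%:E =
    \int[P]_w ((\sum_(0 <= l < m) c l * (y l w)%:R) ^+ 2)%:E)%E.
  apply: eq_integral => w _; congr ((_ ^+ 2)%:E); rewrite /avg !cnt_sum.
  under [RHS]eq_bigr do rewrite mulrBl (fun_if (fun x => x * _)) mul0r.
  by rewrite sumrB sumif -!mulr_sumr ![_^-1 * _]mulrC.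
rewrite integral_square_sum// lee_fin.
have a1 : a <= 1 by rewrite -lee_fin -(y1 0%N) probability_le1.
have b0 : 0 <= b by rewrite -lee_fin -(@y2 0%N 1%N).
have ba : b <= a.
  rewrite -lee_fin -(y1 0%N) -(@y2 0%N 1%N)//; apply: le_measure; rewrite ?inE//.
    rewrite (_ : mkset _ = [set w | y 0%N w] `&` [set w | y 1%N w]).
      exact: measurableI.
    by apply/seteqP; split=> w /= /andP.
  by move=> w /= /andP[].
have cc l : c l ^+ 2 = (if (l < n)%N then n%:R^-1 * (n%:R^-1 - 2 * m%:R^-1) else 0)
   + m%:R^-1 ^+ 2.
  by rewrite /c; case: ifP => _; ring.
under eq_bigr do rewrite cc.
rewrite big_split /= sumif !sumr_const_nat !subn0.
rewrite -[X in _ * (X + _)]mulr_natl -[X in _ * (_ + X)]mulr_natl.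
rewrite mulrA mulfV// mul1r expr2 mulrA mulfV// mul1r.
have mi : m%:R^-1 > 0 :> R by rewrite invr_gt0 ltr0n.
have ni : n%:R^-1 > 0 :> R by rewrite invr_gt0 ltr0n.
have min : m%:R^-1 <= n%:R^-1 :> R by rewrite lef_pV2 ?posrE ?ltr0n// ler_nat.
nra.
Qed.

Lemma measurable_avg n : measurable_fun [set: T] (fun w => avg (y^~ w) n).
Proof.
rewrite /avg; apply: measurable_funM => //.
under eq_fun do rewrite cnt_sum.
apply: measurable_sum => l.
rewrite (_ : (fun w => _) = \1_[set w | y l w]); first exact: measurable_indic.
apply/funext => w; rewrite indicE.
by have -> : (w \in [set w | y l w]) = y l w by apply/idP/idP; rewrite inE.
Qed.

(** Along the fourth powers the consecutive differences of the averages have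
    absolute moments at most (k + 1)^-2; these are summable, so the averages
    converge almost surely along this subsequence. *)
Lemma avg_cvg_ae : {ae P, forall w, cvgn (avg (y^~ w))}.
Proof.
pose Z k (w : T) : R := avg (y^~ w) (k.+1 ^ 4) - avg (y^~ w) (k.+2 ^ 4).
(* a telescoping upper bound of (k + 1)^-2 *)
pose B k : R := 2 * (k.+1%:R^-1 - k.+2%:R^-1).
have mZ k : measurable_fun [set: T] (fun w => `|Z k w|%:E).
  apply/measurable_EFinP; apply: measurableT_comp => //.
  by apply: measurable_funB; exact: measurable_avg.
have ZB k : (\int[P]_w `|Z k w|%:E <= (B k)%:E)%E.
  have k0 : 0 < k.+1%:R^-1 :> R by rewrite invr_gt0 ltr0n.
  have kk : k.+1%:R^-1 * k.+1%:R = 1 :> R by rewrite mulVf.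
  apply: (@le_trans _ _ (\int[P]_w ((k.+1%:R ^+ 2 / 2)%:E * (Z k w ^+ 2)%:E +
      (k.+1%:R^-1 ^+ 2 / 2)%:E))%E).
    apply: ge0_le_integral => //.
    - apply: emeasurable_funD => //; apply: emeasurable_funM => //.
      apply/measurable_EFinP; apply: measurable_funX.
      by apply: measurable_funB; exact: measurable_avg.
    - move=> w _; rewrite -EFinM -EFinD lee_fin.
      rewrite -(real_normK (num_real (Z k w))).
      (* 2 z = 2 (x z) i <= (x z)^2 + i^2, with i = 1 / x *)
      have key (x i z : R) : i * x = 1 -> z <= x ^+ 2 / 2 * z ^+ 2 + i ^+ 2 / 2.
        move=> ix; have := sqr_ge0 (x * z - i).
        have -> : (x * z - i) ^+ 2 = x ^+ 2 * z ^+ 2 - 2 * (i * x) * z + i ^+ 2.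
          by ring.
        by rewrite ix; lra.
      exact: key kk.
  rewrite ge0_integralD//; last 2 first.
    - by move=> w _; rewrite -EFinM lee_fin mulr_ge0 ?exprn_even_ge0.
    - apply: emeasurable_funM => //; apply/measurable_EFinP; apply: measurable_funX.
      by apply: measurable_funB; exact: measurable_avg.
  rewrite integral_cst//= probability_setT mule1.
  rewrite ge0_integralZl//; last 2 first.
    - apply/measurable_EFinP; apply: measurable_funX.
      by apply: measurable_funB; exact: measurable_avg.
    - by move=> w _; rewrite lee_fin exprn_even_ge0.
  have := @integral_avg_square (k.+1 ^ 4) (k.+2 ^ 4); rewrite expn_gt0 leq_exp2r//.
  rewrite leqnSn => /(_ isT isT) h.
  apply: (@le_trans _ _ ((k.+1%:R ^+ 2 / 2)%:E * ((k.+1 ^ 4)%:R^-1)%:E +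
     (k.+1%:R^-1 ^+ 2 / 2)%:E)%E).
    by rewrite leeD2r// lee_wpmul2l// lee_fin mulr_ge0 ?exprn_even_ge0.
  rewrite -EFinM -EFinD lee_fin /B.
  have -> : k.+1%:R ^+ 2 / 2 / (k.+1 ^ 4)%:R + k.+1%:R^-1 ^+ 2 / 2 =
     (k.+1%:R ^+ 2)^-1 :> R.
    have kn : k.+1%:R != 0 :> R by rewrite pnatr_eq0.
    by rewrite natrX; move: kn; move: (k.+1%:R : R) => x x0; field.
  have -> : 2 * (k.+1%:R^-1 - k.+2%:R^-1) = 2 / (k.+1%:R * k.+2%:R) :> R.
    have kn : k.+1%:R != 0 :> R by rewrite pnatr_eq0.
    have kn2 : k.+2%:R != 0 :> R by rewrite pnatr_eq0.
    have : k.+2%:R = k.+1%:R + 1 :> R by rewrite natr1.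
    move: kn kn2; move: (k.+1%:R : R) (k.+2%:R : R) => x z x0 z0 zx.
    have -> : x^-1 - z^-1 = (z - x) / (x * z) by field; rewrite x0 z0.
    by rewrite zx addrAC subrr add0r mul1r.
  rewrite -[leLHS]mul1r ler_pdivlMr ?mulr_gt0 ?ltr0n//.
  rewrite mulrAC ler_pdivrMr ?exprn_gt0 ?ltr0n//.
  have : k.+2%:R = k.+1%:R + 1 :> R by rewrite natr1.
  have : 1 <= k.+1%:R :> R by rewrite ler1n.
  by move: (k.+1%:R) (k.+2%:R) => x z x1 ->; nra.
have fin : (\int[P]_w \sum_(0 <= k <oo) `|Z k w|%:E < +oo)%E.
  rewrite integral_nneseries//.
  apply: (@le_lt_trans _ _ 2%:E); last exact: ltry.
  apply: nneseries_le_bound => [k|n]; first exact: integral_ge0.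
  apply: (@le_trans _ _ (\sum_(0 <= k < n) (B k)%:E)%E).
    by apply: lee_sum => k _; exact: ZB.
  rewrite sumEFin lee_fin -mulr_sumr.
  have -> : \sum_(0 <= k < n) (k.+1%:R^-1 - k.+2%:R^-1) = 1 - n.+1%:R^-1 :> R.
    elim: n => [|n IH]; first by rewrite big_geq// invr1 subrr.
    by rewrite big_nat_recr//= IH; ring.
  have : 0 <= n.+1%:R^-1 :> R by rewrite invr_ge0.
  by move: (n.+1%:R^-1) => x x0; lra.
have sint : P.-integrable setT (fun w => \sum_(0 <= k <oo) `|Z k w|%:E)%E.
  apply/integrableP; split; first exact: ge0_emeasurable_sum.
  under eq_integral do rewrite gee0_abs ?nneseries_ge0//.
  exact: fin.
have := integrable_ae measurableT sint; apply: filterS => w /(_ I) wfin.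
apply: avg_cvg_pow4.
have /normed_cvg : cvgn [normed series (fun k => Z k w)].
  apply: nneseries_fin_cvg => [k|]; first exact: normr_ge0.
  by rewrite ltey_eq wfin.
have -> : (fun k => Z k w) = - telescope (fun k => avg (y^~ w) (k.+1 ^ 4)).
  by apply/funext => k; rewrite /Z /telescope fctE /= opprB.
rewrite seriesN telescopeK => /is_cvgN; rewrite opprK => /cvg_ex[l hl].
apply/cvg_ex; exists (l + avg (y^~ w) 1).
rewrite (_ : (fun k => _) = [sequence avg (y^~ w) (n.+1 ^ 4) -
  avg (y^~ w) (1 ^ 4)]_n + (fun=> avg (y^~ w) 1)).
  by apply: cvgD => //; exact: cvg_cst.
by apply/funext => k; rewrite fctE /= exp1n subrK.
Qed.

End lln.
End averages.

(** * Measurability of the frequencies *)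

Section measurable_limits.
Context d (X : measurableType d) (R : realType).
Variable u : nat -> X -> R.
Hypothesis mu : forall k, measurable_fun [set: X] (u k).

(** The Cauchy criterion with countable quantifiers, as measurability
    requires. *)
Lemma cvgn_cauchyP (v : R^nat) : cvgn v <->
  forall k : nat, exists N, forall m, (N <= m)%N -> `|v m - v N| <= k.+1%:R^-1.
Proof.
split=> [/cvg_ex[l hl] k|h].
  have e0 : 0 < k.+1%:R^-1 / 2 :> R by rewrite divr_gt0.
  move/cvgrPdist_le : hl => /(_ _ e0)[N _ hN]; exists N => m Nm.
  have -> : v m - v N = (l - v N) - (l - v m) by ring.
  rewrite (le_trans (ler_normB _ _))// (splitr (k.+1%:R^-1)) lerD//; apply: hN => //=.
apply/cauchy_cvgP/cauchyP => e e0.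
have [k ke] : exists k : nat, k.+1%:R^-1 < e.
  exists (Num.bound e^-1).
  rewrite invf_plt ?posrE//.
  by rewrite (lt_le_trans (archi_boundP _)) ?invr_ge0 ?(ltW e0)// ler_nat.
have [N hN] := h k; exists (v N); exists N => // m /= Nm.
by rewrite /ball /= distrC (le_lt_trans (hN _ Nm)).
Qed.

Lemma measurable_cvgn : measurable [set x | cvgn (u ^~ x)].
Proof.
rewrite (_ : mkset _ = \bigcap_k \bigcup_N \bigcap_(m in [set m | (N <= m)%N])
  [set x | `|u m x - u N x| <= k.+1%:R^-1]).
  apply: bigcapT_measurable => k; apply: bigcupT_measurable => N.
  apply: bigcap_measurableType => m _.
  rewrite -[X in measurable X]setTI; apply: measurable_fun_le => //.
  by apply: measurableT_comp => //; exact: measurable_funB.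
apply/seteqP; split=> x /=.
  by move=> /cvgn_cauchyP h k _; have [N hN] := h k; exists N.
by move=> h; apply/cvgn_cauchyP => k; have [N _ hN] := h k I; exists N.
Qed.

(** Where the sequence diverges, the total limit is constant. *)
Lemma measurable_limn : measurable_fun [set: X] (fun x => limn (u ^~ x)).
Proof.
pose C := [set x | cvgn (u ^~ x)].
have mC : measurable C := measurable_cvgn.
rewrite -(setvU C); apply/measurable_funU => //; first exact: measurableC.
split.
  apply: (@eq_measurable_fun _ _ _ _ _ (cst (point : R))) => // x.
  by rewrite inE => nC; rewrite dvgP.
apply: (@measurable_fun_cvg _ _ _ _ u) => [k|x Cx]; last exact: Cx.
exact: measurable_funTS.
Qed.

End measurable_limits.

Section sequence_space.
Variable R : realType.

Lemma measurable_coord j : measurable_fun [set: seq_space R] (fun x => x j).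
Proof.
by move=> _ B mB; rewrite setTI; apply: sub_sigma_algebra; exists j, B.
Qed.

Lemma measurable_seq_fun d (X : measurableType d) (g : X -> seq_space R) :
  (forall j, measurable_fun [set: X] (fun x => g x j)) ->
  measurable_fun [set: X] g.
Proof.
move=> mg; apply: (@measurability _ _ X (seq_space R) setT g (@coord_cylinders R)) => //.
move=> _ [_ [j [B [mB ->]]] <-]; exact: mg.
Qed.

Lemma subprobP (x : seq_space R) : subprob x <->
  (forall j, 0 <= x j) /\ (forall N, \sum_(0 <= j < N) x j <= 1).
Proof.
split=> -[x0 h]; split=> //.
  move=> N; rewrite -lee_fin -sumEFin; apply: le_trans h.
  by apply: nneseries_lim_ge => j _ _; rewrite lee_fin.
apply: nneseries_le_bound => [j|N]; first by rewrite lee_fin.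
by rewrite sumEFin lee_fin.
Qed.

Lemma measurable_subprob : measurable (@subprob R).
Proof.
rewrite (_ : @subprob R = (\bigcap_j [set x : seq_space R | 0 <= x j]) `&`
   \bigcap_N [set x : seq_space R | \sum_(0 <= j < N) x j <= 1]).
  apply: measurableI; apply: bigcapT_measurable => N.
    rewrite -[X in measurable X]setTI; apply: measurable_fun_le => //.
    exact: measurable_coord.
  rewrite -[X in measurable X]setTI; apply: measurable_fun_le => //.
  by apply: measurable_sum => j; exact: measurable_coord.
apply/seteqP; split=> x.
  by move=> /subprobP[x0 x1]; split=> N _; [exact: x0|exact: x1].
by move=> [x0 x1]; apply/subprobP; split=> N; [exact: x0|exact: x1].
Qed.

End sequence_space.

Section frequencies.
Variable R : realType.
Local Notation avg := (avg R).

Lemma measurable_cluster_freq i :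
  measurable_fun [set: rel_space] (fun E : rel_space => cluster_freq R E i).
Proof.
apply: (@measurable_limn _ _ _ (fun m (E : rel_space) => rel_freq R E i m)) => m.
rewrite [X in measurable_fun _ X](_ : _ = fun E : rel_space => avg (E i) m).
  apply: measurable_funM => //.
  rewrite [X in measurable_fun _ X](_ : _ =
      fun E : rel_space => \sum_(0 <= l < m) \1_[set E : rel_space | E i l] E).
    apply: measurable_sum => l.
    by apply: measurable_indic; exact: measurable_rel.
  apply/funext => E; rewrite cnt_sum; apply: eq_bigr => l _; rewrite indicE.
  by have -> : (E \in [set E : rel_space | E i l]) = E i l by apply/idP/idP; rewrite inE.
by apply/funext => E; rewrite rel_freqE.
Qed.

Lemma measurable_nth_least n j i :
  measurable [set E : rel_space | is_nth_least E n j i].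
Proof.
apply: (@local_upto_measurable i.+1) => E F EF /=.
by rewrite (nth_least_local _ _ EF).
Qed.

Lemma measurable_freqs n : measurable_fun [set: rel_space]
  (fun E : rel_space => freqs R E n : seq_space R).
Proof.
apply: measurable_seq_fun => j.
pose H k : set rel_space := if k is k'.+1 then [set E : rel_space | is_nth_least E n j k']
  else ~` \bigcup_i [set E : rel_space | is_nth_least E n j i].
have mH k : measurable (H k).
  case: k => [|k]; last exact: measurable_nth_least.
  by apply: measurableC; apply: bigcupT_measurable => i; exact: measurable_nth_least.
have -> : [set: rel_space] = \bigcup_k H k.
  apply/seteqP; split=> E // _.
  have [[i Hi]|no] := pselect (exists i, is_nth_least E n j i).
    by exists i.+1.
  by exists 0%N => //= -[i _ Hi]; apply: no; exists i.
apply/measurable_fun_bigcup => // -[|k].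
  apply: (@eq_measurable_fun _ _ _ _ _ (cst (0 : R))) => // E; rewrite inE => nE.
  by rewrite freqs0// => i; apply/negP => Hi; apply: nE; exists i.
apply: (@eq_measurable_fun _ _ _ _ _ (fun E : rel_space => cluster_freq R E k)).
  by move=> E; rewrite inE => /freqsE ->.
apply: measurable_funTS; exact: measurable_cluster_freq.
Qed.

(** For each m the relative frequencies of finitely many clusters among the
    first m elements have sum at most 1, because the clusters are disjoint. *)
Lemma subprob_freqs E n : equivalence_rel E -> has_freqs R E ->
  subprob (freqs R E n : seq_space R).
Proof.
move=> eqE h; apply/subprobP.
(* y j is the indicator of the j-th cluster, or 0 if there is none *)
have [y hy yE] : exists2 y : nat -> pred nat,
    (forall j, avg (y j) @ \oo --> freqs R E n j) &
    (forall j l, y j l -> exists2 i, is_nth_least E n j i & E i l).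
  have : forall j, exists yj : pred nat, avg yj @ \oo --> freqs R E n j /\
      forall l, yj l -> exists2 i, is_nth_least E n j i & E i l.
    move=> j; have [[i Hi]|no] := pselect (exists i, is_nth_least E n j i).
      exists (E i); split=> [|l Eil]; last by exists i.
      by rewrite (freqsE _ Hi) /cluster_freq rel_freqE -rel_freqE; exact: h.
    exists xpred0; split=> //; rewrite freqs0.
      rewrite (_ : avg _ = fun=> 0); first exact: cvg_cst.
      by apply/funext => m; rewrite /avg count_pred0 mul0r.
    by move=> i; apply/negP => Hi; apply: no; exists i.
  by move=> /choice[y hy]; exists y => j; case: (hy j).
split=> [j|N].
  have <- := cvg_lim (@Rhausdorff R) (hy j).
  apply: limr_ge; first by apply/cvg_ex; exists (freqs R E n j); exact: hy.
  by apply: nearW => m; exact: avg_ge0.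
have hs : (fun m => \sum_(0 <= j < N) avg (y j) m) @ \oo -->
    \sum_(0 <= j < N) freqs R E n j.
  elim: (N) => [|N' IH].
    under eq_fun do rewrite big_geq//; rewrite big_geq//; exact: cvg_cst.
  under eq_fun do rewrite big_nat_recr//=; rewrite big_nat_recr//=.
  exact: cvgD.
have <- := cvg_lim (@Rhausdorff R) hs.
apply: limr_le; first by apply/cvg_ex; eexists; exact: hs.
apply: nearW => m; rewrite -mulr_suml; case: m => [|m].
  by rewrite invr0 mulr0.
rewrite ler_pdivrMr ?mul1r ?ltr0n//.
under eq_bigr do rewrite cnt_sum.
rewrite exchange_big /= -[leRHS]mulr1 mulr_natl -[X in _ *+ X]subn0 -sumr_const_nat.
apply: ler_sum => l _.
elim: N {hs} => [|N IH]; first by rewrite big_geq.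
rewrite big_nat_recr//=; have [yN|yN] := boolP (y N l); last by rewrite addr0.
rewrite big_nat big1 ?add0r// => j jN.
have [yj|//] := boolP (y j l).
have [i Hi Eil] := yE _ _ yN; have [i' Hi' Ei'l] := yE _ _ yj.
have ni := nth_least_nat_ge Hi; have ni' := nth_least_nat_ge Hi'.
have Eii' : E i i' by rewrite (equiv_sym _ _ eqE) (eqE i' l i).2// (equiv_sym _ _ eqE).
case: (ltngtP i i') => ii'.
- by move: Hi' => /andP[/is_least_fromP[_ /(_ i)]]; rewrite ni ii' Eii' => /(_ isT).
- move: Hi => /andP[/is_least_fromP[_ /(_ i')]].
  by rewrite ni' ii' (equiv_sym _ _ eqE) Eii' => /(_ isT).
- move: Hi Hi'; rewrite ii' => /andP[_ /eqP NN] /andP[_ /eqP jj].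
  by move: jN; rewrite -jj -NN ltnn andbF.
Qed.

End frequencies.

(** * Joining a given cluster *)

(** These are the events on which one may condition while the elements of a
    cluster that is already represented are swapped with their successors. The
    events on the frequencies at times up to n are of this kind. *)
Definition tail_inv (n : nat) (S : set rel_space) : Prop :=
  forall (E : rel_space) i0 a, equivalence_rel E -> (n <= i0 < a)%N -> E i0 a ->
    S (relabel (swapn a) E) <-> S E.

Lemma tail_invI n S S' : tail_inv n S -> tail_inv n S' -> tail_inv n (S `&` S').
Proof.
move=> iS iS' E i0 a eqE ni0 Ea /=.
by split=> -[/(iS _ _ _ eqE ni0 Ea) ? /(iS' _ _ _ eqE ni0 Ea)].
Qed.

Lemma tail_inv_freqs (R : realType) n k (B : set (seq_space R)) : (k <= n)%N ->
  tail_inv n [set E : rel_space | B (freqs R E k)].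
Proof.
move=> kn E i0 a eqE /andP[ni0 i0a] Ea /=.
by rewrite (freqs_swap _ eqE _ Ea)// i0a (leq_trans kn).
Qed.

Lemma measurable_freqs_preimage (R : realType) n (B : set (seq_space R)) :
  measurable B -> measurable [set E : rel_space | B (freqs R E n)].
Proof. by move=> mB; rewrite -[X in measurable X]setTI; exact: measurable_freqs. Qed.

Section joining.
Context d (T : measurableType d) (R : realType) (P : probability T R).
Variable Pi : T -> rel_space.
Hypotheses (hPi : random_partition Pi) (hpe : partially_exchangeable P Pi).
Local Open Scope ereal_scope.
Local Notation mPi := (measurable_Pi_preimage hPi).

(** The swap of a and a + 1 exchanges the two events of joining; A does not
    see it and S is invariant under it. *)
Lemma join_swap n m i0 a (S A : set rel_space) : measurable S -> tail_inv n S ->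
  local_upto m A -> (n <= i0 < a)%N -> (m <= a)%N ->
  P (Pi @^-1` (S `&` A `&` [set E : rel_space | E i0 a.+1])) =
  P (Pi @^-1` (S `&` A `&` [set E : rel_space | E i0 a])).
Proof.
move=> mS iS lA /andP[ni0 i0a] ma.
have mSA : measurable (S `&` A).
  by apply: measurableI => //; exact: local_upto_measurable lA.
have := pe_swap_join hPi hpe i0a mSA; rewrite [in RHS]setIC => <-.
congr (P _); apply/seteqP.
have ag (w : T) : agree m (Pi w) (relabel (swapn a) (Pi w)).
  by move=> i j im jm; rewrite /relabel !swapn_lt//; lia.
have eqw w : equivalence_rel (Pi w) by exact: hPi.1.
have key w : Pi w i0 a.+1 -> S (relabel (swapn a) (Pi w)) <-> S (Pi w).
  move=> Ea; have Ea' : relabel (swapn a) (Pi w) i0 a.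
    by rewrite /relabel swapnL swapn_lt.
  have := iS _ i0 a (relabel_equiv (swapn a) (eqw w)).
  by rewrite ni0 i0a relabel_swapK => /(_ isT Ea')[h1 h2]; split.
split=> w /=.
  move=> [[Sw Aw] Ea]; split=> //; split; first exact/key.
  exact: lA Aw.
move=> [Ea [Sw Aw]]; split=> //; split; first exact/key.
by apply: lA Aw; exact: agree_sym.
Qed.

Lemma join_const n m i0 k (S A : set rel_space) : measurable S -> tail_inv n S ->
  local_upto m A -> (n <= i0 < m)%N ->
  P (Pi @^-1` (S `&` A `&` [set E : rel_space | E i0 (m + k)%N])) =
  P (Pi @^-1` (S `&` A `&` [set E : rel_space | E i0 m])).
Proof.
move=> mS iS lA /andP[ni0 i0m]; elim: k => [|k IH]; first by rewrite addn0.
by rewrite addnS -IH; apply: (@join_swap n m) => //; lia.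
Qed.

(** The law of large numbers applies to the events that i + 1 + l is in the
    cluster of i: by joins after i they have equal probabilities. For pairs l
    < k one may first bring k down to l + 1, and then move both up by one. *)
Lemma has_freqs_ae : {ae P, forall w, has_freqs R (Pi w)}.
Proof.
rewrite /has_freqs; apply: ae_foralln => i.
pose y l w : bool := Pi w i (i.+1 + l)%N.
have my l : measurable [set w | y l w] by exact: (mPi (measurable_rel _ _)).
pose a := fine (P [set w | y 0%N w]).
pose b := fine (P [set w | y 0%N w && y 1%N w]).
have fin A : measurable A -> P A \is a fin_num.
  by move=> mA; rewrite fin_num_measure.
suff [y1 y2] : (forall l, P [set w | y l w] = a%:E) /\
    (forall l k, l != k -> P [set w | y l w && y k w] = b%:E).
  have := avg_cvg_ae my y1 y2; apply: filterS => w /cvg_ex[l hl].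
  apply/cvg_ex; exists l; rewrite rel_freqE.
  exact/(avg_shift_cvg _ i.+1).
split=> [l|].
  rewrite /a fineK ?fin//; have := @join_const i i.+1 i l setT setT.
  rewrite !setTI => h; rewrite /y addn0; apply: h => //.
  by rewrite leqnn ltnSn.
pose Q l k := P [set w | y l w && y k w].
have QE l k : Q l k = P (Pi @^-1` ([set E : rel_space | E i (i.+1 + l)%N] `&`
    [set E : rel_space | E i (i.+1 + k)%N])).
  by congr (P _); apply/seteqP; split=> w /= /andP.
have Q_next l k : (l < k)%N -> Q l k = Q l l.+1.
  move=> lk; have := @join_const i (i.+1 + l).+1 i (k - l.+1) setT
    [set E : rel_space | E i (i.+1 + l)%N].
  rewrite !setTI !QE -addnS -addnA subnKC// => -> //.
    by move=> E F EF /=; rewrite EF//; lia.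
  by rewrite leqnn addSn ltnS; lia.
have Q_shift l : Q l l.+1 = Q l.+1 l.+2.
  rewrite -(Q_next l l.+2)// !QE.
  have := @pe_swap_join _ _ _ _ _ hPi hpe (i.+1 + l)%N i
    [set E : rel_space | E i (i.+1 + l.+2)%N].
  rewrite -addnS => <- //; last 2 first.
  - by rewrite addSn ltnS leq_addr.
  - exact: measurable_rel.
  congr (P (_ @^-1` (_ `&` _))).
  by apply/seteqP; split=> E /=; rewrite /relabel swapn_lt ?swapn_gt//; lia.
have Q_const l : Q l l.+1 = Q 0%N 1%N by elim: l => // l <-; rewrite -Q_shift.
have Qb : Q 0%N 1%N = b%:E.
  rewrite /b fineK// fin// (_ : mkset _ = [set w | y 0%N w] `&` [set w | y 1%N w]).
    exact: measurableI.
  by apply/seteqP; split=> w /= /andP.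
move=> l k; rewrite neq_ltn => /orP[lk|kl].
  by rewrite -/(Q l k) Q_next// Q_const.
rewrite (_ : mkset _ = [set w | y k w && y l w]).
  by rewrite -/(Q k l) Q_next// Q_const.
by apply/seteqP; split=> w /=; rewrite andbC.
Qed.

Local Notation F n w := (freqs R (Pi w) n : seq_space R).

Lemma subprob_freqs_ae n : {ae P, forall w, subprob (F n w)}.
Proof.
have := has_freqs_ae; apply: filterS => w hw.
by apply: subprob_freqs => //; exact: hPi.1.
Qed.

(** All later elements are equally likely to join the cluster of i0, so the
    probability is the mean proportion of those that do. By dominated
    convergence it is the mean of the frequency. *)
Lemma prob_join n m i0 (S A : set rel_space) : measurable S -> tail_inv n S ->
  local_upto m A -> (n <= i0 < m)%N ->
  P (Pi @^-1` (S `&` A `&` [set E : rel_space | E i0 m])) =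
  \int[P]_(w in Pi @^-1` (S `&` A)) (cluster_freq R (Pi w) i0)%:E.
Proof.
move=> mS iS lA ni0m; set D := Pi @^-1` (S `&` A).
have mA := local_upto_measurable lA.
have mD : measurable D by apply: mPi; exact: measurableI.
have mE l : measurable [set w | Pi w i0 l] by exact: (mPi (measurable_rel _ _)).
set p := P _.
have mPiE l : measurable_fun [set: T] (fun w => (Pi w i0 l)%:R : R).
  rewrite (_ : (fun w => _) = \1_[set w | Pi w i0 l]); first exact: measurable_indic.
  apply/funext => w; rewrite indicE.
  by have -> : (w \in [set w | Pi w i0 l]) = Pi w i0 l by apply/idP/idP; rewrite inE.
pose f N w := avg R (fun l => Pi w i0 (m + l)%N) N.+1.
have mf N : measurable_fun [set: T] (f N).
  apply: measurable_funM => //.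
  rewrite [X in measurable_fun _ X](_ : _ = fun w =>
      (\sum_(0 <= l < N.+1) (Pi w i0 (m + l)%N)%:R)%R).
    exact: measurable_sum.
  by apply/funext => w; rewrite cnt_sum.
have fp N : \int[P]_(w in D) (f N w)%:E = p.
  have -> : \int[P]_(w in D) (f N w)%:E = \int[P]_(w in D)
      ((N.+1%:R^-1)%:E * \sum_(0 <= l < N.+1) (Pi w i0 (m + l)%N)%:R%:E).
    by apply: eq_integral => w _; rewrite /f /avg cnt_sum sumEFin -EFinM mulrC.
  rewrite ge0_integralZl//; last 2 first.
  - by apply: emeasurable_sum => l; apply/measurable_EFinP/measurable_funTS.
  - by move=> w _; apply: sume_ge0 => l _; rewrite lee_fin.
  rewrite ge0_integral_sum//; last first.
    by move=> l; apply/measurable_EFinP/measurable_funTS.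
  have e l : \int[P]_(w in D) (Pi w i0 (m + l)%N)%:R%:E = p.
    rewrite /p -(join_const l mS iS lA ni0m).
    transitivity (\int[P]_(w in D) (\1_[set w | Pi w i0 (m + l)%N] w)%:E).
      apply: eq_integral => w _; congr (_%:E); rewrite indicE.
      by congr (_%:R); congr nat_of_bool; apply/idP/idP; rewrite inE.
    by rewrite integral_indic// setIC.
  under eq_bigr do rewrite e.
  have pfin : p \is a fin_num.
    by rewrite /p fin_num_measure//; apply: mPi; apply: measurableI;
      [exact: measurableI|exact: measurable_rel].
  rewrite -(fineK pfin) sumEFin sumr_const_nat subn0 -EFinM -[X in (_ * X)%R]mulr_natl.
  by rewrite mulrA mulVf ?mul1r.
have mcf : measurable_fun D (fun w => (cluster_freq R (Pi w) i0)%:E).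
  apply/measurable_EFinP; apply: measurable_funTS.
  apply: (measurableT_comp (@measurable_cluster_freq R i0)); exact: measurable_Pi.
have mfE N : measurable_fun D (fun w => (f N w)%:E).
  by apply/measurable_EFinP/measurable_funTS.
have cv : {ae P, forall w, D w ->
    (fun N => (f N w)%:E) @ \oo --> (cluster_freq R (Pi w) i0)%:E}.
  have := has_freqs_ae; apply: filterS => w /(_ i0) hw _.
  apply: cvg_EFin; first exact: nearW.
  rewrite /= (cvg_shiftS (fun N => avg R (fun l => Pi w i0 (m + l)%N) N)).
  by apply/avg_shift_cvg; rewrite -rel_freqE.
have bd : {ae P, forall w N, D w -> `|(f N w)%:E| <= (cst 1 w : \bar R)}.
  by apply: aeW => w N _; rewrite /= lee_fin ger0_norm ?avg_ge0//; exact: avg_le1.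
have [] := dominated_convergence mD mfE mcf cv _ bd.
  exact: finite_measure_integrable_cst.
move=> _ _; rewrite /= (_ : (fun N => _) = cst p); last by apply/funext.
by move=> /(cvg_lim (@ereal_hausdorff R)) <-; rewrite lim_cst.
Qed.

(** On the event that the frequency is 0, [prob_join] gives every later
    element probability 0 of joining. *)
Lemma mate_freq_pos i0 k :
  {ae P, forall w, cluster_freq R (Pi w) i0 = 0%R -> (i0 < k)%N -> ~~ Pi w i0 k}.
Proof.
have [i0k|ki0] := ltnP i0 k; last by apply: aeW => w _.
pose S := [set E : rel_space | cluster_freq R E i0 = 0%R].
have mS : measurable S.
  rewrite (_ : S = (fun E : rel_space => cluster_freq R E i0) @^-1` [set 0%R])//.
  by rewrite -[X in measurable X]setTI; apply: measurable_cluster_freq.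
have iS : tail_inv i0 S.
  move=> E i a eqE /andP[i0i ia] Ea; rewrite /S /= cluster_freq_swap swapn_lt//.
  exact: leq_ltn_trans ia.
have := @prob_join i0 i0.+1 i0 S setT mS iS.
rewrite leqnn ltnSn setIT => /(_ _ isT)h.
have mSE : measurable (Pi @^-1` (S `&` [set E : rel_space | E i0 k])).
  by apply: mPi; apply: measurableI => //; exact: measurable_rel.
have P0 : P (Pi @^-1` (S `&` [set E : rel_space | E i0 k])) = 0.
  have := @join_const i0 i0.+1 i0 (k - i0.+1) S setT mS iS.
  rewrite leqnn ltnSn setIT subnKC// => ->//; rewrite h//.
  by apply: integral0_eq => w /= ->.
exists (Pi @^-1` (S `&` [set E : rel_space | E i0 k])); split => //.
move=> w /= H; apply: contrapT => nS; apply: H => cf0 _.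
by apply/negP => Ek; apply: nS.
Qed.

End joining.

(** * Integrals against a conditional density *)

Section weighted_law.
Context d (T : measurableType d) d' (X : measurableType d') (R : realType).
Variable P : {measure set T -> \bar R}.
Local Open Scope ereal_scope.

Import HBNNSimple.

(** A conditional density that is correct on the events about Y is correct for
    the functions of Y, by approximation with simple functions. *)
Lemma integral_density (D A : set T) (Y : T -> X) (phi g : X -> R) :
  measurable D -> measurable A -> measurable_fun [set: T] Y ->
  measurable_fun [set: X] phi -> measurable_fun [set: X] g ->
  (forall x, 0 <= phi x)%R -> (forall x, 0 <= g x)%R ->
  (forall B, measurable B ->
     P (D `&` A `&` Y @^-1` B) = \int[P]_(w in D `&` Y @^-1` B) (phi (Y w))%:E) ->
  \int[P]_(w in D `&` A) (g (Y w))%:E = \int[P]_(w in D) (phi (Y w) * g (Y w))%:E.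
Proof.
move=> mD mA mY mphi mg phi0 g0 h.
have mDA : measurable (D `&` A) by exact: measurableI.
have mEg : measurable_fun [set: X] (EFin \o g) by exact/measurable_EFinP.
pose f_ := nnsfun_approx measurableT mEg.
have f_cvg x : (fun k => (f_ k x)%:E) @ \oo --> (g x)%:E.
  by apply: (@cvg_nnsfun_approx _ _ _ _ measurableT _ mEg) => // y _; rewrite lee_fin.
have mfY k : measurable_fun [set: T] (fun w => f_ k (Y w)).
  by apply: measurableT_comp => //; exact: measurable_funP.
have mphiY : measurable_fun [set: T] (fun w => phi (Y w)).
  exact: measurableT_comp.
have ndf x : {homo f_ ^~ x : n m / (n <= m)%N >-> (n <= m)%R}.
  by move=> m n mn; exact/lefP/nd_nnsfun_approx.
transitivity (limn (fun k => \int[P]_(w in D `&` A) (f_ k (Y w))%:E)).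
  rewrite -monotone_convergence//.
  - by apply: eq_integral => w _; apply/esym/cvg_lim => //; exact: f_cvg.
  - by move=> k; apply/measurable_EFinP/measurable_funTS.
  - by move=> k w _; rewrite lee_fin.
  - by move=> w _ m n mn; rewrite lee_fin ndf.
transitivity (limn (fun k => \int[P]_(w in D) (phi (Y w) * f_ k (Y w))%:E)); last first.
  rewrite -monotone_convergence//.
  - apply: eq_integral => w _; apply/cvg_lim => //.
    under eq_fun do rewrite EFinM; rewrite EFinM.
    by apply: cvgeZl => //; exact: f_cvg.
  - by move=> k; apply/measurable_EFinP/measurable_funTS/measurable_funM.
  - by move=> k w _; rewrite lee_fin mulr_ge0.
  - by move=> w _ m n mn; rewrite lee_fin ler_wpM2l// ndf.
congr (limn _); apply/funext => k.
have mB r : measurable (Y @^-1` (f_ k @^-1` [set r])).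
  by rewrite -[X in measurable X]setTI; exact: mY.
have f_E x : f_ k x = (\sum_(r \in range (f_ k)) r * \1_(f_ k @^-1` [set r]) x)%R.
  exact: fimfunE.
have r0 r w : (0 <= r * \1_(Y @^-1` (f_ k @^-1` [set r])) w)%R.
  rewrite indicE; case: (boolP (_ \in _)) => [|_]; last by rewrite mulr0.
  by rewrite inE /= => <-; rewrite mulr1.
transitivity (\sum_(r \in range (f_ k))
    \int[P]_(w in D `&` A) (r * \1_(Y @^-1` (f_ k @^-1` [set r])) w)%:E).
  under eq_integral do rewrite f_E -fsumEFin//.
  rewrite ge0_integral_fsum//.
  - move=> r; apply/measurable_EFinP/measurable_funTS/measurable_funM => //.
    by apply: measurable_indic; exact: (mB r).
  - by move=> r w _; rewrite lee_fin; exact: r0.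
transitivity (\sum_(r \in range (f_ k))
    \int[P]_(w in D) (phi (Y w) * (r * \1_(Y @^-1` (f_ k @^-1` [set r])) w))%:E); last first.
  rewrite -ge0_integral_fsum//.
  - apply: eq_integral => w _; rewrite fsumEFin// -mulr_fsumr//.
    by rewrite [in RHS]f_E.
  - move=> r; apply/measurable_EFinP/measurable_funTS/measurable_funM => //.
    by apply: measurable_funM => //; apply: measurable_indic; exact: (mB r).
  - by move=> r w _; rewrite lee_fin mulr_ge0.
apply: eq_fsbigr => r; rewrite inE => -[x _ rx].
have rge0 : (0 <= r)%R by rewrite -rx.
under eq_integral do rewrite EFinM.
rewrite ge0_integralZl//; last first.
  by apply/measurable_EFinP/measurable_funTS; exact: measurable_indic.
rewrite integral_indic// setIC h//.
under [RHS]eq_integral do rewrite mulrCA EFinM.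
rewrite ge0_integralZl//; last 2 first.
- apply/measurable_EFinP/measurable_funTS/measurable_funM => //.
- by move=> w _; rewrite lee_fin mulr_ge0.
congr (_ * _); under [RHS]eq_integral do rewrite EFinM.
rewrite integral_mkcondr; apply: eq_integral => w _.
by rewrite epatch_indic.
Qed.

End weighted_law.

(** * The prediction rules *)

Section truncation.
Variable R : realType.

(** The frequencies form a sub-probability sequence only almost surely; the
    truncation makes the conditional probabilities below nonnegative
    everywhere. *)
Definition to_subprob (x : seq_space R) : seq_space R :=
  fun j => x j * \1_(@subprob R) x.

Lemma to_subprob_id x : subprob x -> to_subprob x = x.
Proof.
by move=> sx; apply/funext => j; rewrite /to_subprob indicE mem_set// mulr1.
Qed.

Lemma subprob_to_subprob x : subprob (to_subprob x).
Proof.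
have [sx|nx] := pselect (subprob x); first by rewrite to_subprob_id.
have -> : to_subprob x = fun=> 0.
  by apply/funext => j; rewrite /to_subprob indicE memNset// mulr0.
by apply/subprobP; split=> // N; rewrite big1.
Qed.

Lemma measurable_to_subprob : measurable_fun [set: seq_space R] to_subprob.
Proof.
apply: measurable_seq_fun => j; apply: measurable_funM; first exact: measurable_coord.
by apply: measurable_indic; exact: measurable_subprob.
Qed.

End truncation.

Definition joins (n i a : nat) : set rel_space :=
  [set E : rel_space | exists i0, is_nth_least E n i i0 /\ E i0 a].

Lemma measurable_joins n i a : measurable (joins n i a).
Proof.
rewrite (_ : joins n i a = \bigcup_i0 ([set E : rel_space | is_nth_least E n i i0] `&`
   [set E : rel_space | E i0 a])).
  apply: bigcupT_measurable => i0; apply: measurableI.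
    exact: measurable_nth_least.
  exact: measurable_rel.
by apply/seteqP; split=> E [i0]; [exists i0|exists i0].
Qed.

Lemma joins_uniq E n i i' a : equivalence_rel E -> joins n i a E ->
  joins n i' a E -> i = i'.
Proof.
move=> eqE [i0 [Hi Ei]] [i0' [Hi' Ei']].
have Eii : E i0 i0' by rewrite (equiv_sym _ _ eqE) (eqE i0' a i0).2// (equiv_sym _ _ eqE).
have ni := nth_least_nat_ge Hi; have ni' := nth_least_nat_ge Hi'.
case: (ltngtP i0 i0') => ii.
- by move: Hi' => /andP[/is_least_fromP[_ /(_ i0)]]; rewrite ni ii Eii => /(_ isT).
- move: Hi => /andP[/is_least_fromP[_ /(_ i0')]].
  by rewrite ni' ii (equiv_sym _ _ eqE) Eii => /(_ isT).
- by move: Hi Hi'; rewrite ii => /andP[_ /eqP <-] /andP[_ /eqP].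
Qed.

Lemma least_joins E n m : equivalence_rel E -> (n <= m)%N ->
  L E n m <-> forall i, (i < cnt (L E n) m)%N -> ~ joins n i m E.
Proof.
move=> eqE nm; split=> [/is_least_fromP[_ Lm] i im [i0 [Hi Ei]]|h].
  have i0m : (i0 < m)%N.
    by rewrite ltnNge; apply/negP => /(nth_least_ge Hi); rewrite leqNgt im.
  by have := Lm i0; rewrite i0m (nth_least_nat_ge Hi) Ei => /(_ isT).
have [i0 Li0 /andP[/andP[ni0]]] := least_rep eqE nm.
rewrite leq_eqVlt => /predU1P[<-//|i0m] Ei0.
have Hi : is_nth_least E n (cnt (L E n) i0) i0 by rewrite /is_nth_least Li0 eqxx.
by exfalso; apply: (h _ (nth_least_lt Hi i0m)); exists i0.
Qed.

Section densities.
Context d (T : measurableType d) (R : realType) (P : probability T R).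
Variable Pi : T -> rel_space.
Hypotheses (hPi : random_partition Pi) (hpe : partially_exchangeable P Pi).
Local Open Scope ereal_scope.
Local Notation mPi := (measurable_Pi_preimage hPi).
Local Notation F n w := (freqs R (Pi w) n : seq_space R).

Lemma measurable_freqs_Pi n : measurable_fun [set: T] (fun w => F n w).
Proof.
apply: (measurableT_comp (@measurable_freqs R n)); exact: measurable_Pi.
Qed.

Lemma measurable_comp_freqs_Pi n (phi : seq_space R -> R) :
  measurable_fun [set: seq_space R] phi ->
  measurable_fun [set: T] (fun w => phi (to_subprob (F n w))).
Proof.
move=> mphi; apply: (measurableT_comp mphi).
apply: (measurableT_comp (@measurable_to_subprob R)); exact: measurable_freqs_Pi.
Qed.

(** [phi] is the conditional probability of A given the n-th sequence of
    frequencies and any tail invariant event, hence also given all the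
    sequences of frequencies up to time n. *)
Definition has_density (n : nat) (A : set rel_space) (phi : seq_space R -> R) : Prop :=
  [/\ measurable A, measurable_fun [set: seq_space R] phi,
      (forall x, subprob x -> (0 <= phi x)%R) &
      forall S, measurable S -> tail_inv n S ->
        P (Pi @^-1` (S `&` A)) =
        \int[P]_(w in Pi @^-1` S) (phi (to_subprob (F n w)))%:E].

Lemma has_density_integral n A phi (g : seq_space R -> R) S : has_density n A phi ->
  measurable_fun [set: seq_space R] g -> (forall x, subprob x -> (0 <= g x)%R) ->
  measurable S -> tail_inv n S ->
  \int[P]_(w in Pi @^-1` (S `&` A)) (g (to_subprob (F n w)))%:E =
  \int[P]_(w in Pi @^-1` S)
    (phi (to_subprob (F n w)) * g (to_subprob (F n w)))%:E.
Proof.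
move=> [mA mphi phi0 hA] mg g0 mS iS; rewrite preimage_setI.
have mts := @measurable_to_subprob R.
apply: (@integral_density _ _ _ _ _ P (Pi @^-1` S) (Pi @^-1` A) (fun w => F n w)
   (phi \o @to_subprob R) (g \o @to_subprob R)).
- exact: mPi.
- exact: mPi.
- exact: measurable_freqs_Pi.
- exact: measurableT_comp.
- exact: measurableT_comp.
- by move=> x; apply: phi0; exact: subprob_to_subprob.
- by move=> x; apply: g0; exact: subprob_to_subprob.
move=> B mB; have := hA (S `&` [set E : rel_space | B (freqs R E n)]).
rewrite /= => <-.
- by congr (P _); apply/seteqP; split=> w /= [[? ?] ?].
- by apply: measurableI => //; exact: measurable_freqs_preimage.
- by apply: tail_invI => //; exact: tail_inv_freqs.
Qed.

Lemma has_density_ge0 n A phi w : has_density n A phi ->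
  0 <= (phi (to_subprob (F n w)))%:E.
Proof.
by move=> [_ _ phi0 _]; rewrite lee_fin; apply: phi0; exact: subprob_to_subprob.
Qed.

Lemma has_densityT n : has_density n setT (fun=> 1%R).
Proof.
split=> // S mS iS; rewrite setIT integral_cst//; first by rewrite mul1e.
exact: mPi.
Qed.

Lemma has_density_eq n (A B : set rel_space) phi (psi : seq_space R -> R) :
  has_density n A phi -> measurable B ->
  (forall E : rel_space, equivalence_rel E -> A E <-> B E) ->
  measurable_fun [set: seq_space R] psi ->
  (forall x, subprob x -> phi x = psi x) -> has_density n B psi.
Proof.
move=> [mA mphi phi0 hA] mB AB mpsi phipsi; split=> //.
  by move=> x sx; rewrite -phipsi// phi0.
move=> S mS iS; transitivity (P (Pi @^-1` (S `&` A))).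
  congr (P _); apply/seteqP; split=> w /= [Sw]; have := AB _ (hPi.1 w) => -[? ?];
  by split; auto.
rewrite hA//; apply: eq_integral => w _.
by rewrite phipsi//; exact: subprob_to_subprob.
Qed.

Lemma has_density_add n (A B C : set rel_space) phi psi : has_density n A phi ->
  has_density n B psi -> measurable C ->
  (forall E : rel_space, equivalence_rel E -> C E <-> A E \/ B E) ->
  (forall E : rel_space, equivalence_rel E -> ~ (A E /\ B E)) ->
  has_density n C (fun x => phi x + psi x)%R.
Proof.
move=> dA dB mC CAB nAB; case: (dA) (dB) => [mA mphi phi0 hA] [mB mpsi psi0 hB].
split=> //; first exact: measurable_funD.
  by move=> x sx; rewrite addr_ge0 ?phi0 ?psi0.
move=> S mS iS; transitivity (P (Pi @^-1` (S `&` A) `|` Pi @^-1` (S `&` B))).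
  congr (P _); apply/seteqP; split=> w /=; have := CAB _ (hPi.1 w) => -[h1 h2].
    by move=> [Sw /h1[]]; [left|right].
  by case=> -[Sw ?]; split=> //; apply: h2; [left|right].
have mSA : measurable (Pi @^-1` (S `&` A)) by apply: mPi; exact: measurableI.
have mSB : measurable (Pi @^-1` (S `&` B)) by apply: mPi; exact: measurableI.
rewrite measureU//; last first.
  by apply/seteqP; split=> w //= [[_ ?] [_ ?]]; exact: (nAB _ (hPi.1 w)).
rewrite [X in X + _]hA// [X in _ + X]hB// -ge0_integralD//.
- exact: mPi.
- by move=> w _; exact: has_density_ge0 dA.
- by apply/measurable_EFinP/measurable_funTS/measurable_comp_freqs_Pi.
- by move=> w _; exact: has_density_ge0 dB.
- by apply/measurable_EFinP/measurable_funTS/measurable_comp_freqs_Pi.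
Qed.

Lemma has_density_sub n (A B C : set rel_space) phi psi
    (chi : seq_space R -> R) :
  has_density n A phi -> has_density n B psi -> measurable C ->
  (forall E : rel_space, equivalence_rel E -> A E <-> B E \/ C E) ->
  (forall E : rel_space, equivalence_rel E -> ~ (B E /\ C E)) ->
  measurable_fun [set: seq_space R] chi ->
  (forall x, subprob x -> (0 <= chi x)%R) ->
  (forall x, subprob x -> phi x = (psi x + chi x)%R) ->
  has_density n C chi.
Proof.
move=> dA dB mC ABC nBC mchi chi0 e.
case: (dA) (dB) => [mA mphi phi0 hA] [mB mpsi psi0 hB].
split=> // S mS iS.
have mSB : measurable (Pi @^-1` (S `&` B)) by apply: mPi; exact: measurableI.
have mSC : measurable (Pi @^-1` (S `&` C)) by apply: mPi; exact: measurableI.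
have mSC' : measurable (Pi @^-1` S) by exact: mPi.
have PBfin : P (Pi @^-1` (S `&` B)) \is a fin_num by rewrite fin_num_measure.
rewrite -[LHS](addeK _ PBfin) -[RHS](addeK _ PBfin); congr (_ - _).
rewrite addeC [RHS]addeC; transitivity (P (Pi @^-1` (S `&` A))).
  transitivity (P (Pi @^-1` (S `&` B) `|` Pi @^-1` (S `&` C))).
    rewrite measureU//.
    by apply/seteqP; split=> w //= [[_ ?] [_ ?]]; exact: (nBC _ (hPi.1 w)).
  congr (P _); apply/seteqP; split=> w /=; have := ABC _ (hPi.1 w) => -[h1 h2].
    by case=> -[Sw ?]; split=> //; apply: h2; [left|right].
  by move=> [Sw /h1[]]; [left|right].
rewrite hA// [X in X + _]hB// -ge0_integralD//.
- by apply: eq_integral => w _; rewrite -EFinD -e//; exact: subprob_to_subprob.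
- by move=> w _; exact: has_density_ge0 dB.
- by apply/measurable_EFinP/measurable_funTS/measurable_comp_freqs_Pi.
- by move=> w _; rewrite lee_fin; apply: chi0; exact: subprob_to_subprob.
- by apply/measurable_EFinP/measurable_funTS/measurable_comp_freqs_Pi.
Qed.

(** One splits according to the representative i0 of the i-th cluster and
    applies [prob_join]; the frequency of the cluster of i0 is then the i-th
    frequency. *)
Lemma prob_joins n m A i S : (n <= m)%N -> local_upto m A ->
  (forall E : rel_space, equivalence_rel E -> A E -> (i < cnt (L E n) m)%N) ->
  measurable S -> tail_inv n S ->
  P (Pi @^-1` (S `&` (A `&` joins n i m))) =
  \int[P]_(w in Pi @^-1` (S `&` A)) (to_subprob (F n w) i)%:E.
Proof.
move=> nm lA Ai mS iS; have mA := local_upto_measurable lA.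
pose N i0 := [set E : rel_space | is_nth_least E n i i0].
have mN i0 : measurable (N i0) by exact: measurable_nth_least.
have mSAN i0 : measurable (Pi @^-1` (S `&` (A `&` N i0))).
  by apply: mPi; apply: measurableI => //; exact: measurableI.
have tN (B : nat -> set rel_space) :
    trivIset setT (fun i0 => Pi @^-1` (S `&` (A `&` N i0) `&` B i0)).
  move=> j j' _ _ [w [[[_ [_ h]] _] [[_ [_ h']] _]]].
  exact: nth_least_uniq h h'.
have mF : measurable_fun [set: T] (fun w => (to_subprob (F n w) i)%:E).
  apply/measurable_EFinP.
  exact: (@measurable_comp_freqs_Pi n (fun x => x i) (@measurable_coord R i)).
transitivity (P (\bigcup_i0 Pi @^-1` (S `&` (A `&` N i0) `&` [set E : rel_space | E i0 m]))).
  congr (P _); apply/seteqP; split=> w /=.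
    by move=> [Sw [Aw [i0 [Ni Ei]]]]; exists i0.
  by move=> [i0 _ [[Sw [Aw Ni]] Ei]]; split=> //; split=> //; exists i0.
have mSANE i0 : measurable
    (Pi @^-1` (S `&` (A `&` N i0) `&` [set E : rel_space | E i0 m])).
  rewrite preimage_setI; apply: measurableI => //.
  by apply: mPi; exact: measurable_rel.
rewrite measure_semi_bigcup//; last exact: bigcupT_measurable.
have -> : Pi @^-1` (S `&` A) = \bigcup_i0 Pi @^-1` (S `&` (A `&` N i0)).
  apply/seteqP; split=> w /=.
    move=> [Sw Aw]; have [i0 _ Hi] := nth_least_ex (Ai _ (hPi.1 w) Aw).
    by exists i0.
  by move=> [i0 _ [Sw [Aw _]]].
rewrite ge0_integral_bigcup//; last 3 first.
- exact: measurable_funTS.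
- by move=> w _; rewrite lee_fin; case/subprobP: (subprob_to_subprob (F n w)).
- by have := tN (fun=> setT); under eq_fun do rewrite setIT.
apply: eq_eseriesr => i0 _.
have [i0m|mi0] := ltnP i0 m; last first.
  have empty : Pi @^-1` (S `&` (A `&` N i0)) = set0.
    apply/seteqP; split=> w //= [_ [Aw Ni]].
    by have := nth_least_ge Ni mi0; rewrite leqNgt Ai//; exact: hPi.1.
  by rewrite empty integral_set0 preimage_setI empty set0I measure0.
have [ni0|i0n] := leqP n i0; last first.
  have empty : Pi @^-1` (S `&` (A `&` N i0)) = set0.
    apply/seteqP; split=> w //= [_ [Aw Ni]].
    by have := nth_least_nat_ge Ni; rewrite leqNgt i0n.
  by rewrite empty integral_set0 preimage_setI empty set0I measure0.
transitivity (\int[P]_(w in Pi @^-1` (S `&` (A `&` N i0)))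
    (cluster_freq R (Pi w) i0)%:E).
  apply: (prob_join hPi hpe mS iS); last by rewrite ni0.
  move=> E E' EE [AE NE]; split; first exact: lA AE.
  by rewrite /N /= -(nth_least_local _ _ EE).
apply: ae_eq_integral => //.
- apply/measurable_EFinP/measurable_funTS.
  apply: (measurableT_comp (@measurable_cluster_freq R i0)); exact: measurable_Pi.
- exact: measurable_funTS.
have := subprob_freqs_ae hPi hpe n; apply: filterS => w sw /= [_ [_ Ni]].
by rewrite to_subprob_id// (freqsE _ Ni).
Qed.

(** Prediction rule for a cluster already seen. The densities multiply, since
    the frequency is a function of the condition. *)
Lemma has_density_joins n m A phi i : (n <= m)%N -> local_upto m A ->
  has_density n A phi ->
  (forall E : rel_space, equivalence_rel E -> A E -> (i < cnt (L E n) m)%N) ->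
  has_density n (A `&` joins n i m) (fun x => phi x * x i)%R.
Proof.
move=> nm lA dA Ai; case: (dA) => [mA mphi phi0 hA]; split.
- by apply: measurableI => //; exact: measurable_joins.
- by apply: measurable_funM => //; exact: measurable_coord.
- by move=> x sx; rewrite mulr_ge0 ?phi0//; move/subprobP: sx => [].
move=> S mS iS; rewrite prob_joins//.
rewrite -(has_density_integral dA (@measurable_coord R i))//.
by move=> x /subprobP[].
Qed.

Lemma partial_sum_le1 (x : seq_space R) k : subprob x ->
  (0 <= 1 - \sum_(0 <= i < k) x i)%R.
Proof. by move=> /subprobP[_ h]; rewrite subr_ge0. Qed.

(** Prediction rule for a new cluster: the events that m joins one of the k
    clusters seen are taken away from A one after the other. *)
Lemma has_density_new n m A phi k : (n <= m)%N -> local_upto m A ->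
  has_density n A phi ->
  (forall E : rel_space, equivalence_rel E -> A E -> cnt (L E n) m = k) ->
  has_density n (A `&` [set E : rel_space | L E n m])
    (fun x => phi x * (1 - \sum_(0 <= i < k) x i))%R.
Proof.
move=> nm lA dA Ak; case: (dA) => [mA mphi phi0 hA].
have msum j : measurable_fun [set: seq_space R] (fun x => \sum_(0 <= i < j) x i)%R.
  by apply: measurable_sum => i; exact: measurable_coord.
have mchi j : measurable_fun [set: seq_space R]
    (fun x => phi x * (1 - \sum_(0 <= i < j) x i))%R.
  by apply: measurable_funM => //; exact: measurable_funB.
have chi0 j x : subprob x -> (0 <= phi x * (1 - \sum_(0 <= i < j) x i))%R.
  by move=> sx; rewrite mulr_ge0 ?phi0 ?partial_sum_le1.
pose C j := A `&` \bigcap_(i in `I_j) ~` joins n i m.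
have mC j : measurable (C j).
  apply: measurableI => //; apply: bigcap_measurableType => i _.
  by apply: measurableC; exact: measurable_joins.
have dC j : (j <= k)%N ->
    has_density n (C j) (fun x => phi x * (1 - \sum_(0 <= i < j) x i))%R.
  elim: j => [_|j IH jk].
    apply: (has_density_eq dA) => // [E _|x _].
      by rewrite /C; split=> [AE|[]//]; split.
    by rewrite big_geq// subr0 mulr1.
  have dj := has_density_joins nm lA dA (i := j).
  apply: (has_density_sub (IH (ltnW jk)) (dj _) (mC _)) => //.
  - by move=> E eqE AE; rewrite (Ak E).
  - move=> E eqE; split.
      move=> [AE h]; have [J|J] := pselect (joins n j m E); first by left.
      right; split=> // i /=; rewrite ltnS leq_eqVlt => /predU1P[->//|ij].
      exact: h.
    case=> [[AE J]|[AE h]]; split=> // i /= ij.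
      by move=> /(joins_uniq eqE J) ji; rewrite ji ltnn in ij.
    by apply: h => /=; exact: ltnW.
  - by move=> E eqE [[_ J] [_ /(_ j)]]; apply => //=.
  - by move=> x sx; exact: chi0.
  - by move=> x sx; rewrite big_nat_recr//=; ring.
apply: (has_density_eq (dC k (leqnn k))) => //.
  apply: measurableI => //; apply: (@local_upto_measurable m.+1) => E E' EE /=.
  by rewrite (least_local _ EE).
move=> E eqE; split=> -[AE h]; split=> //.
  apply/(least_joins eqE nm) => i; rewrite (Ak E)//; exact: h.
by move=> i /= ik; apply: (least_joins eqE nm).1 => //; rewrite (Ak E).
Qed.

End densities.

(** * Waiting for the return of the first cluster *)

Section waiting_densities.
Variable R : realType.
Implicit Types x : seq_space R.

(** The conditional probability of joining one of the j clusters that have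
    been seen besides the first. *)
Definition others (x : seq_space R) (j : nat) : R := \sum_(1 <= i < j.+1) x i.

(** The conditional probability that, r steps after the first element, its
    cluster has not come back and j other clusters have appeared. The
    prediction rules give the recursion: a step keeps j with probability
    [others x j], and leads from j to j + 1 with probability 1 - x_0 - ... -
    x_j. *)
Fixpoint wait_prob (j r : nat) (x : seq_space R) : R :=
  if r is r'.+1 then
    wait_prob j r' x * others x j +
    (if j is j'.+1 then wait_prob j' r' x * (1 - \sum_(0 <= i < j) x i) else 0)
  else (j == 0%N)%:R.

Lemma othersS x j : \sum_(0 <= i < j.+1) x i = x 0%N + others x j.
Proof. by rewrite big_ltn. Qed.

Lemma others_ge0 x j : subprob x -> 0 <= others x j.
Proof. by move=> /subprobP[x0 _]; apply: sumr_ge0 => i _; exact: x0. Qed.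

Lemma others_le1 x j : subprob x -> 0 <= 1 - x 0%N - others x j.
Proof.
move=> /subprobP[_ /(_ j.+1)]; rewrite othersS.
by rewrite -subr_ge0 opprD addrA.
Qed.

Lemma measurable_others j : measurable_fun [set: seq_space R] (fun x => others x j).
Proof. by apply: measurable_sum => i; exact: measurable_coord. Qed.

Lemma measurable_wait_prob j r : measurable_fun [set: seq_space R] (wait_prob j r).
Proof.
elim: r j => [|r IH] j; first exact: measurable_cst.
apply: measurable_funD.
  by apply: measurable_funM => //; exact: measurable_others.
case: j => [|j]; first exact: measurable_cst.
apply: measurable_funM => //; apply: measurable_funB => //.
by apply: measurable_sum => i; exact: measurable_coord.
Qed.

Lemma wait_prob_ge0 j r x : subprob x -> 0 <= wait_prob j r x.
Proof.
move=> sx; elim: r j => [|r IH] j /=; first exact: ler0n.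
rewrite addr_ge0 ?mulr_ge0 ?others_ge0//.
by case: j => // j; rewrite mulr_ge0// partial_sum_le1.
Qed.

Lemma top_gt_probS x j : top_gt_prob x j.+1 =
  top_gt_prob x j * (1 - x 0%N / (1 - others x j)).
Proof.
rewrite /top_gt_prob big_nat_recr//=; congr (_ * (_ - _ / (_ - _))).
by rewrite big_add1.
Qed.

Lemma top_gt_prob0 x : top_gt_prob x 0 = 1.
Proof. by rewrite /top_gt_prob big_geq. Qed.

Lemma measurable_invr : measurable_fun [set: R] (fun t : R => t^-1).
Proof.
rewrite -(setvU [set (0 : R)]); apply/measurable_funU => //.
  exact: measurableC.
split.
  apply: open_continuous_measurable_fun; first exact: closed_openC.
  by move=> t /set_mem /= t0; apply: inv_continuous; exact/eqP.
apply: (@eq_measurable_fun _ _ _ _ _ (cst (0 : R)^-1)) => // t.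
by rewrite inE => ->.
Qed.

Lemma measurable_top_gt_prob j :
  measurable_fun [set: seq_space R] (fun x => top_gt_prob x j).
Proof.
elim: j => [|j IH].
  rewrite (_ : (fun x => _) = cst 1); first exact: measurable_cst.
  by apply/funext => x; rewrite top_gt_prob0.
rewrite (_ : (fun x => _) =
    fun x : seq_space R => top_gt_prob x j * (1 - x 0%N / (1 - others x j))).
  apply: measurable_funM => //; apply: measurable_funB => //.
  apply: measurable_funM; first exact: measurable_coord.
  apply: (measurableT_comp measurable_invr); apply: measurable_funB => //.
  exact: measurable_others.
by apply/funext => x; rewrite top_gt_probS.
Qed.

Section positive.
Variable x : seq_space R.
Hypotheses (sx : subprob x) (x0 : 0 < x 0%N).

Lemma others_lt1 j : 0 < 1 - others x j.
Proof.
by move: x0 (others_le1 j sx); move: (others x j) (x 0%N) => a b; lra.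
Qed.

Lemma top_gt_prob_factor j : 0 <= 1 - x 0%N / (1 - others x j) <= 1 - x 0%N.
Proof.
move: x0 (others_lt1 j) (others_le1 j sx) (others_ge0 j sx).
move: (others x j) (x 0%N) => a b b0 a1 ab a0; apply/andP; split.
  by rewrite subr_ge0 ler_pdivrMr// mul1r; lra.
by rewrite lerD2l lerN2 ler_pdivlMr//; nra.
Qed.

Lemma top_gt_prob_ge0 j : 0 <= top_gt_prob x j.
Proof.
elim: j => [|j IH]; first by rewrite top_gt_prob0.
by rewrite top_gt_probS mulr_ge0//; case/andP: (top_gt_prob_factor j).
Qed.

Lemma top_gt_prob_le j : top_gt_prob x j <= (1 - x 0%N) ^+ j.
Proof.
elim: j => [|j IH]; first by rewrite top_gt_prob0.
rewrite top_gt_probS exprSr.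
by have /andP[h1 h2] := top_gt_prob_factor j; rewrite ler_pM ?top_gt_prob_ge0.
Qed.

Lemma top_gt_prob_nonincr j : top_gt_prob x j.+1 <= top_gt_prob x j.
Proof.
rewrite top_gt_probS ler_piMr ?top_gt_prob_ge0//.
have /andP[_] := top_gt_prob_factor j.
by move: x0; move: (x 0%N) (_ / _) => a b; lra.
Qed.

(** Every factor of the product is at most 1 - x_0 < 1, so the law of the
    position is proper. *)
Lemma top_gt_prob_cvg0 : (fun j => top_gt_prob x j) @ \oo --> (0 : R).
Proof.
have x1 : x 0%N <= 1.
  by move/subprobP: sx => [_ /(_ 1%N)]; rewrite big_nat1.
apply: (@squeeze_cvgr _ _ _ _ (fun=> 0) (fun j => (1 - x 0%N) ^+ j)).
- by apply: nearW => j; rewrite top_gt_prob_ge0 top_gt_prob_le.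
- exact: cvg_cst.
- apply: cvg_expr; move: x0 x1; move: (x 0%N) => a a0 a1.
  by rewrite ger0_norm; lra.
Qed.

Lemma wait_step j : top_gt_prob x j.+1 =
  top_gt_prob x j / (1 - others x j) * (1 - \sum_(0 <= i < j.+1) x i).
Proof.
rewrite top_gt_probS othersS; move: (others_lt1 j).
move: (others x j) (x 0%N) => a b a1; field; exact: lt0r_neq0.
Qed.

(** A bounded monotone solution converges, and its limit is the fixed point of
    the limiting recursion. *)
Lemma affine_recursion_cvg (U V : R^nat) (s v : R) : s < 1 ->
  nondecreasing_seq U -> (forall N, U N.+1 = U N * s + V N) ->
  (forall N, V N <= v) -> V @ \oo --> v -> U @ \oo --> v / (1 - s).
Proof.
move=> s1 ndU rec Vv cV; have s1' : 0 < 1 - s by rewrite subr_gt0.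
have cU : cvgn U.
  apply: nondecreasing_is_cvgn => //; exists (v / (1 - s)) => _ [N _ <-].
  rewrite ler_pdivlMr// mulrBr mulr1 lerBlDr.
  rewrite (le_trans (ndU _ _ (leqnSn N)))// rec addrC lerD2r.
  exact: Vv.
have cU1 : (fun N => U N.+1) @ \oo --> limn U by rewrite cvg_shiftS.
have cU2 : (fun N => U N.+1) @ \oo --> limn U * s + v.
  under eq_fun do rewrite rec.
  by apply: cvgD => //; apply: cvgMl.
have e := cvg_unique (@Rhausdorff R) cU1 cU2.
suff <- : limn U = v / (1 - s) by [].
apply: (canRL (mulfK (lt0r_neq0 s1'))).
by rewrite mulrBr mulr1 {1}e addrAC subrr add0r.
Qed.

(** The expected time spent waiting with j other clusters: the probability
    [top_gt_prob x j] of ever being in this situation, times the mean 1 / (1 -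
    others x j) of a geometric holding time. *)
Lemma wait_prob_series j :
  series (fun r => wait_prob j r x) @ \oo --> top_gt_prob x j / (1 - others x j).
Proof.
have nd i : nondecreasing_seq (series (fun r => wait_prob i r x)).
  apply/nondecreasing_seqP => n; rewrite /series /= big_nat_recr//=.
  by rewrite lerDl wait_prob_ge0.
elim: j => [|j IH].
  apply: (@affine_recursion_cvg _ (fun=> 1)) => //.
  - by have := others_lt1 0; rewrite subr_gt0.
  - move=> N; rewrite /series /= big_nat_recl//= addrC; congr (_ + _).
    by rewrite mulr_suml; apply: eq_bigr => r _; rewrite addr0.
  - by move=> N; rewrite top_gt_prob0.
  - by rewrite top_gt_prob0; exact: cvg_cst.
apply: (@affine_recursion_cvg _
    (fun N => series (fun r => wait_prob j r x) N * (1 - \sum_(0 <= i < j.+1) x i))) => //.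
- by have := others_lt1 j.+1; rewrite subr_gt0.
- move=> N; rewrite /series /= big_nat_recl//= add0r big_split /=.
  by rewrite !mulr_suml.
- move=> N; rewrite (wait_step j) ler_wpM2r ?partial_sum_le1//.
  have cj : cvgn (series (fun r => wait_prob j r x)).
    by apply/cvg_ex; eexists; exact: IH.
  by have := nondecreasing_cvgn_le (nd j) cj N; rewrite (cvg_lim _ IH).
- by rewrite wait_step; apply: cvgMl.
Qed.

(** Summation over the time at which the cluster number j + 1 besides the
    first is discovered. *)
Lemma wait_prob_exit j :
  (\sum_(0 <= r <oo) (wait_prob j r x * (1 - \sum_(0 <= i < j.+1) x i))%:E =
   (top_gt_prob x j.+1)%:E)%E.
Proof.
apply/cvg_lim => //; under eq_fun do rewrite sumEFin -mulr_suml.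
apply: cvg_EFin; first exact: nearW.
by rewrite wait_step; apply: cvgMl; exact: wait_prob_series.
Qed.

End positive.
End waiting_densities.

(** * The law of the position of the first cluster *)

(** The number of clusters seen, itself included, before the first cluster of
    {k | n <= k} comes back: its place in {k | n + 1 <= k}. The default value
    is for a cluster that never comes back, whose frequency is 0. *)
Definition top_position (n : nat) (E : rel_space) : nat :=
  if pselect (exists k, returns E n k) is left ex
  then cnt (L E n) (ex_minn ex) else 1%N.

Definition waiting (n j m : nat) : set rel_space :=
  [set E : rel_space | cnt (L E n) m = j.+1 /\ forall k, (n < k < m)%N -> ~~ E n k].

(** For a cluster that comes back this says that its position exceeds j, but
    it is decided when the j-th other cluster is discovered. *)
Definition late (n j : nat) : set rel_space :=
  [set E : rel_space | exists m, is_nth_least E n j m /\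
     forall k, (n < k < m)%N -> ~~ E n k].

Lemma top_position_gt0 n E : (0 < top_position n E)%N.
Proof.
rewrite /top_position; case: pselect => // ex.
case: ex_minnP => rho /andP[nr _] _.
by rewrite (leq_trans _ (cnt_homo _ nr))// cntS least_self addn1.
Qed.

Lemma top_position_late n j (E : rel_space) : (exists k, returns E n k) ->
  (j < top_position n E)%N <-> late n j E.
Proof.
rewrite /top_position => ex0; case: pselect => // ex.
case: ex_minnP => rho /andP[nr Er] rmin; split=> [/nth_least_ex[m mr Hm]|[m [Hm h]]].
  exists m; split=> // k /andP[nk km]; apply/negP => Ek.
  by have := rmin k; rewrite /returns nk Ek => /(_ isT); rewrite leqNgt (ltn_trans km).
apply: (nth_least_lt Hm); rewrite ltnNge; apply/negP => rm.
move: rm; rewrite leq_eqVlt => /predU1P[rm|rm]; last first.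
  by have := h rho; rewrite nr rm Er => /(_ isT).
by move: Hm => /andP[/is_least_fromP[_ /(_ n)]]; rewrite leqnn -rm nr Er => /(_ isT).
Qed.

Lemma measurable_top_position n : measurable_fun [set: rel_space] (top_position n).
Proof.
have mk k : measurable [set E : rel_space | top_position n E = k].
  pose Rt r := [set E : rel_space | returns E n r /\ (forall i, (i < r)%N -> ~~ returns E n i)].
  have mR r : measurable (Rt r).
    apply: (@local_upto_measurable (maxn n r).+1) => E F EF [h1 h2].
    have e i : (i <= r)%N -> returns F n i = returns E n i.
      move=> ir; rewrite /returns EF//; first by rewrite ltnS leq_maxl.
      by rewrite ltnS (leq_trans ir)// leq_maxr.
    by split; [rewrite e|move=> i ir; rewrite e ?(ltnW ir)//; exact: h2].
  have mnR : measurable (~` \bigcup_r Rt r).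
    by apply: measurableC; exact: bigcupT_measurable.
  have mC r : measurable [set E : rel_space | cnt (L E n) r = k].
    apply: (@local_upto_measurable r) => E F EF /= <-.
    by rewrite (cnt_least_local _ EF).
  rewrite (_ : mkset _ = (\bigcup_r (Rt r `&` [set E : rel_space | cnt (L E n) r = k]))
     `|` ((~` \bigcup_r Rt r) `&` [set _ | k = 1%N])).
    apply: measurableU.
      by apply: bigcupT_measurable => r; exact: measurableI.
    apply: measurableI => //; have [->|k1] := eqVneq k 1%N.
      by rewrite (_ : mkset _ = setT)//; apply/seteqP; split.
    by rewrite (_ : mkset _ = set0)//; apply/seteqP; split=> // E /= k1'; rewrite k1' eqxx in k1.
  apply/seteqP; split=> E; rewrite /top_position /=.
    case: pselect => [ex|nex].
      case: ex_minnP => r hr rmin <-; left; exists r => //; split=> //; split=> // i ir.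
      by apply/negP => /rmin; rewrite leqNgt ir.
    move=> <-; right; split=> // -[r _ [hr _]]; apply: nex.
    by exists r.
  move=> [[r _ [[hr hmin] <-]]|[nR ->]]; case: pselect => [ex|nex].
  - case: ex_minnP => r' hr' rmin; congr (count _ (iota 0 _)).
    apply/eqP; rewrite eqn_leq rmin//= leqNgt; apply/negP => /hmin.
    by rewrite hr'.
  - by exfalso; apply: nex; exists r.
  - exfalso; apply: nR; case: (ex_minnP ex) => r hr rmin; exists r => //.
    by split=> // i ir; apply/negP => /rmin; rewrite leqNgt ir.
  - by [].
move=> _ B _; rewrite setTI.
rewrite (_ : _ @^-1` _ = \bigcup_(k in B) [set E : rel_space | top_position n E = k]).
  by apply: bigcup_measurable => k _; exact: mk.
by apply/seteqP; split=> E /=; [move=> BE; exists (top_position n E)|move=> [k Bk tk]]; rewrite ?tk.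
Qed.

Lemma no_return_freq (R : realType) (E : rel_space) n :
  (forall k, ~~ returns E n k) -> cluster_freq R E n = 0.
Proof.
move=> nr; apply/cvg_lim => //; rewrite rel_freqE.
apply/(avg_shift_cvg _ n.+1).
rewrite (_ : avg R _ = fun=> 0); first exact: cvg_cst.
apply/funext => m; rewrite /avg cnt0 ?mul0r// => k _.
by have := nr (n.+1 + k)%N; rewrite /returns addSn ltnS leq_addr.
Qed.

Section position_law.
Context d (T : measurableType d) (R : realType) (P : probability T R).
Variable Pi : T -> rel_space.
Hypotheses (hPi : random_partition Pi) (hpe : partially_exchangeable P Pi).
Local Open Scope ereal_scope.
Local Notation mPi := (measurable_Pi_preimage hPi).
Local Notation F n w := (freqs R (Pi w) n : seq_space R).
Local Notation has_density := (has_density P Pi).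

Lemma local_upto_waiting n j m : (n < m)%N -> local_upto m (waiting n j m).
Proof.
move=> nm E E' EE [h1 h2]; split; first by rewrite -h1 (cnt_least_local _ EE).
by move=> k /[dup] /andP[_ km] /h2; rewrite EE.
Qed.

Lemma joins0 n m (E : rel_space) : joins n 0 m E <-> E n m.
Proof.
split=> [[i0 [H0 Ei0]]|Em]; last by exists n; split=> //; exact: nth_least0.
by rewrite (nth_least_uniq (nth_least0 E n) H0).
Qed.

(** The element m = n + 1 + r joins the first cluster, or one of the j others,
    or none. Waiting stops in the first case, goes on with the same j in the
    second, and with j + 1 in the third. *)
Lemma has_density_waiting n j r :
  has_density n (waiting n j (n.+1 + r)) (wait_prob j r).
Proof.
elim: r j => [|r IH] j.
  have cn1 E : cnt (L E n) n.+1 = 1%N by rewrite cntS cnt_least_n// least_self.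
  rewrite addn0; case: j => [|j].
    apply: (has_density_eq hPi (has_densityT _ hPi n)) => //.
    - by apply: local_upto_measurable; exact: local_upto_waiting.
    - by move=> E _; split=> // _; split=> //; lia.
    - exact: measurable_wait_prob.
  have e : waiting n j.+1 n.+1 = set0.
    by apply/seteqP; split=> E //= -[]; rewrite cn1.
  split=> //=; first by rewrite e.
  move=> S mS iS; rewrite e setI0 preimage_set0 measure0.
  by rewrite integral0_eq.
set m := (n.+1 + r)%N in IH *.
have nm : (n < m)%N by rewrite /m addSn ltnS leq_addr.
have lW i := @local_upto_waiting n i m nm.
have cW i E : waiting n i m E -> cnt (L E n) m = i.+1 by case.
have dnew i := has_density_new hPi hpe (ltnW nm) (lW i) (IH i) (fun E _ => cW i E).
have dret : has_density n (waiting n j m `&` joins n 0 m)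
    (fun x => wait_prob j r x * x 0%N)%R.
  by apply: (has_density_joins hPi hpe (ltnW nm) (lW j) (IH j)) => E _ /cW ->.
have mW i : measurable (waiting n i m) by exact: local_upto_measurable (lW i).
have mLm : measurable [set E : rel_space | L E n m].
  apply: (@local_upto_measurable m.+1) => E E' EE /=.
  by rewrite (least_local _ EE).
have mwp i : measurable_fun [set: seq_space R] (fun x => wait_prob i r x).
  exact: measurable_wait_prob.
have mJ : measurable (waiting n j m `&` ~` joins n 0 m).
  by apply: measurableI => //; apply: measurableC; exact: measurable_joins.
have mc0 : measurable_fun [set: seq_space R] (fun x => x 0%N).
  exact: measurable_coord.
have Lnot (E : rel_space) : L E n m -> ~ joins n 0 m E.
  by move=> /is_least_fromP[_ Lm] /joins0 Em; have := Lm n; rewrite leqnn nm Em => /(_ isT).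
have le1 (x : seq_space R) : subprob x -> (0 <= 1 - x 0%N)%R.
  by move=> /subprobP[_ /(_ 1%N)]; rewrite big_nat1 subr_ge0.
have dstay1 : has_density n (waiting n j m `&` ~` joins n 0 m)
    (fun x => wait_prob j r x * (1 - x 0%N))%R.
  apply: (has_density_sub hPi (IH j) dret mJ).
  - move=> E _; split=> [WE|]; last by case=> -[].
    by have [J|J] := pselect (joins n 0 m E); [left|right].
  - by move=> E _ [[_ J] [_ nJ]].
  - by apply: measurable_funM => //; exact: measurable_funB.
  - by move=> x sx; rewrite mulr_ge0 ?wait_prob_ge0 ?le1.
  - by move=> x sx; ring.
have mstay : measurable (waiting n j m `&` ~` joins n 0 m `&`
    ~` [set E : rel_space | L E n m]).
  by apply: measurableI => //; exact: measurableC.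
(* m joins neither the first cluster nor a new one *)
have dstay : has_density n (waiting n j m `&` ~` joins n 0 m `&`
    ~` [set E : rel_space | L E n m]) (fun x => wait_prob j r x * others x j)%R.
  apply: (has_density_sub hPi dstay1 (dnew j) mstay).
  - move=> E _; split=> [WE|].
      by have [J|J] := pselect (L E n m); [left; split=> //; case: WE|right].
    by case=> -[]//= WE Lm; split=> //; exact: Lnot.
  - by move=> E _ [[_ Lm] [_ nL]].
  - by apply: measurable_funM => //; exact: measurable_others.
  - by move=> x sx; rewrite mulr_ge0 ?wait_prob_ge0 ?others_ge0.
  - by move=> x sx; rewrite othersS; ring.
have mWS : measurable (waiting n j m.+1).
  by apply: local_upto_measurable; apply: local_upto_waiting; exact: ltnW.
have stayE E : (waiting n j m `&` ~` joins n 0 m `&`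
    ~` [set E : rel_space | L E n m]) E <-> waiting n j m.+1 E /\ ~~ L E n m.
  split=> [[[[h1 h2] /joins0/negP nE] /negP nL]|[[h1 h2] nL]].
    split=> //; split; first by rewrite cntS h1 (negPf nL) addn0.
    move=> k /andP[nk]; rewrite ltnS leq_eqVlt => /predU1P[->//|km].
    by apply: h2; rewrite nk.
  move: h1; rewrite cntS (negPf nL) addn0 => h1.
  split; last exact/negP; split.
    by split=> // k /andP[nk km]; apply: h2; rewrite nk ltnW.
  by move=> /joins0 Em; have := h2 m; rewrite nm ltnSn Em => /(_ isT).
have newE i E : (waiting n i m `&` [set E : rel_space | L E n m]) E <->
    waiting n i.+1 m.+1 E /\ L E n m.
  split=> [[[h1 h2] /= Lm]|[[h1 h2] Lm]].
    split=> //; split; first by rewrite cntS h1 Lm addn1.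
    move=> k /andP[nk]; rewrite ltnS leq_eqVlt => /predU1P[->|km].
      by apply/negP => Em; apply: (Lnot _ Lm); exact/joins0.
    by apply: h2; rewrite nk.
  move: h1; rewrite cntS Lm addn1 => -[h1]; split=> //; split=> // k /andP[nk km].
  by apply: h2; rewrite nk ltnW.
have -> : (n.+1 + r.+1 = m.+1)%N by rewrite addnS.
case: j => [|j] in dstay mWS stayE {dret mJ dstay1 mstay} *.
  apply: (has_density_eq hPi dstay) => //.
  - move=> E _; rewrite stayE; split=> [[]//|WE]; split=> //.
    apply/negP => Lm; case: WE => + _; rewrite cntS Lm addn1 => /eqP; rewrite eqSS => /eqP.
    by move=> c0; move: (cnt_homo (L E n) nm); rewrite c0 cntS least_self addn1.
  - exact: measurable_wait_prob.
  - by move=> x _ /=; rewrite addr0.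
apply: (has_density_add hPi dstay (dnew j)) => //.
- move=> E _; rewrite stayE newE; split=> [WE|]; last by case=> -[].
  by case: (boolP (L E n m)) => Lm; [right|left].
- by move=> E _; rewrite stayE newE => -[[_ /negP nL] [_ Lm]].
Qed.

(** One sums over the time at which the j-th other cluster is discovered. *)
Lemma prob_late n j S : measurable S -> tail_inv n S ->
  (forall E, S E -> (0 < freqs R E n 0%N)%R) ->
  P (Pi @^-1` (S `&` late n j)) =
  \int[P]_(w in Pi @^-1` S) (top_gt_prob (F n w) j)%:E.
Proof.
move=> mS iS S0; have mF : measurable_fun [set: T] (fun w => F n w) by exact: measurable_freqs_Pi.
case: j => [|j].
  transitivity (P (Pi @^-1` S)).
    congr (P _); apply/seteqP; split=> w /=; first by case.
    move=> Sw; split=> //; exists n; split; first exact: nth_least0.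
    by move=> k; lia.
  under eq_integral do rewrite top_gt_prob0.
  by rewrite integral_cst ?mul1e//; exact: mPi.
pose A r := waiting n j (n.+1 + r) `&` [set E : rel_space | L E n (n.+1 + r)].
have nm r : (n < n.+1 + r)%N by rewrite addSn ltnS leq_addr.
have dA r : has_density n (A r)
    (fun x => wait_prob j r x * (1 - \sum_(0 <= i < j.+1) x i))%R.
  apply: (has_density_new hPi hpe (ltnW (nm r))).
  - exact: local_upto_waiting.
  - exact: has_density_waiting.
  - by move=> E _ [].
have mA r : measurable (Pi @^-1` (S `&` A r)).
  by apply: mPi; apply: measurableI => //; case: (dA r).
transitivity (P (\bigcup_r Pi @^-1` (S `&` A r))).
  congr (P _); apply/seteqP; split=> w /=.
    move=> [Sw [m [Hm h]]]; have nm' : (n < m)%N.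
      rewrite ltnNge; apply/negP => /(cnt_least_n (Pi w)).
      by case/andP: Hm => _ /eqP ->.
    exists (m - n.+1)%N => //; split=> //; rewrite /A subnKC//.
    by case/andP: Hm => Lm /eqP cm; split.
  move=> [r _ [Sw [[h1 h2] Lm]]]; split=> //; exists (n.+1 + r)%N; split=> //.
  by rewrite /is_nth_least Lm h1 /=.
rewrite measure_semi_bigcup//; last 2 first.
- move=> r r' _ _ [w [[_ [[h1 _] h2]] [_ [[h1' _] h2']]]].
  have := @nth_least_uniq (Pi w) n j.+1 (n.+1 + r) (n.+1 + r').
  by rewrite /is_nth_least h1 h1' h2 h2' eqxx => /(_ isT isT) /addnI.
- exact: bigcupT_measurable.
transitivity (\sum_(0 <= r <oo) \int[P]_(w in Pi @^-1` S)
   (wait_prob j r (to_subprob (F n w)) *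
     (1 - \sum_(0 <= i < j.+1) to_subprob (F n w) i))%:E).
  by apply: eq_eseriesr => r _; have [_ _ _ h] := dA r; exact: h.
have mphi r : measurable_fun [set: T] (fun w => (wait_prob j r (to_subprob (F n w)) *
     (1 - \sum_(0 <= i < j.+1) to_subprob (F n w) i))%R).
  by have [_ mp _ _] := dA r; exact: (measurable_comp_freqs_Pi hPi n mp).
rewrite -integral_nneseries//; last 3 first.
- exact: mPi.
- by move=> r; apply/measurable_EFinP/measurable_funTS.
- by move=> r w _; exact: has_density_ge0 (dA r).
apply: ae_eq_integral.
- exact: mPi.
- apply: ge0_emeasurable_sum => [r w _ _|r _].
    exact: has_density_ge0 (dA r).
  exact/measurable_EFinP/measurable_funTS.
- apply/measurable_EFinP/measurable_funTS.
  exact: (measurableT_comp (@measurable_top_gt_prob R j.+1) mF).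
have := subprob_freqs_ae hPi hpe n; apply: filterS => w sw Sw.
by rewrite to_subprob_id// wait_prob_exit//; exact: S0.
Qed.

(** A cluster of positive frequency comes back, so its position exceeds j iff
    it is late. *)
Lemma prob_top_position n j S : measurable S -> tail_inv n S ->
  (forall E, S E -> (0 < freqs R E n 0%N)%R) ->
  P (Pi @^-1` (S `&` [set E | (j < top_position n E)%N])) =
  \int[P]_(w in Pi @^-1` S) (top_gt_prob (F n w) j)%:E.
Proof.
move=> mS iS S0; rewrite -prob_late//; congr (P _).
have ret w : S (Pi w) -> exists k, returns (Pi w) n k.
  move=> Sw; apply: contrapT => nr; have := S0 _ Sw.
  rewrite freqs_head no_return_freq ?ltxx// => k.
  by apply/negP => rk; apply: nr; exists k.
apply/seteqP; split=> w /= [Sw h]; split=> //.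
  exact/(top_position_late j (ret w Sw)).
exact/(top_position_late j (ret w Sw)).
Qed.

(** By [mate_freq_pos], a cluster of frequency 0 almost surely has no later
    element. *)
Lemma freqs_drop_ae n : {ae P, forall w, (F n w 0%N = 0)%R ->
  F n.+1 w = drop_top (F n w)}.
Proof.
have : {ae P, forall w k, cluster_freq R (Pi w) n = 0%R -> (n < k)%N -> ~~ Pi w n k}.
  by apply: ae_foralln => k; exact: mate_freq_pos.
apply: filterS => w h; rewrite freqs_head => c0.
apply: freqs_noret => k.
by rewrite /returns; case: ltnP => //= nk; exact: h.
Qed.

Lemma freqs_move_top n w : (0 < F n w 0%N)%R ->
  F n.+1 w = move_top (top_position n (Pi w)) (F n w).
Proof.
move=> F0; rewrite /top_position; case: pselect => [ex|nr].
  case: ex_minnP => rho ret rmin; apply: freqs_ret => //; first exact: hPi.1.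
  move=> k /andP[nk kr]; apply/negP => Ek.
  by have := rmin k; rewrite /returns nk Ek => /(_ isT); rewrite leqNgt kr.
move: F0; rewrite freqs_head no_return_freq ?ltxx// => k.
by apply/negP => rk; apply: nr; exists k.
Qed.

End position_law.

(** * The top to random kernel *)

Section mixture_kernel.
Context d d' (X : measurableType d) (Y : measurableType d') (R : realType).
Variables (c : nat -> X -> R) (g : nat -> X -> Y).
Hypotheses (mc : forall r, measurable_fun [set: X] (c r))
  (mg : forall r, measurable_fun [set: X] (g r))
  (c0 : forall r x, 0 <= c r x)
  (c1 : forall x, (\sum_(0 <= r <oo) (c r x)%:E = 1)%E).
Local Open Scope ereal_scope.

Let mixture (x : X) : {measure set Y -> \bar R} :=
  mseries (fun r => mscale (NngNum (c0 r x)) \d_(g r x)) 0.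

Let mixtureE x B : mixture x B = \sum_(0 <= r <oo) (c r x)%:E * \d_(g r x) B.
Proof. by []. Qed.

Let measurable_mixture B : measurable B -> measurable_fun [set: X] (mixture ^~ B).
Proof.
move=> mB; apply: ge0_emeasurable_sum => [r x _ _|r _].
  by rewrite mule_ge0// lee_fin.
apply: emeasurable_funM; first by apply/measurable_EFinP; exact: mc.
by apply/measurable_EFinP; apply: (measurableT_comp (measurable_indic mB)); exact: mg.
Qed.

Let mixtureT x : mixture x setT = 1.
Proof.
rewrite mixtureE -[RHS](c1 x); apply: eq_eseriesr => r _.
by rewrite diracT mule1.
Qed.

HB.instance Definition _ := isKernel.Build _ _ X Y R mixture measurable_mixture.
HB.instance Definition _ := Kernel_isProbability.Build _ _ X Y R mixture mixtureT.

(** Both mechanisms of the corollary choose among countably many deterministic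
    moves, with probabilities that depend on the current sequence. *)
Lemma mixture_kernel : exists K : R.-pker X ~> Y, forall x B,
  K x B = \sum_(0 <= r <oo) (c r x)%:E * \d_(g r x) B.
Proof. by exists mixture. Qed.

End mixture_kernel.

Lemma measure_ae_eq d (T : measurableType d) (R : realType)
    (P : probability T R) (A B : set T) : measurable A -> measurable B ->
  {ae P, forall w, A w <-> B w} -> P A = P B.
Proof.
move=> mA mB AB; rewrite -[A]setIT -[B]setIT -!integral_indic//.
apply: ae_eq_integral => //; try exact/measurable_EFinP/measurable_indic.
apply: filterS AB => w [AB BA] _; rewrite /= !indicE; congr (_%:R%:E).
by congr nat_of_bool; apply/idP/idP; rewrite !inE.
Qed.

Section top_to_random_kernel.
Variable R : realType.
Implicit Types x : seq_space R.

Lemma subprob_drop_top x : subprob x -> subprob (drop_top x : seq_space R).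
Proof.
move=> /subprobP[x0 x1]; apply/subprobP; split=> [j|N]; first exact: x0.
have := x1 N.+1; rewrite big_nat_recl//=; have := x0 0%N.
rewrite /drop_top; move: (\sum_(_ <= _ < _) _) (x 0%N) => a b; lra.
Qed.

Lemma sum_move_top r N x : (r < N)%N ->
  \sum_(0 <= k < N) move_top r.+1 x k = \sum_(0 <= k < N) x k.
Proof.
move=> rN; rewrite (@big_cat_nat _ _ _ r.+1)//= [RHS](@big_cat_nat _ _ _ r.+1)//=.
congr (_ + _); last first.
  apply: eq_big_nat => k /andP[rk _]; rewrite /move_top !ifF//; lia.
rewrite big_nat_recr//= [RHS]big_nat_recl//= addrC; congr (_ + _).
  by rewrite /move_top ltnn eqxx.
by apply: eq_big_nat => k /andP[_ kr]; rewrite /move_top ltnS kr.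
Qed.

Lemma subprob_move_top r x : subprob x -> subprob (move_top r.+1 x : seq_space R).
Proof.
move=> /subprobP[x0 x1]; apply/subprobP; split=> [j|N].
  by rewrite /move_top; case: ifP => // _; case: ifP.
have pos k : 0 <= move_top r.+1 x k.
  by rewrite /move_top; case: ifP => // _; case: ifP.
apply: (@le_trans _ _ (\sum_(0 <= k < maxn N r.+1) move_top r.+1 x k)).
  rewrite [leRHS](@big_cat_nat _ _ _ N)//= ?leq_maxl// lerDl.
  by apply: sumr_ge0 => k _; exact: pos.
by rewrite sum_move_top ?x1// leq_max ltnSn orbT.
Qed.

Lemma measurable_drop_top : measurable_fun [set: seq_space R]
  (fun x => drop_top x : seq_space R).
Proof. by apply: measurable_seq_fun => j; exact: measurable_coord. Qed.

Lemma measurable_move_top r : measurable_fun [set: seq_space R]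
  (fun x => move_top r x : seq_space R).
Proof.
apply: measurable_seq_fun => j; rewrite /move_top.
by case: (j.+1 < r)%N; [|case: (j.+1 == r)]; exact: measurable_coord.
Qed.

(** The sequences whose first entry is moved rather than dropped. *)
Definition top_pos : set (seq_space R) := @subprob R `&` [set x | 0 < x 0%N].

Lemma measurable_top_pos : measurable top_pos.
Proof.
apply: measurableI; first exact: measurable_subprob.
rewrite (_ : mkset _ = ~` [set x : seq_space R | x 0%N <= 0]).
  apply: measurableC; rewrite -[X in measurable X]setTI.
  by apply: measurable_fun_le => //; exact: measurable_coord.
by apply/seteqP; split=> x /=; rewrite ltNge => /negP.
Qed.

(** The index 0 stands for dropping the first entry, and r >= 1 for moving it
    to the place r. Outside [top_pos] it is always dropped, so that the
    weights have sum 1 at every sequence. *)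
Definition top_weight (r : nat) x : R :=
  if r is r'.+1 then \1_top_pos x * (top_gt_prob x r' - top_gt_prob x r'.+1)
  else 1 - \1_top_pos x.

Definition top_move (r : nat) x : seq_space R :=
  if r is r'.+1 then move_top r x else drop_top x.

Lemma measurable_top_weight r : measurable_fun [set: seq_space R] (top_weight r).
Proof.
have m1 : measurable_fun [set: seq_space R] (\1_top_pos : _ -> R).
  by apply: measurable_indic; exact: measurable_top_pos.
case: r => [|r]; first exact: measurable_funB.
apply: measurable_funM => //; apply: measurable_funB; exact: measurable_top_gt_prob.
Qed.

Lemma measurable_top_move r : measurable_fun [set: seq_space R] (top_move r).
Proof. by case: r => [|r]; [exact: measurable_drop_top|exact: measurable_move_top]. Qed.

Lemma top_weight_ge0 r x : 0 <= top_weight r x.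
Proof.
case: r => [|r]; rewrite /= indicE.
  by case: (_ \in _); rewrite ?subrr ?subr0.
case: (boolP (_ \in _)) => [|_]; last by rewrite mul0r.
by rewrite inE => -[sx x0]; rewrite mul1r subr_ge0 top_gt_prob_nonincr.
Qed.

(** The weights are the decrements of [top_gt_prob], which tends to 0. *)
Lemma top_weight_tail j x : top_pos x ->
  (\sum_(0 <= r <oo) (top_weight r x)%:E * (j < r)%N%:R%:E = (top_gt_prob x j)%:E)%E.
Proof.
move=> gx; have [sx x0] := gx; apply/cvg_lim => //.
rewrite -(cvg_shiftn j.+1) /=.
rewrite (_ : (fun n => _) = fun n => (top_gt_prob x j - top_gt_prob x (j + n))%:E).
  apply: cvg_EFin; first exact: nearW.
  rewrite -[X in _ --> X]subr0; apply: cvgB; first exact: cvg_cst.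
  have := top_gt_prob_cvg0 sx x0; rewrite -(cvg_shiftn j) /=.
  by under eq_fun do rewrite addnC.
apply/funext => n; elim: n => [|n IH].
  rewrite add0n addn0 subrr big_nat big1// => r /andP[_ rj].
  by rewrite ltnNge -ltnS rj mule0.
rewrite addSn big_nat_recr//= IH addnS ltnS leq_addl mule1 -EFinD.
by rewrite /= indicE mem_set// mul1r [(n + j)%N]addnC addrA subrK addnS.
Qed.

Lemma top_weight_sum1 x : (\sum_(0 <= r <oo) (top_weight r x)%:E = 1)%E.
Proof.
have [gx|ngx] := pselect (top_pos x).
  rewrite -[RHS](_ : (top_gt_prob x 0)%:E = _)%E; last by rewrite top_gt_prob0.
  rewrite -(top_weight_tail 0 gx); apply: eq_eseriesr => -[|r] _ /=.
    by rewrite indicE mem_set// subrr mule0.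
  by rewrite mule1.
apply/cvg_lim => //; rewrite -(cvg_shiftn 1) /=.
rewrite (_ : (fun n => _) = cst 1%E); first exact: cvg_cst.
apply/funext => n; rewrite addn1 big_nat_recl//= indicE memNset// subr0.
by rewrite big1 ?adde0// => r _; rewrite mul0r.
Qed.

End top_to_random_kernel.

(** * The Markov property *)

Section unit_mass.
Context d (Y : measurableType d) (R : realType).
Variable m : {measure set Y -> \bar R}.
Hypothesis m1 : m setT = 1%E.

Let unit_mass : set Y -> \bar R := m.
HB.instance Definition _ := Measure.copy unit_mass m.
HB.instance Definition _ := Measure_isProbability.Build _ Y R unit_mass m1.

Lemma probability_of_measure : exists q : probability Y R, forall B, q B = m B.
Proof. by exists unit_mass. Qed.

End unit_mass.

(** The law of the position is the mixture with the same weights of the point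
    masses at the indices. *)
Lemma top_to_random_kernel_ex (R : realType) :
  exists K : R.-pker (seq_space R) ~> (seq_space R),
    (forall x B, K x B = \sum_(0 <= r <oo) (top_weight r x)%:E * \d_(top_move r x) B)%E /\
    (forall x, subprob x -> top_to_random_law x (K x)).
Proof.
have [K hK] := mixture_kernel (@measurable_top_weight R) (@measurable_top_move R)
  (@top_weight_ge0 R) (@top_weight_sum1 R).
exists K; split=> // x sx; split=> [x0 B mB|x0].
  have nx : ~ top_pos x by move=> [_ /=]; rewrite x0 ltxx.
  rewrite hK; apply/cvg_lim => //; rewrite -(cvg_shiftn 1) /=.
  rewrite (_ : (fun n => _) = cst (\d_(drop_top x : seq_space R) B)).
    exact: cvg_cst.
  apply/funext => n; rewrite addn1 big_nat_recl//= indicE memNset// subr0 mul1e.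
  by rewrite big1 ?adde0// => r _; rewrite mul0r mul0e.
have gx : top_pos x by split.
have [Q hQ] := @mixture_kernel _ _ (seq_space R) nat R (@top_weight R)
  (fun r _ => r) (@measurable_top_weight R) (fun r => measurable_cst _)
  (@top_weight_ge0 R) (@top_weight_sum1 R).
have [q qQ] := probability_of_measure (prob_kernel (s := Q) x).
exists q; split=> [j|B mB].
  rewrite -(top_weight_tail j gx) [LHS]qQ [LHS]hQ; apply: eq_eseriesr => r _.
  rewrite diracE; congr (_ * _%:R%:E)%E; congr nat_of_bool.
  by apply/idP/idP; rewrite inE.
rewrite [RHS]qQ [RHS]hQ hK; apply: eq_eseriesr => -[|r] _ /=.
  by rewrite indicE mem_set// subrr !mul0e.
congr (_ * _)%E; rewrite !diracE; congr (_%:R%:E); congr nat_of_bool.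
Qed.

Section markov.
Context d (T : measurableType d) (R : realType) (P : probability T R).
Variable Pi : T -> rel_space.
Hypotheses (hPi : random_partition Pi) (hpe : partially_exchangeable P Pi).
Local Open Scope ereal_scope.
Local Notation mPi := (measurable_Pi_preimage hPi).
Local Notation F n w := (freqs R (Pi w) n : seq_space R).

Lemma prob_top_position_eq n r S : measurable S -> tail_inv n S ->
  (forall E, S E -> top_pos (freqs R E n)) ->
  P (Pi @^-1` (S `&` [set E | top_position n E = r.+1])) =
  \int[P]_(w in Pi @^-1` S) (top_weight r.+1 (F n w))%:E.
Proof.
move=> mS iS Sg; have S0 E : S E -> (0 < freqs R E n 0%N)%R by move=> /Sg[].
have hr j := prob_top_position hPi hpe j mS iS S0.
have mF : measurable_fun [set: T] (fun w => F n w) by exact: measurable_freqs_Pi.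
have mgt j : measurable (Pi @^-1` (S `&` [set E | (j < top_position n E)%N])).
  apply: mPi; apply: measurableI => //.
  rewrite -[X in measurable X]setTI.
  exact: (@measurable_top_position n measurableT [set k | (j < k)%N]).
have meq : measurable (Pi @^-1` (S `&` [set E | top_position n E = r.+1])).
  apply: mPi; apply: measurableI => //; rewrite -[X in measurable X]setTI.
  exact: (@measurable_top_position n measurableT [set r.+1]).
have fin : P (Pi @^-1` (S `&` [set E | (r.+1 < top_position n E)%N])) \is a fin_num.
  by rewrite fin_num_measure.
have mw k : measurable_fun (Pi @^-1` S) (fun w => (top_weight k (F n w))%:E).
  apply/measurable_EFinP; apply: measurable_funTS.
  exact: (measurableT_comp (@measurable_top_weight R k) mF).
have mt k : measurable_fun (Pi @^-1` S) (fun w => (top_gt_prob (F n w) k)%:E).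
  apply/measurable_EFinP; apply: measurable_funTS.
  exact: (measurableT_comp (@measurable_top_gt_prob R k) mF).
rewrite -[LHS](addeK _ fin) -[RHS](addeK _ fin); congr (_ - _).
transitivity (P (Pi @^-1` (S `&` [set E | (r < top_position n E)%N]))).
  rewrite -measureU//.
    congr (P _); apply/seteqP; split=> w /=.
      by case=> -[Sw]; [move=> ->|move=> /ltnW].
    move=> [Sw]; rewrite leq_eqVlt => /predU1P[e|]; first by left.
    by right.
  by apply/seteqP; split=> w //= [[_ e] [_]]; rewrite e ltnn.
rewrite hr [X in _ + X]hr -ge0_integralD//.
- apply: eq_integral => w; rewrite inE => /Sg gw; rewrite -EFinD /= indicE mem_set//.
  by rewrite mul1r subrK.
- exact: mPi.
- by move=> w _; rewrite lee_fin top_weight_ge0.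
- by move=> w /Sg[sw x0]; rewrite lee_fin top_gt_prob_ge0.
Qed.

(** Almost surely the next sequence is the result of the drop or of the move
    to the position of the first cluster, and [prob_top_position] gives the
    probabilities of the moves. *)
Lemma markov_step n S (B : set (seq_space R)) : measurable S -> tail_inv n S -> measurable B ->
  P (Pi @^-1` (S `&` [set E : rel_space | B (freqs R E n.+1)])) =
  \int[P]_(w in Pi @^-1` S)
    \sum_(0 <= r <oo) (top_weight r (F n w))%:E * \d_(top_move r (F n w)) B.
Proof.
move=> mS iS mB.
have mF : measurable_fun [set: T] (fun w => F n w) by exact: measurable_freqs_Pi.
pose G : set (seq_space R) := @top_pos R.
have mG : measurable G by exact: measurable_top_pos.
pose D r := [set x : seq_space R | B (top_move r x)].
have mD r : measurable (D r).
  by rewrite -[X in measurable X]setTI; exact: measurable_top_move.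
pose Fs (C : set (seq_space R)) : set rel_space := [set E : rel_space | C (freqs R E n)].
have mFs C : measurable C -> measurable (Fs C) by exact: measurable_freqs_preimage.
have iFs C : tail_inv n (Fs C) by exact: tail_inv_freqs.
pose V r : set rel_space := if r is r'.+1 then
   S `&` Fs (G `&` D r) `&` [set E | top_position n E = r] else S `&` Fs (~` G `&` D 0%N).
have mV r : measurable (V r).
  case: r => [|r] /=.
    by apply: measurableI => //; apply: mFs; apply: measurableI => //; exact: measurableC.
  apply: measurableI; first by apply: measurableI => //; apply: mFs; exact: measurableI.
  rewrite -[X in measurable X]setTI.
  exact: (@measurable_top_position n measurableT [set r.+1]).
have mPiV r : measurable (Pi @^-1` V r) by exact: mPi.
have tV : trivIset setT (fun r => Pi @^-1` V r).
  move=> [|r] [|r'] _ _ // [w []] /=.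
  - by move=> [_ [nG _]] [[_ [gG _]] _].
  - by move=> [[_ [gG _]] _] [_ [nG _]].
  - by move=> [_ ->] [_].
transitivity (P (\bigcup_r Pi @^-1` V r)).
  apply: measure_ae_eq.
  - by apply: mPi; apply: measurableI => //; exact: measurable_freqs_preimage.
  - exact: bigcupT_measurable.
  apply: filterS2 (subprob_freqs_ae hPi hpe n) (freqs_drop_ae (R := R) hPi hpe n).
  move=> w sw hw; have Fn0 : (0 <= F n w 0%N)%R by case/subprobP: sw.
  split.
    move=> [Sw Bw]; move: Fn0; rewrite le_eqVlt => /predU1P[/esym F0|F0].
      exists 0%N => //; split=> //; split; last by rewrite /D /= -hw.
      by move=> [_ /=]; rewrite F0 ltxx.
    exists (top_position n (Pi w)) => //; have := freqs_move_top hPi F0.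
    have := top_position_gt0 n (Pi w); case e : top_position => [//|r] _ Fw.
    by split=> //; split=> //; split; [split|rewrite /D /= -Fw].
  move=> [[|r] _ /=].
    move=> [Sw [nG Dw]]; split=> //; rewrite hw//.
    apply/eqP; move: Fn0; rewrite le_eqVlt => /predU1P[<-//|F0].
    by exfalso; apply: nG; split.
  move=> [[Sw [[_ F0] Dw]] e]; split=> //.
  by rewrite /= (freqs_move_top hPi F0) e.
rewrite measure_semi_bigcup//; last exact: bigcupT_measurable.
rewrite integral_nneseries//; last 3 first.
- exact: mPi.
- move=> r; apply: emeasurable_funM.
    apply/measurable_EFinP; apply: measurable_funTS.
    exact: (measurableT_comp (@measurable_top_weight R r) mF).
  apply/measurable_EFinP; apply: measurable_funTS.
  apply: (measurableT_comp (measurable_indic mB)).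
  exact: (measurableT_comp (@measurable_top_move R r) mF).
- by move=> r w _; rewrite mule_ge0// lee_fin top_weight_ge0.
apply: eq_eseriesr => r _.
have dE w : \d_(top_move r (F n w)) B = (\1_(Pi @^-1` Fs (D r)) w)%:E :> \bar R.
  rewrite diracE indicE; congr (_%:R%:E); congr nat_of_bool.
under eq_integral do rewrite dE.
transitivity (\int[P]_(w in Pi @^-1` (S `&` Fs (D r))) (top_weight r (F n w))%:E); last first.
  rewrite preimage_setI integral_mkcondr; apply: eq_integral => w _.
  by rewrite epatch_indic.
case: r {dE} => [|r].
  rewrite [RHS](_ : _ = \int[P]_(w in Pi @^-1` (S `&` Fs (D 0%N)))
     (\1_(Pi @^-1` Fs (~` G)) w)%:E).
    have m1 : measurable (Pi @^-1` Fs (~` G)).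
      by apply: mPi; apply: mFs; exact: measurableC.
    have m2 : measurable (Pi @^-1` (S `&` Fs (D 0%N))).
      by apply: mPi; apply: measurableI => //; exact: mFs.
    rewrite integral_indic//.
    by congr (P _); apply/seteqP; split=> w /=; [move=> [? [? ?]]|move=> [? [? ?]]].
  apply: eq_integral => w _; congr (_%:E); rewrite /= !indicE.
  have -> : (w \in Pi @^-1` Fs (~` G)) = (F n w \notin G).
    by apply/idP/idP; rewrite notin_setE inE.
  by case: (_ \in _); rewrite ?subrr ?subr0.
rewrite /V prob_top_position_eq//.
- rewrite [in LHS](_ : Fs (G `&` D r.+1) = Fs (D r.+1) `&` Fs G); last first.
    by apply/seteqP; split=> E [].
  rewrite setIA preimage_setI integral_mkcondr; apply: eq_integral => w _.
  rewrite epatch_indic /= -EFinM; congr (_%:E); rewrite mulrAC !indicE.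
  have -> : (w \in Pi @^-1` Fs G) = (F n w \in G) by apply/idP/idP; rewrite !inE.
  by case: (_ \in _); rewrite ?mul1r ?mul0r.
- by apply: measurableI => //; apply: mFs; exact: measurableI.
- by apply: tail_invI.
- by move=> E [_ []].
Qed.

(** An event on the sequences up to time n is tail invariant for n, so
    [markov_step] applies to the whole past. *)
Lemma freqs_markov_chain (K : R.-pker (seq_space R) ~> (seq_space R)) :
  (forall x B, K x B = \sum_(0 <= r <oo) (top_weight r x)%:E * \d_(top_move r x) B) ->
  markov_chain P (@subprob R) K (fun n w => F n w).
Proof.
move=> hK; split.
- exact: measurable_subprob.
- move=> x sx; rewrite hK -[RHS](top_weight_sum1 x); apply: eq_eseriesr => r _.
  rewrite diracE mem_set ?mule1//; case: r => [|r].
    exact: subprob_drop_top.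
  exact: subprob_move_top.
- by move=> n; exact: measurable_freqs_Pi.
- by move=> n; exact: subprob_freqs_ae.
move=> n A B mA mB; pose S : set rel_space :=
  \bigcap_(i in [set i | (i <= n)%N]) [set E : rel_space | A i (freqs R E i)].
have mS : measurable S.
  by apply: bigcap_measurableType => i _; exact: measurable_freqs_preimage.
have iS : tail_inv n S.
  move=> E i0 a eqE na Ea; split=> h i ni.
    by apply/(tail_inv_freqs _ ni eqE na Ea); exact: h.
  by apply/(tail_inv_freqs _ ni eqE na Ea); exact: h.
have SE : [set w | forall i, (i <= n)%N -> A i (F i w)] = Pi @^-1` S.
  by apply/seteqP; split=> w.
rewrite SE; under eq_integral do rewrite hK.
by rewrite -markov_step.
Qed.

End markov.

(** * The law of the partition given the frequencies *)

Section pattern_steps.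
Variables (e F : rel_space) (m : nat).
Hypotheses (eqe : equivalence_rel e) (eqF : equivalence_rel F).

Lemma agree_step : agree m.+1 e F <->
  agree m e F /\ (forall k, (k < m)%N -> F k m = e k m).
Proof.
split=> [h|[h h'] i j].
  by split=> [|k km]; [exact: agree_le h|apply: h => //; exact: ltnW].
rewrite !ltnS leq_eqVlt => /predU1P[->|im]; rewrite leq_eqVlt => /predU1P[->|jm].
- by rewrite (eqe m m m).1 (eqF m m m).1.
- by rewrite (equiv_sym _ _ eqe) (equiv_sym _ _ eqF) h'.
- exact: h'.
- exact: h.
Qed.

Lemma agree_step_new : L e 0 m ->
  agree m.+1 e F <-> agree m e F /\ L F 0 m.
Proof.
move=> Lm; split=> [h|[h LF]].
  split; first exact: agree_le h.
  by rewrite -(least_local _ h).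
apply/agree_step; split=> // k km.
move: Lm LF => /is_least_fromP[_ /(_ k)] + /is_least_fromP[_ /(_ k)].
by rewrite km => /(_ isT)/negbTE -> /(_ isT)/negbTE ->.
Qed.

Lemma agree_step_join i i0 : is_nth_least e 0 i i0 -> (i0 < m)%N -> e i0 m ->
  agree m.+1 e F <-> agree m e F /\ joins 0 i m F.
Proof.
move=> Hi im eim; split=> [h|[h [i1 [Hi1 Fim]]]].
  split; first exact: agree_le h.
  exists i0; split; last by rewrite h// ltnW.
  by rewrite -(nth_least_local _ _ h)// ltnW.
have e01 : i0 = i1.
  by apply: nth_least_uniq Hi1; rewrite -(nth_least_local _ _ h).
rewrite -{i1}e01 in Hi1 Fim; apply/agree_step; split=> // k km.
rewrite (equiv_sym _ _ eqe) (equiv_sym _ _ eqF).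
by rewrite -(eqe i0 m k).2// -(eqF i0 m k).2// h.
Qed.

End pattern_steps.

Lemma joins_shift n i m E : joins 0 i m (relabel (addn n) E) <-> joins n i (n + m) E.
Proof.
split=> -[i0 [Hi Ei]].
  by exists (n + i0)%N; move: Hi; rewrite nth_least_shift addn0.
have ni := nth_least_nat_ge Hi.
by exists (i0 - n)%N; rewrite nth_least_shift addn0 /relabel !subnKC.
Qed.

Section laws.
Context d (T : measurableType d) (R : realType) (P : probability T R).
Variable Pi : T -> rel_space.
Hypotheses (hPi : random_partition Pi) (hpe : partially_exchangeable P Pi).
Local Open Scope ereal_scope.
Local Notation mPi := (measurable_Pi_preimage hPi).
Local Notation F n w := (freqs R (Pi w) n : seq_space R).

Definition shifted_pattern (n m : nat) (e : rel_space) : set rel_space :=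
  [set E : rel_space | agree m e (relabel (addn n) E)].

Lemma local_upto_shifted_pattern n m e : local_upto (n + m) (shifted_pattern n m e).
Proof.
move=> E E' EE h; apply: (agree_trans h) => i j im jm.
by rewrite /relabel EE// ltn_add2l.
Qed.

Lemma cnt_shifted_pattern n m e E : shifted_pattern n m e E ->
  cnt (L E n) (n + m) = cnt (L e 0) m.
Proof.
move=> h; rewrite cnt_addn cnt_least_n// add0n; apply: eq_cnt => k km.
by rewrite (least_local _ h)// least_shift addn0.
Qed.

(** When the pattern is read one element after the other, each prediction rule
    contributes a factor that does not mention n. *)
Lemma pattern_density m e : equivalence_rel e -> exists phi : seq_space R -> R,
  forall n, has_density P Pi n (shifted_pattern n m e) phi.
Proof.
move=> eqe; elim: m => [|m [phi hphi]].
  exists (fun=> 1%R) => n; apply: (has_density_eq hPi (has_densityT P hPi n)) => //.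
  by apply: local_upto_measurable; exact: local_upto_shifted_pattern.
have mS n : measurable (shifted_pattern n m.+1 e).
  by apply: local_upto_measurable; exact: local_upto_shifted_pattern.
have [Lm|nL] := boolP (L e 0 m).
  exists (fun x => phi x * (1 - \sum_(0 <= i < cnt (L e 0) m) x i))%R => n.
  have dn := has_density_new hPi hpe (leq_addr m n)
    (@local_upto_shifted_pattern n m e) (hphi n)
    (fun E _ => @cnt_shifted_pattern n m e E).
  apply: (has_density_eq hPi dn) => //; last by case: dn.
  move=> E eqE; rewrite /shifted_pattern /=.
  have := agree_step_new eqe (relabel_equiv (addn n) eqE) Lm.
  by rewrite least_shift addn0 => ->.
have [i0 Li0 /andP[/andP[_ i0m] ei0]] := least_rep eqe (leq0n m).
have {}i0m : (i0 < m)%N.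
  by rewrite ltn_neqAle i0m andbT; apply/eqP => i0m'; rewrite -i0m' Li0 in nL.
pose i := cnt (L e 0) i0; have Hi : is_nth_least e 0 i i0.
  by rewrite /is_nth_least Li0 eqxx.
exists (fun x => phi x * x i)%R => n.
have dj : has_density P Pi n (shifted_pattern n m e `&` joins n i (n + m))
    (fun x => phi x * x i)%R.
  apply: (has_density_joins hPi hpe (leq_addr m n) _ (hphi n)).
    exact: local_upto_shifted_pattern.
  by move=> E _ /cnt_shifted_pattern ->; exact: nth_least_lt Hi i0m.
apply: (has_density_eq hPi dj) => //; last by case: dj.
move=> E eqE; rewrite /shifted_pattern /=.
have := agree_step_join eqe (relabel_equiv (addn n) eqE) Hi i0m ei0.
by rewrite joins_shift => ->.
Qed.

Lemma same_law_integral (Y Z : T -> seq_space R) (A : set (seq_space R))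
    (g : seq_space R -> \bar R) :
  measurable_fun [set: T] Y -> measurable_fun [set: T] Z -> same_law P Y Z ->
  measurable A -> measurable_fun [set: seq_space R] g -> (forall x, 0 <= g x) ->
  \int[P]_(w in Y @^-1` A) g (Y w) = \int[P]_(w in Z @^-1` A) g (Z w).
Proof.
move=> mY mZ YZ mA mg g0.
have mgA : measurable_fun A g by exact: measurable_funTS.
have gg (x : seq_space R) : x \in A -> 0 <= g x by [].
rewrite -(@ge0_integral_pushforward _ _ _ _ _ _ mY P A g mA mgA gg).
rewrite -(@ge0_integral_pushforward _ _ _ _ _ _ mZ P A g mA mgA gg).
by apply: eq_measure_integral => B mB _; exact: YZ.
Qed.

(** The partition and its shift realize a pattern with probabilities that are
    the means of the same function of their frequencies. *)
Lemma shift_law : same_law P (fun w => F 1%N w) (fun w => F 0%N w) ->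
  forall S : set rel_space, measurable S ->
  P [set w | S (relabel (addn 1) (Pi w))] = P (Pi @^-1` S).
Proof.
move=> F10 S mS; rewrite -[X in P X]setTI -[in RHS](setTI (Pi @^-1` S)).
apply: (@law_ext _ _ _ P setT (fun w => relabel (addn 1) (Pi w)) Pi 0) => //.
- apply: (measurableT_comp (measurable_relabel (addn 1))); exact: measurable_Pi.
- exact: measurable_Pi.
- by move=> w; apply: relabel_equiv; exact: hPi.1.
- exact: hPi.1.
move=> m e _ eqe; rewrite !setTI; have [phi hphi] := pattern_density m eqe.
have h n : P (Pi @^-1` shifted_pattern n m e) =
    \int[P]_w (phi (to_subprob (F n w)))%:E.
  have [_ _ _ /(_ setT)] := hphi n; rewrite setTI preimage_setT; apply => //.
have -> : P ((fun w => relabel (addn 1) (Pi w)) @^-1` agree m e) =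
  P (Pi @^-1` shifted_pattern 1 m e) by [].
have -> : Pi @^-1` agree m e = Pi @^-1` shifted_pattern 0 m e.
  by apply/seteqP; split=> w.
rewrite !h; have [_ mphi phi0 _] := hphi 0%N.
have := @same_law_integral (fun w => F 1%N w) (fun w => F 0%N w) setT
  (EFin \o phi \o @to_subprob R).
rewrite !preimage_setT; apply => //.
- exact: measurable_freqs_Pi.
- exact: measurable_freqs_Pi.
- apply/measurable_EFinP; apply: measurableT_comp => //.
  exact: measurable_to_subprob.
- by move=> x; rewrite lee_fin; apply: phi0; exact: subprob_to_subprob.
Qed.

End laws.

Section invariance.
Context d (T : measurableType d) (R : realType) (P : probability T R).
Variable Pi : T -> rel_space.
Hypothesis hPi : random_partition Pi.
Local Open Scope ereal_scope.
Local Notation mPi := (measurable_Pi_preimage hPi).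

Definition relabel_inv (s : nat -> nat) : Prop := forall S : set rel_space,
  measurable S -> P [set w | S (relabel s (Pi w))] = P (Pi @^-1` S).

Lemma relabel_inv_comp s t : relabel_inv s -> relabel_inv t -> relabel_inv (s \o t).
Proof.
move=> hs ht S mS; rewrite -(ht _ mS).
exact: hs (measurable_preimage_relabel t mS).
Qed.

Lemma relabel_inv_id s : s =1 id -> relabel_inv s.
Proof.
move=> hs S mS; congr (P _); apply/seteqP; split=> w /=;
by have -> : relabel s (Pi w) = Pi w
  by apply/funext => i; apply/funext => j; rewrite /relabel !hs.
Qed.

Lemma relabel_inv_eq s t : s =1 t -> relabel_inv s -> relabel_inv t.
Proof. by move=> /funext ->. Qed.

Lemma relabel_inv_shift : relabel_inv (addn 1) -> forall n, relabel_inv (addn n).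
Proof.
move=> h1; elim=> [|n IH]; first exact: relabel_inv_id.
apply: (@relabel_inv_eq (addn 1 \o addn n)); last exact: relabel_inv_comp.
by move=> i /=; rewrite addnA add1n.
Qed.

Lemma relabel_inv_ext s : (exists N, forall m e, (N <= m)%N -> equivalence_rel e ->
     P [set w | agree m e (relabel s (Pi w))] = P (Pi @^-1` agree m e)) ->
  relabel_inv s.
Proof.
move=> [N h] S mS; rewrite -[X in P X]setTI -[in RHS](setTI (Pi @^-1` S)).
apply: (@law_ext _ _ _ P setT (fun w => relabel s (Pi w)) Pi N) => //.
- apply: (measurableT_comp (measurable_relabel s)); exact: measurable_Pi.
- exact: measurable_Pi.
- by move=> w; apply: relabel_equiv; exact: hPi.1.
- exact: hPi.1.
by move=> m e Nm eqe; rewrite !setTI; exact: h.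
Qed.

End invariance.

(** * Stationary chains and swaps far away *)

Section stationary.
Context d (T : measurableType d) (R : realType) (P : probability T R).
Variable Pi : T -> rel_space.
Hypotheses (hPi : random_partition Pi) (hpe : partially_exchangeable P Pi).
Local Open Scope ereal_scope.
Local Notation mPi := (measurable_Pi_preimage hPi).

Definition new_with_mate (b k : nat) : set rel_space :=
  [set E : rel_space | L E 0 b && E b k].

Lemma measurable_new_with_mate b k : measurable (new_with_mate b k).
Proof.
apply: (@local_upto_measurable (maxn b k).+1) => E F EF; rewrite /new_with_mate /=.
rewrite (least_local _ EF) ?EF//; rewrite ltnS ?leq_maxl ?leq_maxr//.
Qed.

Lemma prob_new_with_mate b k : (b < k)%N ->
  P (Pi @^-1` new_with_mate b k) = P (Pi @^-1` new_with_mate b b.+1).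
Proof.
move=> bk; pose A : set rel_space := [set E : rel_space | L E 0 b].
have lA : local_upto b.+1 A by move=> E F EF; rewrite /A /= (least_local _ EF).
have := @join_const _ _ _ P Pi hPi hpe 0 b.+1 b (k - b.+1) setT A.
rewrite !setTI subnKC// => h.
have e l : Pi @^-1` new_with_mate b l =
    Pi @^-1` (A `&` [set E : rel_space | E b l]).
  by apply/seteqP; split=> w /=; rewrite /new_with_mate /= => /andP.
by rewrite !e; apply: h => //=; rewrite ltnSn.
Qed.

(** The element N has only one least element in its cluster, so the events
    [new_with_mate b N] with b < N are disjoint, and their probabilities do
    not change when N is replaced by b + 1. *)
Lemma sum_new_with_mate N :
  \sum_(0 <= b < N) P (Pi @^-1` new_with_mate b b.+1) <= 1.
Proof.
pose C b := Pi @^-1` (new_with_mate b N `&` [set E : rel_space | (b < N)%N]).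
have mC b : measurable (C b).
  apply: mPi; apply: measurableI; first exact: measurable_new_with_mate.
  by case: ltnP => _; [rewrite (_ : mkset _ = setT)|rewrite (_ : mkset _ = set0)] => //;
    apply/seteqP; split.
apply: (@le_trans _ _ (P (\bigcup_b C b))); last first.
  by apply: probability_le1; exact: bigcupT_measurable.
rewrite measure_semi_bigcup//; last 2 first.
- move=> b b' _ _ [w [[/andP[Lb Eb] bN] [/andP[Lb' Eb'] bN']]].
  have eqE := hPi.1 w.
  have Ebb : Pi w b b'.
    by rewrite (equiv_sym _ _ eqE) (eqE b' N b).2// (equiv_sym _ _ eqE).
  case: (ltngtP b b') => // bb.
    by move: Lb' => /is_least_fromP[_ /(_ b)]; rewrite bb Ebb => /(_ isT).
  by move: Lb => /is_least_fromP[_ /(_ b')]; rewrite bb (equiv_sym _ _ eqE) Ebb => /(_ isT).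
- exact: bigcupT_measurable.
apply: le_trans (nneseries_lim_ge (m := 0) N _) => //.
rewrite !big_nat; apply: lee_sum => b /andP[_ bN].
rewrite -(prob_new_with_mate bN) le_eqVlt; apply/orP; left; apply/eqP.
by congr (P _); apply/seteqP; split=> w //= [].
Qed.

Lemma new_with_mate_cvg0 :
  (fun b => fine (P (Pi @^-1` new_with_mate b b.+1))) @ \oo --> (0%R : R).
Proof.
apply: cvg_series_cvg_0; apply: nneseries_fin_cvg => [b|].
  exact: fine_ge0.
apply: (@le_lt_trans _ _ 1); last exact: ltry.
apply: nneseries_le_bound => [b|N]; first by rewrite lee_fin fine_ge0.
apply: le_trans (sum_new_with_mate N); apply: lee_sum => b _.
by rewrite fineK// fin_num_measure//; apply: mPi; exact: measurable_new_with_mate.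
Qed.

Lemma measure_exists_lt (C : nat -> set T) (c : \bar R) n :
  (forall k, measurable (C k)) -> (forall k, P (C k) <= c) ->
  P [set w | exists2 k, (k < n)%N & C k w] <= n%:R%:E * c.
Proof.
move=> mC Cc.
have mU j : measurable [set w | exists2 k, (k < j)%N & C k w].
  by apply: bigcup_measurable => k _.
elim: n => [|n IH].
  rewrite (_ : mkset _ = set0) ?measure0 ?mul0e//.
  by apply/seteqP; split=> w // -[].
rewrite (_ : mkset _ = [set w | exists2 k, (k < n)%N & C k w] `|` C n).
  apply: le_trans (measureU2 _ _ _) _ => //.
  have c0 : 0 <= c by apply: le_trans (Cc 0%N).
  by rewrite -natr1 EFinD ge0_muleDl ?lee_fin// mul1e; exact: leeD IH (Cc n).
apply/seteqP; split=> w /=.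
  move=> [k]; rewrite ltnS leq_eqVlt => /predU1P[->|kn] Ck; first by right.
  by left; exists k.
by case=> [[k kn Ck]|Cn]; [exists k => //; exact: ltnW|exists n].
Qed.

(** By invariance under the shift by M, the swap of a and a + 1 can be
    replaced by the swap at b = M + a in the window {M, ..., M + n - 1}. It
    changes probabilities only where b and b + 1 are both least in their
    clusters, and there it changes what is seen in the window only if one of
    them has a mate in it. *)
Lemma stationary_swap_bound a n e M : (forall k, relabel_inv P Pi (addn k)) ->
  (a.+2 <= n)%N -> equivalence_rel e ->
  let b := (M + a)%N in
  let m k := P (Pi @^-1` new_with_mate k k.+1) in
  P [set w | agree n e (relabel (swapn a) (Pi w))] <=
    P (Pi @^-1` agree n e) + (n%:R%:E * m b + n%:R%:E * m b.+1) /\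
  P (Pi @^-1` agree n e) <=
    P [set w | agree n e (relabel (swapn a) (Pi w))] + (n%:R%:E * m b + n%:R%:E * m b.+1).
Proof.
move=> inv an eqe b m.
pose Y : set rel_space := shifted_pattern M n e.
have mY : measurable Y.
  by apply: local_upto_measurable; exact: local_upto_shifted_pattern.
pose X : set rel_space := [set E | Y (relabel (swapn b) E)].
have mX : measurable X by exact: measurable_preimage_relabel.
have -> : P (Pi @^-1` agree n e) = P (Pi @^-1` Y).
  by rewrite -(inv M)//; exact: measurable_agree.
have -> : P [set w | agree n e (relabel (swapn a) (Pi w))] = P (Pi @^-1` X).
  have := inv M [set E : rel_space | agree n e (relabel (swapn a) E)].
  move=> <-; last by apply: measurable_preimage_relabel; exact: measurable_agree.
  have sw k : (M + swapn a k)%N = swapn b (M + k)%N.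
    rewrite /swapn /b eqn_add2l -addnS eqn_add2l.
    by case: eqP => // _; case: eqP.
  have e2 w : relabel (swapn a) (relabel (addn M) (Pi w)) =
      relabel (addn M) (relabel (swapn b) (Pi w)).
    by apply/funext => i; apply/funext => j; rewrite /relabel !sw.
  by congr (P _); apply/seteqP; split=> w /=; rewrite /X /Y /shifted_pattern /= e2.
pose NB := not_both_least b.
have mNB : measurable NB by exact: measurable_not_both_least.
(* the n elements after c cover the part of the window that follows c *)
pose mates c : set T := [set w | exists2 k, (k < n)%N & (Pi @^-1` new_with_mate c (c + k).+1) w].
have mmates c : measurable (mates c).
  by apply: bigcup_measurable => k _; apply: mPi; exact: measurable_new_with_mate.
have Pmates c : P (mates c) <= n%:R%:E * m c.
  apply: measure_exists_lt => [k|k].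
    by apply: mPi; exact: measurable_new_with_mate.
  by rewrite prob_new_with_mate// ltnS leq_addr.
have PB : P (mates b `|` mates b.+1) <= n%:R%:E * m b + n%:R%:E * m b.+1.
  by apply: le_trans (measureU2 _ _ _) _ => //; exact: leeD (Pmates b) (Pmates b.+1).
have XY w : ~ NB (Pi w) -> ~ (mates b `|` mates b.+1) w -> X (Pi w) <-> Y (Pi w).
  move=> /negP; rewrite negbK => /andP[Lb Lb1] nmates.
  have eqE := hPi.1 w.
  have nb1 : Pi w b b.+1 = false.
    by move: Lb1 => /is_least_fromP[_ /(_ b)]; rewrite ltnSn => /(_ isT)/negbTE.
  have before c j : L (Pi w) 0 c -> (j < c)%N -> Pi w c j = false.
    move=> /is_least_fromP[_ /(_ j)] + jc; rewrite jc => /(_ isT)/negbTE.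
    by rewrite (equiv_sym _ _ eqE).
  have after c j : (c = b \/ c = b.+1) -> L (Pi w) 0 c -> (c < j)%N ->
      (j < M + n)%N -> Pi w c j = false.
    move=> cb Lc cj jn; apply/negP => Ecj; apply: nmates.
    have mc : mates c w.
      exists (j - c.+1)%N; first by case: cb => ->; rewrite /b; lia.
      have -> : (c + (j - c.+1)).+1 = j by lia.
      by rewrite /new_with_mate /= Lc Ecj.
    by case: cb mc => ->; [left|right].
  have fixed i j : (i < M + n)%N -> (j < M + n)%N ->
      Pi w (swapn b i) (swapn b j) = Pi w i j.
    have side c c' j' : (c = b /\ c' = b.+1) \/ (c = b.+1 /\ c' = b) ->
        (j' < M + n)%N -> j' != b -> j' != b.+1 -> Pi w c j' = Pi w c' j'.
      move=> cc jn jb jb1.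
      have z c0 : (c0 = b \/ c0 = b.+1) -> Pi w c0 j' = false.
        move=> c0b; have Lc0 : L (Pi w) 0 c0 by case: c0b => ->.
        have : (j' < c0)%N \/ (c0 < j')%N by case: c0b => ->; lia.
        by case=> ?; [exact: before|exact: after].
      by rewrite (z c) 1?(z c')//; case: cc => -[]; auto.
    move=> im jm; have [->|ib] := eqVneq i b.
      rewrite swapnL; have [->|jb] := eqVneq j b.
        by rewrite swapnL (eqE b b b).1 (eqE b.+1 b.+1 b.+1).1.
      have [->|jb1] := eqVneq j b.+1; first by rewrite swapnR (equiv_sym _ _ eqE).
      by rewrite swapn_neq//; apply: side => //; right.
    have [->|ib1] := eqVneq i b.+1.
      rewrite swapnR; have [->|jb] := eqVneq j b.
        by rewrite swapnL (equiv_sym _ _ eqE).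
      have [->|jb1] := eqVneq j b.+1.
        by rewrite swapnR (eqE b b b).1 (eqE b.+1 b.+1 b.+1).1.
      by rewrite swapn_neq//; apply: side => //; left.
    rewrite (swapn_neq ib ib1); have [->|jb] := eqVneq j b.
      rewrite swapnL (equiv_sym _ _ eqE) [RHS](equiv_sym _ _ eqE).
      by apply: side => //; right.
    have [->|jb1] := eqVneq j b.+1; last by rewrite swapn_neq.
    rewrite swapnR (equiv_sym _ _ eqE) [RHS](equiv_sym _ _ eqE).
    by apply: side => //; left.
  by split=> h i j im jn; rewrite -h// /relabel fixed// ltn_add2l.
have split_NB (Z : set rel_space) : measurable Z ->
    P (Pi @^-1` Z) = P (Pi @^-1` (NB `&` Z)) + P (Pi @^-1` (~` NB `&` Z)).
  move=> mZ; rewrite -measureU//.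
  - congr (P _); apply/seteqP; split=> w /=; last by case=> -[].
    by move=> Zw; have [?|?] := pselect (NB (Pi w)); [left|right].
  - by apply: mPi; exact: measurableI.
  - by apply: mPi; apply: measurableI => //; exact: measurableC.
  - by apply/seteqP; split=> w //= [[? _] [? _]].
have eqNB : P (Pi @^-1` (NB `&` X)) = P (Pi @^-1` (NB `&` Y)).
  exact: (pe_swap hPi hpe b mY).
have bound (Z Z' : set rel_space) : measurable Z -> measurable Z' ->
    (forall w, ~ NB (Pi w) -> ~ (mates b `|` mates b.+1) w -> Z (Pi w) -> Z' (Pi w)) ->
    P (Pi @^-1` (~` NB `&` Z)) <= P (Pi @^-1` (~` NB `&` Z')) + (n%:R%:E * m b + n%:R%:E * m b.+1).
  move=> mZ mZ' ZZ'.
  have mNZ' : measurable (Pi @^-1` (~` NB `&` Z')).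
    by apply: mPi; apply: measurableI => //; exact: measurableC.
  apply: (@le_trans _ _ (P (Pi @^-1` (~` NB `&` Z') `|` (mates b `|` mates b.+1)))).
    apply: le_measure; rewrite ?inE.
    - by apply: mPi; apply: measurableI => //; exact: measurableC.
    - by apply: measurableU => //; exact: measurableU.
    move=> w /= [nN Zw]; have [B|nB] := pselect ((mates b `|` mates b.+1) w).
      by right.
    by left; split=> //; exact: ZZ'.
  apply: le_trans (measureU2 _ _ _) _ => //; first exact: measurableU.
  by rewrite leeD2l.
rewrite (split_NB _ mX) (split_NB _ mY) eqNB -!addeA; split; rewrite leeD2l//.
  by apply: bound => // w nN nB /XY; apply.
by apply: bound => // w nN nB h; apply/XY.
Qed.

End stationary.

(** * Exchangeability and relabellings *)

Definition transp (x y i : nat) : nat :=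
  if i == x then y else if i == y then x else i.

Definition ord_ext n (s : {perm 'I_n}) (i : nat) : nat :=
  if insub i is Some i' then val (s i') else i.

Lemma ord_extE n (s : {perm 'I_n}) (i : 'I_n) : ord_ext s i = s i.
Proof. by rewrite /ord_ext insubT // => ?; congr (val (s _)); exact: val_inj. Qed.

Lemma ord_ext_ge n (s : {perm 'I_n}) i : (n <= i)%N -> ord_ext s i = i.
Proof. by move=> ni; rewrite /ord_ext insubF// ltnNge ni. Qed.

Lemma ord_extM n (s t : {perm 'I_n}) i :
  ord_ext (s * t)%g i = ord_ext t (ord_ext s i).
Proof.
have [ni|ni] := leqP n i; first by rewrite !ord_ext_ge.
by rewrite (ord_extE _ (Ordinal ni)) (ord_extE s (Ordinal ni)) ord_extE permM.
Qed.

Lemma ord_ext1 n i : ord_ext (1%g : {perm 'I_n}) i = i.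
Proof.
have [ni|ni] := leqP n i; first by rewrite !ord_ext_ge.
by rewrite (ord_extE _ (Ordinal ni)) perm1.
Qed.

Lemma ord_ext_tperm n (x y : 'I_n) i : ord_ext (tperm x y) i = transp x y i.
Proof.
rewrite /transp; have [ni|ni] := leqP n i.
  rewrite ord_ext_ge// !ifF//; apply/negP => /eqP ei.
    by move: ni; rewrite ei leqNgt ltn_ord.
  by move: ni; rewrite ei leqNgt ltn_ord.
rewrite (ord_extE _ (Ordinal ni)).
case: tpermP => [<-|<-|/eqP nx /eqP ny] /=; first by rewrite eqxx.
  by case: eqP => [->|_]; rewrite ?eqxx.
have {}nx : i != x by apply: contra nx => /eqP ix; apply/eqP/val_inj.
have {}ny : i != y by apply: contra ny => /eqP iy; apply/eqP/val_inj.
by rewrite (negPf nx) (negPf ny).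
Qed.

Section exchangeability.
Context d (T : measurableType d) (R : realType) (P : probability T R).
Variable Pi : T -> rel_space.
Hypotheses (hPi : random_partition Pi).
Local Open Scope ereal_scope.
Local Notation mPi := (measurable_Pi_preimage hPi).
Local Notation inv := (relabel_inv P Pi).

(** The error in [stationary_swap_bound] tends to 0 as the window moves to
    infinity. *)
Lemma stationary_swap (hpe : partially_exchangeable P Pi) :
  (forall k, inv (addn k)) -> forall a, inv (swapn a).
Proof.
move=> hinv a; apply: relabel_inv_ext => //; exists a.+2 => n e an eqe.
pose m k := P (Pi @^-1` new_with_mate k k.+1).
have mfin k : m k \is a fin_num.
  by rewrite fin_num_measure//; apply: mPi; exact: measurable_new_with_mate.
pose p := P [set w | agree n e (relabel (swapn a) (Pi w))].
pose q := P (Pi @^-1` agree n e).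
have pfin : p \is a fin_num.
  rewrite fin_num_measure//.
  apply: (mPi (S := [set E : rel_space | agree n e (relabel (swapn a) E)])).
  by apply: measurable_preimage_relabel; exact: measurable_agree.
have qfin : q \is a fin_num.
  by rewrite fin_num_measure//; apply: mPi; exact: measurable_agree.
pose err M := (n%:R * fine (m (M + a)%N) + n%:R * fine (m (M + a).+1))%R.
have err0 : err @ \oo --> (0%R : R).
  have m0 := @new_with_mate_cvg0 _ _ _ P Pi hPi hpe.
  rewrite -[0%R](_ : n%:R * 0 + n%:R * 0 = _)%R; last by rewrite mulr0 addr0.
  apply: cvgD; apply: cvgMr.
    by move: m0; rewrite -(cvg_shiftn a).
  move: m0; rewrite -(cvg_shiftn a.+1) /=.
  by under eq_fun do rewrite addnS.
have bnd M : (fine p <= fine q + err M)%R /\ (fine q <= fine p + err M)%R.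
  have [] := @stationary_swap_bound _ _ _ P Pi hPi hpe a n e M hinv an eqe.
  rewrite -/(m _) -/(m _) -/p -/q -(fineK pfin) -(fineK qfin).
  rewrite -(fineK (mfin (M + a)%N)) -(fineK (mfin (M + a).+1)).
  by rewrite -!EFinM -!EFinD !lee_fin.
have lim0 (c : R) : (fun M => c + err M)%R @ \oo --> c.
  by rewrite -[X in _ --> X]addr0; apply: cvgD => //; exact: cvg_cst.
suff h : fine p = fine q by change (p = q); rewrite -(fineK pfin) h fineK.
apply/eqP; rewrite eq_le; apply/andP; split.
  have <- := cvg_lim (@Rhausdorff R) (lim0 (fine q)).
  apply: limr_ge; first by apply/cvg_ex; eexists; exact: lim0.
  by apply: nearW => M; case: (bnd M).
have <- := cvg_lim (@Rhausdorff R) (lim0 (fine p)).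
apply: limr_ge; first by apply/cvg_ex; eexists; exact: lim0.
by apply: nearW => M; case: (bnd M).
Qed.

(** Transpositions are products of swaps of neighbours. *)
Lemma relabel_inv_transp : (forall a, inv (swapn a)) -> forall x y, inv (transp x y).
Proof.
move=> hs.
have lt x k : inv (transp x (x + k.+1)).
  elim: k => [|k IH]; first by rewrite addn1; exact: hs.
  apply: (@relabel_inv_eq _ _ _ _ _
    (swapn (x + k.+1) \o (transp x (x + k.+1) \o swapn (x + k.+1)))).
    move=> i; rewrite /transp /swapn /= [(x + k.+2)%N]addnS.
    set b := (x + k.+1)%N.
    have e1 : (b == x) = false by apply/negbTE; rewrite /b; lia.
    have e2 : (b.+1 == x) = false by apply/negbTE; rewrite /b; lia.
    have e3 : (b.+1 == b) = false by apply/negbTE; lia.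
    have e6 : (b == b.+1) = false by rewrite eq_sym.
    have e4 : (x == b) = false by rewrite eq_sym.
    have e5 : (x == b.+1) = false by rewrite eq_sym.
    case: (eqVneq i b) => [->|i1]; first by rewrite ?(eqxx, e1, e2, e3, e6).
    case: (eqVneq i b.+1) => [->|i2]; first by rewrite ?(eqxx, e1, e2, e3, e4, e5).
    case: (eqVneq i x) => [_|ix]; first by rewrite ?(eqxx, e1, e2, e3, e4, e5).
    by rewrite (negPf i1) (negPf i1) (negPf i2).
  by apply: relabel_inv_comp => //; apply: relabel_inv_comp.
move=> x y; case: (ltngtP x y) => [xy|yx|->].
- by have := lt x (y - x).-1; rewrite prednK ?subn_gt0// subnKC// ltnW.
- apply: (@relabel_inv_eq _ _ _ _ _ (transp y x)).
    by move=> i; rewrite /transp; case: eqP => [->|_]; case: eqP => // ->.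
  by have := lt y (x - y).-1; rewrite prednK ?subn_gt0// subnKC// ltnW.
- by apply: relabel_inv_id => i; rewrite /transp; case: eqP => [->|].
Qed.

Lemma relabel_inv_perm : (forall a, inv (swapn a)) ->
  forall n (s : {perm 'I_n}), inv (ord_ext s).
Proof.
move=> hs n s; have [ts -> _] := prod_tpermP s.
elim: ts => [|t ts IH].
  by rewrite big_nil; apply: relabel_inv_id => i; rewrite ord_ext1.
rewrite big_cons; apply: (@relabel_inv_eq _ _ _ _ _
  (ord_ext (\prod_(t <- ts) tperm t.1 t.2)%g \o transp t.1 t.2)).
  by move=> i; rewrite ord_extM ord_ext_tperm.
by apply: relabel_inv_comp => //; exact: relabel_inv_transp.
Qed.

Lemma perm_act_restr n (s : {perm 'I_n}) (E : rel_space) :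
  perm_act s (restr E n) = restr (relabel (ord_ext s^-1%g) E) n.
Proof.
have img (x : 'I_n) : [set s i | i in [set j : 'I_n | E x j]]%SET =
    [set j : 'I_n | relabel (ord_ext s^-1%g) E (s x) j]%SET.
  apply/setP => j; rewrite inE /relabel !ord_extE permK.
  apply/imsetP/idP => [[i]|Ej]; first by rewrite inE => Exi ->; rewrite permK.
  by exists (s^-1%g j); rewrite ?inE// permKV.
apply/setP => B; apply/imsetP/mem_restr.
  by move=> [C /mem_restr[x ->] ->]; exists (s x); rewrite img.
move=> [x ->]; exists [set j : 'I_n | E (s^-1%g x) j]%SET.
  by apply/mem_restr; exists (s^-1%g x).
by rewrite img permKV.
Qed.

Lemma relabel_inv_exchangeable : (forall a, inv (swapn a)) -> exchangeable P Pi.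
Proof.
move=> hs n s Q; have hinv := relabel_inv_perm hs (s^-1)%g.
have eqPi w : equivalence_rel (Pi w) by exact: hPi.1.
have main (e : rel_space) : equivalence_rel e -> Q = restr e n ->
    P [set w | perm_act s (restr (Pi w) n) = Q] = P [set w | restr (Pi w) n = Q].
  move=> eqe ->; have -> : [set w | restr (Pi w) n = restr e n] = Pi @^-1` agree n e.
    by apply/seteqP; split=> w /= h; [apply/restr_eqP|apply/esym/restr_eqP].
  rewrite -hinv; last exact: measurable_agree.
  congr (P _); apply/seteqP; split=> w /=; rewrite perm_act_restr => h.
    by apply/restr_eqP => //; exact: relabel_equiv.
  by apply/esym/restr_eqP => //; exact: relabel_equiv.
have [[w Qw]|nQ] := pselect (exists w, perm_act s (restr (Pi w) n) = Q).
  apply: (main (relabel (ord_ext s^-1%g) (Pi w))); first exact: relabel_equiv.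
  by rewrite -Qw perm_act_restr.
have [[w Qw]|nQ'] := pselect (exists w, restr (Pi w) n = Q); first exact: main (esym Qw).
congr (P _); apply/seteqP; split=> w /= h; exfalso.
  by apply: nQ; exists w.
by apply: nQ'; exists w.
Qed.

(** On the first m elements, for m >= N, the relabelling is a permutation. *)
Lemma exchangeable_relabel_inv (s : nat -> nat) N : exchangeable P Pi ->
  injective s -> (forall m i, (N <= m)%N -> (i < m)%N -> (s i < m)%N) -> inv s.
Proof.
move=> ex injs sN; apply: relabel_inv_ext => //; exists N => m e Nm eqe.
have eqPi w : equivalence_rel (Pi w) by exact: hPi.1.
pose f (i : 'I_m) : 'I_m := Ordinal (sN m i Nm (ltn_ord i)).
have injf : injective f by move=> i j /(congr1 val)/injs/val_inj.
pose t := (perm injf)^-1%g; have := ex m t (restr e m).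
have -> : [set w | restr (Pi w) m = restr e m] = Pi @^-1` agree m e.
  by apply/seteqP; split=> w /= h; [apply/restr_eqP|apply/esym/restr_eqP].
move=> <-; congr (P _).
have sE i : (i < m)%N -> ord_ext t^-1%g i = s i.
  by move=> im; rewrite (ord_extE _ (Ordinal im)) /t invgK permE.
apply/seteqP; split=> w /=; rewrite perm_act_restr => h.
  apply/esym/restr_eqP => //; first exact: relabel_equiv.
  by move=> i j im jm; rewrite -h// /relabel !sE.
have {h} : agree m e (relabel (ord_ext t^-1%g) (Pi w)).
  by apply/restr_eqP => //; exact: relabel_equiv.
by move=> h i j im jm; rewrite -h// /relabel !sE.
Qed.

Lemma rot_nat_inj m : injective (rot_nat m).
Proof.
move=> i j; rewrite /rot_nat.
by do 2 ![case: (ltnP _ m) => ?; last (case: eqP => ?)]; lia.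
Qed.

Lemma rot_nat_bound m k i : (m.+1 <= k)%N -> (i < k)%N -> (rot_nat m i < k)%N.
Proof.
by rewrite /rot_nat; case: (ltnP i m) => ?; last (case: eqP => ?); lia.
Qed.

Lemma exchangeable_rot m : exchangeable P Pi -> inv (rot_nat m).
Proof.
move=> ex; apply: (@exchangeable_relabel_inv _ m.+1) => //; first exact: rot_nat_inj.
by move=> k i; exact: rot_nat_bound.
Qed.

(** On the first m elements the shift by 1 agrees with [rot_nat m]. *)
Lemma exchangeable_shift : exchangeable P Pi -> forall n, inv (addn n).
Proof.
move=> ex; apply: relabel_inv_shift; apply: relabel_inv_ext => //.
exists 0%N => m e _ eqe; rewrite -(exchangeable_rot m ex); last exact: measurable_agree.
congr (P _); apply/seteqP; split=> w /= h i j im jm; rewrite -h// /relabel.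
  by rewrite !rot_nat_lt.
by rewrite !rot_nat_lt.
Qed.

End exchangeability.

(** * The random to top kernel and the reversed chain *)

Section random_to_top_kernel.
Variable R : realType.
Implicit Types x : seq_space R.

Lemma nneseries_shift (f : nat -> \bar R) : (forall r, 0 <= f r)%E ->
  (\sum_(0 <= r <oo) f r = f 0%N + \sum_(0 <= r <oo) f r.+1)%E.
Proof.
move=> f0; apply/cvg_lim => //; rewrite -(cvg_shiftn 1) /=.
under eq_fun do rewrite addn1 big_nat_recl//=.
apply: cvgeD.
- by rewrite ge0_adde_def// inE//; apply: nneseries_ge0.
- exact: cvg_cst.
- by apply: is_cvg_nneseries.
Qed.

Definition total (x : seq_space R) : R := limn (series (to_subprob x)).

Lemma total_cvg x : cvgn (series (to_subprob x)).
Proof.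
have [x0 x1] := (subprobP _).1 (subprob_to_subprob x).
apply: nondecreasing_is_cvgn.
  by apply/nondecreasing_seqP => n; rewrite /series /= big_nat_recr//= lerDl.
by exists 1 => _ [n _ <-]; exact: x1.
Qed.

Lemma totalE x : (\sum_(0 <= r <oo) (to_subprob x r)%:E = (total x)%:E)%E.
Proof.
apply/cvg_lim => //; under eq_fun do rewrite sumEFin.
by apply: cvg_EFin; [exact: nearW|exact: total_cvg].
Qed.

Lemma total_le1 x : total x <= 1.
Proof.
by rewrite -lee_fin -totalE; case: (subprob_to_subprob x).
Qed.

(** The index 0 stands for prepending a 0, and r + 1 for moving the entry of
    index r to the front. The truncation gives weights of sum 1 at every
    sequence. *)
Definition random_weight (r : nat) x : R :=
  if r is r'.+1 then to_subprob x r' else 1 - total x.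

Definition random_move (r : nat) x : seq_space R :=
  if r is r'.+1 then move_to_top r' x else prepend0 x.

Lemma measurable_to_subprob_coord j :
  measurable_fun [set: seq_space R] (fun x => to_subprob x j).
Proof. exact: (measurableT_comp (@measurable_coord R j) (@measurable_to_subprob R)). Qed.

Lemma measurable_random_weight r : measurable_fun [set: seq_space R] (random_weight r).
Proof.
case: r => [|r]; last exact: measurable_to_subprob_coord.
apply: measurable_funB => //.
apply: (@measurable_limn _ _ _ (fun N x => series (to_subprob x) N)) => N.
by apply: measurable_sum => j; exact: measurable_to_subprob_coord.
Qed.

Lemma measurable_random_move r : measurable_fun [set: seq_space R] (random_move r).
Proof.
case: r => [|r]; apply: measurable_seq_fun => j /=.
  by case: j => [|j] /=; [exact: measurable_cst|exact: measurable_coord].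
rewrite /move_to_top; case: (j == 0%N); first exact: measurable_coord.
by case: (j <= r)%N; exact: measurable_coord.
Qed.

Lemma random_weight_ge0 r x : 0 <= random_weight r x.
Proof.
case: r => [|r] /=; first by rewrite subr_ge0 total_le1.
by case: ((subprobP _).1 (subprob_to_subprob x)).
Qed.

Lemma random_weight_sum1 x : (\sum_(0 <= r <oo) (random_weight r x)%:E = 1)%E.
Proof.
rewrite nneseries_shift; last by move=> r; rewrite lee_fin random_weight_ge0.
by rewrite totalE -EFinD subrK.
Qed.

Lemma random_to_top_kernel_ex : exists K : R.-pker (seq_space R) ~> (seq_space R),
  (forall x B, K x B =
    \sum_(0 <= r <oo) (random_weight r x)%:E * \d_(random_move r x) B)%E /\
  (forall x, subprob x -> random_to_top_law x (K x)).
Proof.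
have [K hK] := mixture_kernel measurable_random_weight measurable_random_move
  random_weight_ge0 random_weight_sum1.
exists K; split=> // x sx B mB; rewrite hK.
have h0 r : (0 <= (random_weight r x)%:E * \d_(random_move r x) B)%E.
  by rewrite mule_ge0// lee_fin random_weight_ge0.
rewrite (nneseries_shift h0).
rewrite /= EFinB -totalE to_subprob_id//.
Qed.

End random_to_top_kernel.

(** Without the element 0, its cluster moves from the top to the place j, by
    [freqs_ret]; adding 0 brings it back. *)
Lemma freqs_joins_top (R : realType) (E : rel_space) j : equivalence_rel E ->
  joins 1 j 0 E -> freqs R E 0 = move_to_top j (freqs R E 1).
Proof.
move=> eqE J; have [i [Hi Ei]] := J.
have ex : exists k, returns E 0 k.
  by exists i; rewrite /returns (nth_least_nat_ge Hi) (equiv_sym _ _ eqE).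
case: (ex_minnP ex) => rho ret rmin.
have no k : (0 < k < rho)%N -> ~~ E 0 k.
  move=> /andP[k0 kr]; apply/negP => Ek.
  by have := rmin k; rewrite /returns k0 Ek => /(_ isT); rewrite leqNgt kr.
have /andP[rho0 Erho] := ret.
have cr := cnt_least_ret eqE ret no rho0; rewrite ltnn addn0 in cr.
have Hrho : is_nth_least E 1 (cnt (L E 1) rho) rho.
  by rewrite /is_nth_least (least_ret eqE ret no rho0) !eqxx orbT.
have jE : j = cnt (L E 1) rho.
  by apply: (joins_uniq eqE J); exists rho; rewrite (equiv_sym _ _ eqE).
by rewrite (freqs_ret R eqE ret no) cr -jE move_topK.
Qed.

Lemma freqs_not_joins (R : realType) (E : rel_space) : equivalence_rel E ->
  (forall j, ~ joins 1 j 0 E) -> freqs R E 0 = prepend0 (freqs R E 1).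
Proof.
move=> eqE nJ; have nr k : ~~ returns E 0 k.
  apply/negP => /andP[k0 Ek].
  have [i Li /andP[/andP[i1 ik] Eik]] := least_rep eqE k0.
  apply: (nJ (cnt (L E 1) i)); exists i; split.
    by rewrite /is_nth_least Li eqxx.
  by rewrite (equiv_sym _ _ eqE) (eqE 0%N k i).2// (equiv_sym _ _ eqE).
by rewrite freqs_noret// drop_topK// freqs_head no_return_freq.
Qed.

Section reversal.
Context d (T : measurableType d) (R : realType) (P : probability T R).
Variable Pi : T -> rel_space.
Hypotheses (hPi : random_partition Pi) (hpe : partially_exchangeable P Pi).
Local Open Scope ereal_scope.
Local Notation mPi := (measurable_Pi_preimage hPi).
Local Notation F n w := (freqs R (Pi w) n : seq_space R).

Lemma shift_same_law n : relabel_inv P Pi (addn n) ->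
  same_law P (fun w => F n w) (fun w => F 0%N w).
Proof.
move=> inv A mA; have mS := measurable_freqs_preimage 0 mA.
transitivity (P [set w | A (freqs R (relabel (addn n) (Pi w)) 0)]).
  apply: measure_ae_eq.
  - by rewrite -[X in measurable X]setTI; exact: (@measurable_freqs_Pi _ T R Pi hPi n).
  - exact: (mPi (measurable_preimage_relabel (addn n) mS)).
  have := has_freqs_ae hPi hpe; apply: filterS => w hw /=.
  by rewrite freqs_shift// addn0.
exact: (inv _ mS).
Qed.

Hypothesis ex : exchangeable P Pi.

Let law10 : same_law P (fun w => F 1%N w) (fun w => F 0%N w).
Proof. by apply: shift_same_law; exact: exchangeable_shift. Qed.

(** By exchangeability 0 may be placed after the elements 1, ..., m. If these
    meet the j-th cluster, 0 joins it according to the prediction rule; and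
    the j-th cluster is met by 1, ..., m for large m if there is one at all.
    *)
Lemma prob_joins_top j (C : set (seq_space R)) : measurable C ->
  P (Pi @^-1` ([set E : rel_space | C (freqs R E 1)] `&` joins 1 j 0)) =
  \int[P]_(w in (fun w => F 1%N w) @^-1` C) (to_subprob (F 1%N w) j)%:E.
Proof.
move=> mC.
pose S k : set rel_space := [set E : rel_space | C (freqs R E k)].
have mS k : measurable (S k) by exact: measurable_freqs_preimage.
have iS : tail_inv 0 (S 0%N) by exact: tail_inv_freqs.
pose J m : set rel_space :=
  [set E : rel_space | exists i, [/\ (i < m)%N, is_nth_least E 1 j i.+1 & E i.+1 0%N]].
pose A m : set rel_space := [set E : rel_space | (j < cnt (L E 0) m)%N].
have lA m : local_upto m (A m).
  by move=> E E' EE; rewrite /A /= (cnt_least_local _ EE).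
have mA m : measurable (A m) by exact: local_upto_measurable (lA m).
have mJ m : measurable (J m).
  apply: (@local_upto_measurable m.+1) => E E' EE [i [im Hi Ei]].
  by exists i; split=> //; [rewrite -(nth_least_local _ _ EE)|rewrite EE].
have mSJ m : measurable (Pi @^-1` (S 1%N `&` J m)).
  by apply: mPi; exact: measurableI.
have mSA m : measurable (Pi @^-1` (S 0%N `&` A m)).
  by apply: mPi; exact: measurableI.
have step m : P (Pi @^-1` (S 1%N `&` J m)) =
    \int[P]_(w in Pi @^-1` (S 0%N `&` A m)) (to_subprob (F 0%N w) j)%:E.
  rewrite -(prob_joins hPi hpe (leq0n m) (lA m))//.
  rewrite -[RHS](exchangeable_rot hPi m ex); last first.
    by do ?apply: measurableI => //; exact: measurable_joins.
  congr (P _); apply/seteqP; split=> w; have eqE := hPi.1 w.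
    move=> [Sw [i [im Hi Ei]]]; have Ei' : Pi w 0%N i.+1 by rewrite (equiv_sym _ _ eqE).
    have Hi' : is_nth_least (relabel (rot_nat m) (Pi w)) 0 j i.
      by rewrite (nth_least_rot eqE im Ei') rot_nat_lt.
    split; first by rewrite /S /= (freqs_rot R eqE im Ei').
    split; first exact: nth_least_lt Hi' im.
    by exists i; split=> //; rewrite /relabel rot_nat_lt// rot_natm.
  move=> /= [Sw [Aw [i [Hi Ei]]]].
  have im : (i < m)%N.
    by rewrite ltnNge; apply/negP => /(nth_least_ge Hi); rewrite leqNgt Aw.
  have Ei' : Pi w i.+1 0%N by move: Ei; rewrite /relabel rot_nat_lt// rot_natm.
  have Ei0 : Pi w 0%N i.+1 by rewrite (equiv_sym _ _ eqE).
  split; first by move: Sw; rewrite /S /= (freqs_rot R eqE im Ei0).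
  by exists i; split=> //; move: Hi; rewrite (nth_least_rot eqE im Ei0) rot_nat_lt.
have lhs : (fun m => P (Pi @^-1` (S 1%N `&` J m))) @ \oo -->
    P (Pi @^-1` (S 1%N `&` joins 1 j 0)).
  have -> : Pi @^-1` (S 1%N `&` joins 1 j 0) = \bigcup_m Pi @^-1` (S 1%N `&` J m).
    apply/seteqP; split=> w /=.
      move=> [Sw [i [Hi Ei]]]; have i1 := nth_least_nat_ge Hi.
      by exists i => //; split=> //; exists i.-1; rewrite prednK.
    by move=> [m _ [Sw [i [_ Hi Ei]]]]; split=> //; exists i.+1.
  apply: nondecreasing_cvg_mu => //; first exact: bigcupT_measurable.
  move=> m m' mm'; apply/subsetPset => w /= [Sw [i [im Hi Ei]]]; split=> //.
  by exists i; split=> //; exact: leq_trans mm'.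
have mg : measurable_fun [set: T] (fun w => (to_subprob (F 0%N w) j)%:E).
  apply/measurable_EFinP.
  exact: (@measurable_comp_freqs_Pi _ T R Pi hPi 0 (fun x => x j) (@measurable_coord R j)).
have rhs : (fun m => \int[P]_(w in Pi @^-1` (S 0%N `&` A m)) (to_subprob (F 0%N w) j)%:E)
    @ \oo --> \int[P]_(w in \bigcup_m Pi @^-1` (S 0%N `&` A m)) (to_subprob (F 0%N w) j)%:E.
  apply: ge0_nondecreasing_set_cvg_integral => //.
  - move=> m m' mm'; apply/subsetPset => w /= [Sw Aw]; split=> //.
    exact: leq_trans (cnt_homo _ mm').
  - by move=> m; exact: measurable_funTS.
  - by move=> m w _; rewrite lee_fin; exact: (random_weight_ge0 j.+1).
move: lhs; under eq_fun do rewrite step.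
move=> lhs; rewrite (cvg_unique (@ereal_hausdorff R) lhs rhs).
have mcj : measurable_fun [set: seq_space R] (fun x => (to_subprob x j)%:E).
  by apply/measurable_EFinP; exact: measurable_to_subprob_coord.
have h0 (x : seq_space R) : 0 <= (to_subprob x j)%:E.
  by rewrite lee_fin; exact: (random_weight_ge0 j.+1).
rewrite (@same_law_integral _ T R P _ _ C (fun x => (to_subprob x j)%:E) _ _ law10)//;
  try exact: measurable_freqs_Pi.
have mU : measurable (\bigcup_m Pi @^-1` (S 0%N `&` A m)) by exact: bigcupT_measurable.
rewrite integral_mkcond [RHS]integral_mkcond; apply: eq_integral => w _.
rewrite !patchE; case: ifPn => wU.
  rewrite ifT// inE; move: wU; rewrite inE => -[m _ [Sw _]]; exact: Sw.
(* if the j-th cluster never appears, its frequency is 0 by definition *)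
case: ifPn => // wC; apply/esym; congr (_%:E); rewrite /to_subprob freqs0 ?mul0r//.
move=> i; apply/negP => Hi; move: wU; rewrite notin_setE; apply.
exists i.+1 => //; split; first by move: wC; rewrite inE.
exact: nth_least_lt Hi _.
Qed.

(** The event that the move with index r leads from the sequence at time 1
    back to the one at time 0. *)
Let W (r : nat) : set rel_space :=
  if r is j.+1 then joins 1 j 0 else ~` \bigcup_j joins 1 j 0.

Let mW r : measurable (W r).
Proof.
case: r => [|j]; last exact: measurable_joins.
by apply: measurableC; apply: bigcupT_measurable => j; exact: measurable_joins.
Qed.

Lemma trivIset_W (S : set rel_space) : trivIset setT (fun r => Pi @^-1` (S `&` W r)).
Proof.
move=> [|j] [|j'] _ _ // [w [[_ h] [_ h']]].
- by exfalso; apply: h; exists j'.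
- by exfalso; apply: h'; exists j.
- by congr (_.+1); exact: joins_uniq (hPi.1 w) h h'.
Qed.

(** The case r = 0 follows from the others, as the sum over all r is P (F 1 in
    C) on both sides. *)
Lemma prob_random_move r (C : set (seq_space R)) : measurable C ->
  P (Pi @^-1` ([set E : rel_space | C (freqs R E 1)] `&` W r)) =
  \int[P]_(w in (fun w => F 1%N w) @^-1` C) (random_weight r (F 1%N w))%:E.
Proof.
case: r => [|j]; last exact: prob_joins_top.
move=> mC; pose S : set rel_space := [set E : rel_space | C (freqs R E 1)].
have mS : measurable S by exact: measurable_freqs_preimage.
have mPiS : measurable (Pi @^-1` S) by exact: mPi.
have mSW r : measurable (Pi @^-1` (S `&` W r)).
  by apply: mPi; apply: measurableI.
have mwt r : measurable_fun (Pi @^-1` S) (fun w => (random_weight r (F 1%N w))%:E).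
  apply/measurable_EFinP; apply: measurable_funTS.
  apply: (measurableT_comp (@measurable_random_weight R r)); exact: measurable_freqs_Pi.
have w0 r w : 0 <= (random_weight r (F 1%N w))%:E.
  by rewrite lee_fin random_weight_ge0.
have sumP : P (Pi @^-1` S) = \sum_(0 <= r <oo) P (Pi @^-1` (S `&` W r)).
  rewrite -measure_semi_bigcup//; last 2 first.
  - exact: trivIset_W.
  - exact: bigcupT_measurable.
  congr (P _); apply/seteqP; split=> w /=; last by case=> r _ [].
  move=> Sw; have [[j Jw]|nJ] := pselect (exists j, joins 1 j 0 (Pi w)).
    by exists j.+1.
  by exists 0%N => //; split=> // -[j _ Jw]; apply: nJ; exists j.
have sumI : P (Pi @^-1` S) =
    \sum_(0 <= r <oo) \int[P]_(w in Pi @^-1` S) (random_weight r (F 1%N w))%:E.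
  rewrite -integral_nneseries//.
  under eq_integral do rewrite random_weight_sum1.
  by rewrite integral_cst// mul1e.
have tail : \sum_(0 <= r <oo) P (Pi @^-1` (S `&` W r.+1)) =
    \sum_(0 <= r <oo) \int[P]_(w in Pi @^-1` S) (random_weight r.+1 (F 1%N w))%:E.
  by apply: eq_eseriesr => r _; exact: prob_joins_top.
have fin : \sum_(0 <= r <oo) P (Pi @^-1` (S `&` W r.+1)) \is a fin_num.
  rewrite ge0_fin_numE; last exact: nneseries_ge0.
  apply: (@le_lt_trans _ _ (P (Pi @^-1` S))).
    by rewrite sumP [leRHS]nneseries_shift// leeDr.
  exact: le_lt_trans (probability_le1 P mPiS) (ltry _).
rewrite -[LHS](addeK _ fin) -[RHS](addeK _ fin); congr (_ - _).
rewrite [RHS](_ : _ = P (Pi @^-1` S)).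
  by rewrite sumP [RHS]nneseries_shift.
rewrite sumI [RHS]nneseries_shift; first by rewrite tail.
by move=> r; apply: integral_ge0.
Qed.

Lemma random_to_top_step (A B : set (seq_space R)) : measurable A -> measurable B ->
  P ((fun w => F 1%N w) @^-1` A `&` (fun w => F 0%N w) @^-1` B) =
  \int[P]_(w in (fun w => F 1%N w) @^-1` A)
    \sum_(0 <= r <oo) (random_weight r (F 1%N w))%:E * \d_(random_move r (F 1%N w)) B.
Proof.
move=> mA mB; have mF : measurable_fun [set: T] (fun w => F 1%N w) by exact: measurable_freqs_Pi.
pose D r := [set x : seq_space R | B (random_move r x)].
have mD r : measurable (D r).
  by rewrite -[X in measurable X]setTI; exact: measurable_random_move.
have mYA : measurable ((fun w => F 1%N w) @^-1` A).
  by rewrite -[X in measurable X]setTI; exact: mF.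
have mAD r : measurable (A `&` D r) by exact: measurableI.
pose V r := Pi @^-1` ([set E : rel_space | (A `&` D r) (freqs R E 1)] `&` W r).
have mV r : measurable (V r).
  apply: mPi; apply: measurableI => //; exact: (measurable_freqs_preimage 1 (mAD r)).
transitivity (P (\bigcup_r V r)).
  congr (P _); apply/seteqP; split=> w; have eqE := hPi.1 w.
    move=> [Aw Bw]; have [[j Jw]|nJ] := pselect (exists j, joins 1 j 0 (Pi w)).
      by exists j.+1 => //; split=> //; split=> //; rewrite /D /= -freqs_joins_top.
    have nJ' j : ~ joins 1 j 0 (Pi w) by move=> Jw; apply: nJ; exists j.
    exists 0%N => //; split; last by move=> [j _]; exact: nJ'.
    by split=> //; rewrite /D /= -freqs_not_joins.
  move=> [[|j] _ [[Aw Dw] Ww]]; split=> //.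
    by rewrite /= freqs_not_joins// => j Jw; apply: Ww; exists j.
  by rewrite /= (freqs_joins_top R eqE Ww).
rewrite measure_semi_bigcup//; last 2 first.
- move=> r r' _ _ [w [[_ h] [_ h']]].
  by apply: (@trivIset_W setT r r') => //; exists w.
- exact: bigcupT_measurable.
rewrite integral_nneseries//; last 2 first.
- move=> r; apply: emeasurable_funM.
    apply/measurable_EFinP; apply: measurable_funTS.
    exact: (measurableT_comp (@measurable_random_weight R r) mF).
  apply/measurable_EFinP; apply: measurable_funTS.
  apply: (measurableT_comp (measurable_indic mB)).
  exact: (measurableT_comp (@measurable_random_move R r) mF).
- by move=> r w _; rewrite mule_ge0// lee_fin random_weight_ge0.
apply: eq_eseriesr => r _.
have dE w : \d_(random_move r (F 1%N w)) B =
    (\1_((fun w => F 1%N w) @^-1` D r) w)%:E :> \bar R by [].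
under eq_integral do rewrite dE.
rewrite /V prob_random_move// preimage_setI integral_mkcondr.
by apply: eq_integral => w _; rewrite epatch_indic.
Qed.

(** By [exchangeable_shift] the sequences at times n and n - 1 have the joint
    law of those at times 1 and 0. *)
Lemma freqs_reversed (K : R.-pker (seq_space R) ~> (seq_space R)) n :
  (forall x B, K x B =
    \sum_(0 <= r <oo) (random_weight r x)%:E * \d_(random_move r x) B) ->
  (1 <= n)%N -> cond_law P K (fun w => F n w) (fun w => F n.-1 w).
Proof.
move=> hK n1 A B mA mB; have inv k := exchangeable_shift hPi ex k.
have lawn1 : same_law P (fun w => F n w) (fun w => F 1%N w).
  by move=> C mC; rewrite law10// (shift_same_law (inv n)).
rewrite (@same_law_integral _ T R P _ _ A (fun x => K x B) _ _ lawn1)//; last 3 first.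
- exact: measurable_freqs_Pi.
- exact: measurable_freqs_Pi.
- exact: measurable_kernel.
under eq_integral do rewrite hK.
rewrite -random_to_top_step//.
pose S : set rel_space := [set E : rel_space | A (freqs R E 1)] `&`
  [set E : rel_space | B (freqs R E 0)].
have mS : measurable S by apply: measurableI; exact: measurable_freqs_preimage.
transitivity (P [set w | S (relabel (addn n.-1) (Pi w))]); last exact: (inv n.-1 S mS).
apply: measure_ae_eq.
- by apply: measurableI; rewrite -[X in measurable X]setTI;
    [exact: (@measurable_freqs_Pi _ T R Pi hPi n)|exact: (@measurable_freqs_Pi _ T R Pi hPi n.-1)].
- exact: (mPi (measurable_preimage_relabel (addn n.-1) mS)).
have := has_freqs_ae hPi hpe; apply: filterS => w hw.
by rewrite /S /= !freqs_shift// addn0 addn1 prednK.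
Qed.

End reversal.

(** * The corollary *)

Theorem corollary1p2 (d : measure_display) (T : measurableType d)
    (R : realType) (P : probability T R) (Pi : T -> rel nat)
    (hPi : random_partition Pi) (hpe : partially_exchangeable P Pi) :
  let F (n : nat) (w : T) : seq_space R := @freqs R (Pi w) n in
  [/\ (* (1) *)
      (exists K : R.-pker (seq_space R) ~> (seq_space R),
         (forall x, subprob x -> top_to_random_law x (K x)) /\
         markov_chain P (@subprob R) K F) /\
      (forall n : nat, (1 <= n)%N ->
         exists X : T -> nat,
           [/\ measurable_fun [set: T] X,
               (forall w, (1 <= X w)%N),
               {ae P, forall w, (F n.-1 w 0%N = 0)%R ->
                        F n w = drop_top (F n.-1 w)},
               {ae P, forall w, (0 < F n.-1 w 0%N)%R ->
                        F n w = move_top (X w) (F n.-1 w)} &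
               forall (j : nat) (B : set (seq_space R)),
                 (1 <= j)%N -> measurable B ->
                 P [set w | [/\ B (F n.-1 w), (0 < F n.-1 w 0%N)%R &
                                (j < X w)%N]] =
                 (\int[P]_(w in [set w | B (F n.-1 w) /\
                                         (0 < F n.-1 w 0%N)%R])
                    (top_gt_prob (F n.-1 w) j)%:E)%E]),
      (* (2) *)
      (exchangeable P Pi <-> same_law P (F 1%N) (F 0%N)) /\
      (exchangeable P Pi <->
         forall n : nat, (1 <= n)%N -> same_law P (F n) (F 0%N)) &
      (* (3) *)
      exchangeable P Pi ->
        exists K : R.-pker (seq_space R) ~> (seq_space R),
          (forall x, subprob x -> random_to_top_law x (K x)) /\
          (forall n : nat, (1 <= n)%N -> cond_law P K (F n) (F n.-1))].
Proof.
move=> F.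
have stat : same_law P (F 1%N) (F 0%N) -> exchangeable P Pi.
  move=> F10; apply: (relabel_inv_exchangeable hPi) => a.
  apply: (stationary_swap hPi hpe) => k; apply: relabel_inv_shift.
  exact: (shift_law hPi hpe F10).
have exch : exchangeable P Pi -> forall n, same_law P (F n) (F 0%N).
  by move=> ex n; apply: (shift_same_law hPi hpe); exact: exchangeable_shift.
split.
- split.
    have [K [hK law]] := top_to_random_kernel_ex R.
    by exists K; split=> //; exact: (freqs_markov_chain hPi hpe hK).
  move=> [//|n] _ /=; exists (fun w => top_position n (Pi w)); split.
  + exact: (measurableT_comp (measurable_top_position n) (measurable_Pi hPi)).
  + by move=> w; exact: top_position_gt0.
  + exact: (freqs_drop_ae hPi hpe).
  + by apply: aeW => w; exact: (freqs_move_top hPi).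
  + move=> j B _ mB.
    pose C : set (seq_space R) := B `&` [set x : seq_space R | 0 < x 0%N].
    have mC : measurable C.
      apply: measurableI => //; rewrite -[X in measurable X]setTI.
      have := @measurable_coord R 0 measurableT `]0, +oo[%classic (measurable_itv _).
      by congr measurable; apply/seteqP; split=> x /=; rewrite in_itv/= andbT => // -[].
    transitivity (P ((Pi : T -> rel_space) @^-1` ([set E : rel_space | C (freqs R E n)]
        `&` [set E : rel_space | (j < top_position n E)%N]))).
      by congr (P _); apply/seteqP; split=> w /= => [[]|[[]]].
    apply: (prob_top_position hPi hpe j (measurable_freqs_preimage n mC)
      (@tail_inv_freqs R n n C (leqnn n))).
    by move=> E [].
- split; first by split=> [/exch|/stat].
  by split=> [/exch h n _|h]; [exact: h|apply: stat; exact: h].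
- move=> ex; have [K [hK law]] := random_to_top_kernel_ex R.
  by exists K; split=> // n; exact: (freqs_reversed hPi hpe ex hK).
Qed.
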